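(* Let $k$ be a field of characteristic $p>0$, let $n\in\mathbb{Z}_{\ge0}$ and $\Lambda_n=[0,n]\cap(n+2\mathbb{Z})$. Define integers $p_{n,m}$ ($n\ge0$, $m\in\mathbb{Z}$) by $p_{0,m}=\delta_{0,m}$, $p_{n,m}=0$ for $m<0$, and $p_{n,m}=p_{n-1,m-1}+p_{n-1,m+1}$ for $n>0$, $m\ge0$. Define integers $p_{n,m}(p)$ by $p_{0,m}(p)=p_{0,m}$ for all $m$, $p_{n,m}(p)=0$ if $m<0$, and for $n>0$, $m\ge0$ $$p_{n,m}(p)=\begin{cases}\sum_{r\ge0}p_{n,\,p(r+1)-1}\,d_{r,s}&\text{if } m=p(s+1)-1>0 \text{ for some } s\ge0,\\ p_{n-1,m-1}(p)&\text{if } m>0 \text{ with } m\equiv-2\pmod p,\\ p_{n-1,m-1}(p)+p_{n-1,m+1}(p)&\text{otherwise,}\end{cases}$$ where $(d_{r,s})_{r,s\ge0}$ is the inverse of the matrix of Weyl multiplicities in the indecomposable tilting modules for $SL_2$ over $k$. Then the dimensions of the simple modules $D_n(m)$ of the Temperley-Lieb algebra $TL_n(2)$ over $k$ are given by $\dim_k D_n(m)=p_{n,m}(p)$ for all $m\in\Lambda_n$.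
   Context: $TL_n(2)$ is the Temperley-Lieb algebra over $k$ on $n$ strands with parameter $2=q+q^{-1}\in k$ for $q=1$. For the algebraic group $SL_2$ over $k$: $\Delta(m)$, $m\ge0$, is the Weyl module of highest weight $m$ (dimension $m+1$), $V=\Delta(1)$ is the natural $2$-dimensional module, and $T(m)$ is the indecomposable tilting module of highest weight $m$ (a module is tilting if both it and its dual have a filtration with Weyl modules as subquotients). $(M:\Delta(s))$ is the multiplicity of $\Delta(s)$ in a Weyl filtration of $M$. Put $c_{r,s}=(T(r):\Delta(s))$; the matrix $(c_{r,s})_{r,s\ge0}$ is lower triangular with $1$'s on the diagonal, and $(d_{r,s})_{r,s\ge0}$ denotes its inverse. There is a well-known isomorphism $TL_n(2)\simeq\mathrm{End}_{SL_2}(V^{\otimes n})$, by which the two algebras are identified. The algebra is cellular with cell modules $C_n(m)=\mathrm{Hom}_{SL_2}(\Delta(m),V^{\otimes n})$, $m\in\Lambda_n$. $D_n(m)$ denotes the head of $C_n(m)$; the cell modules have unique simple heads, and the modules $D_n(m)$, $m\in\Lambda_n$, are up to isomorphism the simple modules for $TL_n(2)$. *)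

(* Defs.v *)
From HB Require Import structures.
From mathcomp Require Import all_fingroup all_boot all_order all_algebra.
From mathcomp Require Import boolp zify ring.

Set Implicit Arguments.
Unset Strict Implicit.
Unset Printing Implicit Defensive.

Import GRing.Theory.
Local Open Scope ring_scope.
Local Open Scope quotient_scope.

Section VspaceOf.
Variables (k : fieldType) (V : vectType k).

Definition subspace_pred (P : V -> Prop) : Prop :=
  P 0 /\ forall (a : k) (x y : V), P x -> P y -> P (a *: x + y).

Lemma vspace_of_exists (P : V -> Prop) :
  subspace_pred P -> exists U : {vspace V}, forall x, x \in U <-> P x.
Proof.
case=> P0 PL.
pose Q d := `[< exists U : {vspace V}, \dim U = d /\ forall x, x \in U -> P x >].
have Q0 : Q 0%N.
  apply/asboolP; exists 0%VS; split; first exact: dimv0.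
  by move=> x; rewrite memv0 => /eqP ->.
have Qb d : Q d -> (d <= \dim {:V})%N.
  by move=> /asboolP[U [<- _]]; apply: dimvS; apply: subvf.
have exQ : exists d, Q d by exists 0%N.
case: (ex_maxnP exQ Qb) => d /asboolP[U [dU UP]] maxd.
exists U => x; split; first exact: UP.
move=> Px.
have : Q (\dim (U + <[x]>)%VS).
  apply/asboolP; exists (U + <[x]>)%VS; split=> // y /memv_addP[u Uu [v]].
  case/vlineP=> a -> ->; rewrite addrC; apply: PL => //; exact: UP.
move=> /maxd; rewrite -dU => le.
have /eqP eU : U == (U + <[x]>)%VS by rewrite eqEdim addvSl le.
by rewrite eU; apply: (subvP (addvSr U _)); apply: memv_line.
Qed.

(* The subspace of the vectors satisfying [P]; meaningful if [P] is a
   [subspace_pred], see [mem_vspace_of]. *)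
Definition vspace_of (P : V -> Prop) : {vspace V} :=
  if pselect (subspace_pred P) is left h
  then projT1 (cid (vspace_of_exists h)) else 0%VS.

Lemma mem_vspace_of (P : V -> Prop) :
  subspace_pred P -> forall x, x \in vspace_of P <-> P x.
Proof. by rewrite /vspace_of; case: pselect => // h _; case: cid. Qed.

End VspaceOf.

Record fdmod (k : fieldType) (A : algType k) := FDMod {
  fdsort :> vectType k;
  fdact : A -> fdsort -> fdsort;
  fdact1 : forall x, fdact 1 x = x;
  fdactM : forall a b x, fdact (a * b) x = fdact a (fdact b x);
  fdactPl : forall (c : k) a b x,
    fdact (c *: a + b) x = c *: fdact a x + fdact b x;
  fdactPr : forall (c : k) a x y,
    fdact a (c *: x + y) = c *: fdact a x + fdact a y
}.

Section FdMod.
Variables (k : fieldType) (A : algType k).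
Implicit Types M : fdmod A.

Definition fddim M : nat := \dim {: M}.

Definition submodule M (U : {vspace M}) : Prop :=
  forall (a : A) x, x \in U -> fdact a x \in U.

Definition maximal_submodule M (U : {vspace M}) : Prop :=
  [/\ submodule U, U <> fullv &
      forall W : {vspace M}, submodule W -> (U <= W)%VS -> W = U \/ W = fullv].

Definition radical M : {vspace M} :=
  vspace_of (fun x => forall U : {vspace M}, maximal_submodule U -> x \in U).

Lemma mem_radical M x :
  x \in radical M <-> forall U : {vspace M}, maximal_submodule U -> x \in U.
Proof.
apply: mem_vspace_of; split=> [U _|a u v hu hv U mU]; first exact: mem0v.
by apply: memvD; [apply: memvZ; apply: hu | apply: hv].
Qed.

Lemma radical_submodule M : submodule (radical M).
Proof.
move=> a x /mem_radical hx; apply/mem_radical => U mU.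
by have [sU _ _] := mU; apply: sU; apply: hx.
Qed.

(* The quotient M / U is realised on a complement of U; [quot_proj] below is
   the quotient map. *)
Section Quotient.
Variables (M : fdmod A) (U : {vspace M}) (sU : submodule U).

Definition quot_sort : vectType k := subvs_of (U^C)%VS.
Definition quot_proj (x : M) : quot_sort := vsproj (U^C)%VS (daddv_pi (U^C)%VS U x).
Definition quot_act (a : A) (x : quot_sort) : quot_sort :=
  quot_proj (fdact a (vsval x)).

Lemma quot_proj_linear : linear quot_proj.
Proof. by move=> c x y; rewrite /quot_proj !linearP. Qed.

Lemma quot_cap0 : (U^C :&: U)%VS = 0%VS.
Proof. by rewrite capvC capv_compl. Qed.

Lemma quot_full : (U^C + U)%VS = fullv.
Proof. by rewrite addvC addv_complf. Qed.

Lemma quot_projK x : vsval (quot_proj x) - x \in U.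
Proof.
rewrite /quot_proj vsprojK ?memv_pi //.
have {2}<- : daddv_pi (U^C)%VS U x + daddv_pi U (U^C)%VS x = x.
  by apply: daddv_pi_add; rewrite ?quot_cap0 // quot_full memvf.
by rewrite opprD addNKr memvN memv_pi.
Qed.

Lemma quot_proj_eq0 x : quot_proj x = 0 <-> x \in U.
Proof.
split=> h.
  have := quot_projK x; rewrite h.
  by rewrite (_ : vsval (0 : quot_sort) = 0) // sub0r memvN.
apply: val_inj; apply/eqP.
rewrite -[X in _ == X]/(0 : M) -memv0 -quot_cap0 memv_cap.
rewrite subvsP /= -[X in X \in U](subrK x).
by apply: memvD => //; apply: quot_projK.
Qed.

Lemma quot_proj_eq x y : x - y \in U -> quot_proj x = quot_proj y.
Proof.
move=> h; have e : x = 1 *: (x - y) + y by rewrite scale1r subrK.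
by rewrite e quot_proj_linear scale1r; move/quot_proj_eq0: h => ->; rewrite add0r.
Qed.

Lemma quot_proj_val (x : quot_sort) : quot_proj (vsval x) = x.
Proof.
apply: val_inj => /=; apply/eqP; rewrite -subr_eq0 -memv0 -quot_cap0 memv_cap.
by rewrite quot_projK andbT; apply: rpredB; apply: subvsP.
Qed.

Lemma fdactB (N : fdmod A) a (x y : N) : fdact a (x - y) = fdact a x - fdact a y.
Proof. by rewrite addrC -scaleN1r fdactPr scaleN1r addrC. Qed.

Lemma quot_proj_act a x : quot_proj (fdact a x) = quot_act a (quot_proj x).
Proof.
apply: quot_proj_eq; rewrite -fdactB; apply: sU.
by rewrite -memvN opprB quot_projK.
Qed.

Lemma quot_act1 x : quot_act 1 x = x.
Proof. by rewrite /quot_act fdact1 quot_proj_val. Qed.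

Lemma quot_actM a b x : quot_act (a * b) x = quot_act a (quot_act b x).
Proof. by rewrite {1}/quot_act fdactM quot_proj_act. Qed.

Lemma quot_actPl (c : k) a b x :
  quot_act (c *: a + b) x = c *: quot_act a x + quot_act b x.
Proof. by rewrite /quot_act fdactPl quot_proj_linear. Qed.

Lemma quot_actPr (c : k) a x y :
  quot_act a (c *: x + y) = c *: quot_act a x + quot_act a y.
Proof. by rewrite /quot_act linearP fdactPr quot_proj_linear. Qed.

Definition quotient_module : fdmod A :=
  FDMod quot_act1 quot_actM quot_actPl quot_actPr.

End Quotient.

Definition head M : fdmod A := quotient_module (radical_submodule (M := M)).

End FdMod.

Inductive tlterm (k : Type) (n : nat) : Type :=
| TLgen of 'I_n.-1
| TLscal of k
| TLadd of tlterm k n & tlterm k n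
| TLmul of tlterm k n & tlterm k n.

Arguments TLgen {k n} _.
Arguments TLscal {k n} _.

HB.instance Definition _ k n := gen_eqMixin (tlterm k n).
HB.instance Definition _ k n := gen_choiceMixin (tlterm k n).

(* The smallest congruence that makes the terms a k-algebra (scalars being
   identified with multiples of the unit) and in which the generators e_i,
   0 <= i < n-1, satisfy the Temperley-Lieb relations. *)
Inductive tleq (k : fieldType) (n : nat) (delta : k) :
  tlterm k n -> tlterm k n -> Prop :=
| TLrefl x : tleq delta x x
| TLsym x y : tleq delta x y -> tleq delta y x
| TLtrans y x z : tleq delta x y -> tleq delta y z -> tleq delta x z
| TLaddCong x x' y y' : tleq delta x x' -> tleq delta y y' ->
    tleq delta (TLadd x y) (TLadd x' y')
| TLmulCong x x' y y' : tleq delta x x' -> tleq delta y y' ->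
    tleq delta (TLmul x y) (TLmul x' y')
| TLaddA x y z : tleq delta (TLadd x (TLadd y z)) (TLadd (TLadd x y) z)
| TLaddC x y : tleq delta (TLadd x y) (TLadd y x)
| TLadd0 x : tleq delta (TLadd (TLscal 0) x) x
| TLaddN x : tleq delta (TLadd (TLmul (TLscal (-1)) x) x) (TLscal 0)
| TLmulA x y z : tleq delta (TLmul x (TLmul y z)) (TLmul (TLmul x y) z)
| TLmul1 x : tleq delta (TLmul (TLscal 1) x) x
| TLmulDl x y z :
    tleq delta (TLmul (TLadd x y) z) (TLadd (TLmul x z) (TLmul y z))
| TLmulDr x y z :
    tleq delta (TLmul x (TLadd y z)) (TLadd (TLmul x y) (TLmul x z))
| TLscalD a b : tleq delta (TLscal (a + b)) (TLadd (TLscal a) (TLscal b))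
| TLscalM a b : tleq delta (TLscal (a * b)) (TLmul (TLscal a) (TLscal b))
| TLscalC a x : tleq delta (TLmul (TLscal a) x) (TLmul x (TLscal a))
| TLrelSq i :
    tleq delta (TLmul (TLgen i) (TLgen i)) (TLmul (TLscal delta) (TLgen i))
| TLrelAdj (i j : 'I_n.-1) : (i.+1 == j :> nat) || (j.+1 == i :> nat) ->
    tleq delta (TLmul (TLmul (TLgen i) (TLgen j)) (TLgen i)) (TLgen i)
| TLrelFar (i j : 'I_n.-1) : (i.+1 < j)%N || (j.+1 < i)%N ->
    tleq delta (TLmul (TLgen i) (TLgen j)) (TLmul (TLgen j) (TLgen i)).

Definition tl_relations (k : fieldType) (n : nat) (delta : k) (d : nat)
    (E : 'I_n.-1 -> 'M[k]_d) : Prop :=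
  [/\ forall i, E i *m E i = delta *: E i,
      forall i j : 'I_n.-1, (i.+1 == j :> nat) || (j.+1 == i :> nat) ->
        E i *m E j *m E i = E i &
      forall i j : 'I_n.-1, (i.+1 < j)%N || (j.+1 < i)%N ->
        E i *m E j = E j *m E i].

Section TLAlgebra.
Variables (k : fieldType) (n : nat) (delta : k).
Notation term := (tlterm k n).

Fixpoint tleval d (E : 'I_n.-1 -> 'M[k]_d) (t : term) : 'M[k]_d :=
  match t with
  | TLgen i => E i
  | TLscal a => a%:M
  | TLadd x y => tleval E x + tleval E y
  | TLmul x y => tleval E x *m tleval E y
  end.

Lemma tleval_eq d (E : 'I_n.-1 -> 'M[k]_d) x y :
  tl_relations delta E -> tleq delta x y -> tleval E x = tleval E y.
Proof.
case=> r1 r2 r3; elim=> //=.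
- by move=> ? ? ? _ -> _ ->.
- by move=> ? ? ? ? _ -> _ ->.
- by move=> ? ? ? ? _ -> _ ->.
- by move=> ? ? ?; rewrite addrA.
- by move=> ? ?; rewrite addrC.
- by move=> ?; rewrite raddf0 add0r.
- by move=> ?; rewrite mul_scalar_mx scaleN1r addNr raddf0.
- by move=> ? ? ?; rewrite mulmxA.
- by move=> ?; rewrite mul1mx.
- by move=> ? ? ?; rewrite mulmxDl.
- by move=> ? ? ?; rewrite mulmxDr.
- by move=> ? ?; rewrite raddfD.
- by move=> ? ?; rewrite -scalar_mxM.
- by move=> ? ?; rewrite scalar_mxC.
- by move=> ?; rewrite mul_scalar_mx.
Qed.

Definition tleqb : rel term := fun x y => `[< tleq delta x y >].

Lemma tleqb_equiv : equiv_class_of tleqb.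
Proof.
split=> [x|x y|y x z]; first exact/asboolP/TLrefl.
- by apply/asboolP/asboolP; apply: TLsym.
- by move=> /asboolP h1 /asboolP h2; apply/asboolP; apply: TLtrans h1 h2.
Qed.
Canonical tleqb_equivRel := EquivRelPack tleqb_equiv.

Definition TL := {eq_quot tleqb}.
HB.instance Definition _ : EqQuotient term tleqb TL := EqQuotient.on TL.
HB.instance Definition _ := Choice.on TL.

Lemma tl_pi_eq x y : tleq delta x y -> \pi_TL x = \pi_TL y.
Proof. by move=> h; apply/eqmodP/asboolP. Qed.

Lemma tl_piP x y : \pi_TL x = \pi_TL y -> tleq delta x y.
Proof. by move/eqmodP/asboolP. Qed.

Lemma tl_repr x : tleq delta (repr (\pi_TL x)) x.
Proof. by apply: tl_piP; rewrite reprK. Qed.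

Definition tl_add (x y : TL) : TL := \pi_TL (TLadd (repr x) (repr y)).
Definition tl_mul (x y : TL) : TL := \pi_TL (TLmul (repr x) (repr y)).
Definition tl_scal (a : k) : TL := \pi_TL (TLscal a).
Definition tl_opp (x : TL) : TL := tl_mul (tl_scal (-1)) x.
Definition tl_gen (i : 'I_n.-1) : TL := \pi_TL (TLgen i).

Lemma tl_addE x y : tl_add (\pi_TL x) (\pi_TL y) = \pi_TL (TLadd x y).
Proof. by apply: tl_pi_eq; apply: TLaddCong; apply: tl_repr. Qed.

Lemma tl_mulE x y : tl_mul (\pi_TL x) (\pi_TL y) = \pi_TL (TLmul x y).
Proof. by apply: tl_pi_eq; apply: TLmulCong; apply: tl_repr. Qed.

Lemma tl_addrA : associative tl_add.
Proof.
by elim/quotW=> x; elim/quotW=> y; elim/quotW=> z;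
  rewrite (tl_addE y z) (tl_addE x y) !tl_addE;
  apply: tl_pi_eq; apply: TLaddA.
Qed.
Lemma tl_addrC : commutative tl_add.
Proof.
by elim/quotW=> x; elim/quotW=> y; rewrite !tl_addE; apply: tl_pi_eq; apply: TLaddC.
Qed.
Lemma tl_add0r : left_id (tl_scal 0) tl_add.
Proof. by elim/quotW=> x; rewrite tl_addE; apply: tl_pi_eq; apply: TLadd0. Qed.
Lemma tl_addNr : left_inverse (tl_scal 0) tl_opp tl_add.
Proof.
by elim/quotW=> x; rewrite /tl_opp (tl_mulE _ x) tl_addE; apply: tl_pi_eq; apply: TLaddN.
Qed.
HB.instance Definition _ := GRing.isZmodule.Build TL tl_addrA tl_addrC tl_add0r tl_addNr.

Lemma tl_mulrA : associative tl_mul.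
Proof.
by elim/quotW=> x; elim/quotW=> y; elim/quotW=> z;
  rewrite (tl_mulE y z) (tl_mulE x y) !tl_mulE;
  apply: tl_pi_eq; apply: TLmulA.
Qed.
Lemma tl_mul1r : left_id (tl_scal 1) tl_mul.
Proof. by elim/quotW=> x; rewrite tl_mulE; apply: tl_pi_eq; apply: TLmul1. Qed.
Lemma tl_scalC a x : tl_mul (tl_scal a) x = tl_mul x (tl_scal a).
Proof. by elim/quotW: x => x; rewrite !tl_mulE; apply: tl_pi_eq; apply: TLscalC. Qed.
Lemma tl_mulr1 : right_id (tl_scal 1) tl_mul.
Proof. by move=> x; rewrite -tl_scalC tl_mul1r. Qed.
Lemma tl_mulrDl : left_distributive tl_mul tl_add.
Proof.
by elim/quotW=> x; elim/quotW=> y; elim/quotW=> z;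
  rewrite (tl_addE x y) (tl_mulE x z) (tl_mulE y z) tl_mulE tl_addE;
  apply: tl_pi_eq; apply: TLmulDl.
Qed.
Lemma tl_mulrDr : right_distributive tl_mul tl_add.
Proof.
by elim/quotW=> x; elim/quotW=> y; elim/quotW=> z;
  rewrite (tl_addE y z) (tl_mulE x y) (tl_mulE x z) tl_mulE tl_addE;
  apply: tl_pi_eq; apply: TLmulDr.
Qed.
Lemma tl_relations0 : tl_relations (n := n) delta (fun _ => 0 : 'M[k]_1).
Proof. by split=> *; rewrite ?mul0mx ?scaler0 ?mulmx0. Qed.
Lemma tl_oner_neq0 : tl_scal 1 != tl_scal 0.
Proof.
apply/eqP => /tl_piP /(tleval_eq tl_relations0) /= /matrixP /(_ 0 0).
by rewrite !mxE => /eqP; rewrite oner_eq0.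
Qed.
HB.instance Definition _ := GRing.Zmodule_isNzRing.Build TL
  tl_mulrA tl_mul1r tl_mulr1 tl_mulrDl tl_mulrDr tl_oner_neq0.

Definition tl_scale (a : k) (x : TL) : TL := tl_mul (tl_scal a) x.

Lemma tl_scalM a b : tl_scal (a * b) = tl_mul (tl_scal a) (tl_scal b).
Proof. by rewrite tl_mulE; apply: tl_pi_eq; apply: TLscalM. Qed.
Lemma tl_scalD a b : tl_scal (a + b) = tl_add (tl_scal a) (tl_scal b).
Proof. by rewrite tl_addE; apply: tl_pi_eq; apply: TLscalD. Qed.
Lemma tl_scalerA a b x : tl_scale a (tl_scale b x) = tl_scale (a * b) x.
Proof. by rewrite /tl_scale tl_mulrA tl_scalM. Qed.
Lemma tl_scale1r : left_id 1 tl_scale.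
Proof. exact: tl_mul1r. Qed.
Lemma tl_scalerDr : right_distributive tl_scale +%R.
Proof. by move=> a x y; apply: tl_mulrDr. Qed.
Lemma tl_scalerDl x : {morph tl_scale^~ x : a b / a + b}.
Proof. by move=> a b; rewrite /tl_scale tl_scalD; apply: tl_mulrDl. Qed.
HB.instance Definition _ := GRing.Zmodule_isLmodule.Build k TL
  tl_scalerA tl_scale1r tl_scalerDr tl_scalerDl.

Lemma tl_scalerAl (a : k) (x y : TL) : a *: (x * y) = (a *: x) * y.
Proof. exact: tl_mulrA. Qed.
HB.instance Definition _ := GRing.Lmodule_isLalgebra.Build k TL tl_scalerAl.

Lemma tl_scalerAr (a : k) (x y : TL) : a *: (x * y) = x * (a *: y).
Proof.
rewrite -[LHS]/(tl_mul (tl_scal a) (tl_mul x y)) tl_mulrA tl_scalC.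
by rewrite -[RHS]/(tl_mul x (tl_mul (tl_scal a) y)) tl_mulrA.
Qed.
HB.instance Definition _ := GRing.Lalgebra_isAlgebra.Build k TL tl_scalerAr.

Section Representation.
Variables (d : nat) (E : 'I_n.-1 -> 'M[k]_d) (rE : tl_relations delta E).

Definition tl_rep (x : TL) : 'M[k]_d := tleval E (repr x).

Lemma tl_rep_pi t : tl_rep (\pi_TL t) = tleval E t.
Proof. by apply: tleval_eq => //; apply: tl_repr. Qed.
Lemma tl_rep_gen i : tl_rep (tl_gen i) = E i.
Proof. exact: tl_rep_pi. Qed.
Lemma tl_rep1 : tl_rep 1 = 1%:M.
Proof. exact: tl_rep_pi. Qed.
Lemma tl_repD x y : tl_rep (x + y) = tl_rep x + tl_rep y.
Proof. exact: tl_rep_pi. Qed.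
Lemma tl_repM x y : tl_rep (x * y) = tl_rep x *m tl_rep y.
Proof. exact: tl_rep_pi. Qed.
Lemma tl_repZ (a : k) x : tl_rep (a *: x) = a *: tl_rep x.
Proof.
rewrite -mul_scalar_mx -[a *: x]/(tl_mul (tl_scal a) x) -[LHS]/(tl_rep (tl_scal a * x)).
by rewrite tl_repM; congr (_ *m _); apply: tl_rep_pi.
Qed.
Lemma tl_repP (a : k) x y : tl_rep (a *: x + y) = a *: tl_rep x + tl_rep y.
Proof. by rewrite tl_repD tl_repZ. Qed.
End Representation.

End TLAlgebra.

(* A morphism of k-group functors SL_2 -> GL_d: for every commutative k-algebra
   A an action of SL_2(A) on A^d (columns), naturally in A.  The value of
   [slact] on matrices of determinant different from 1 is irrelevant. *)
Record SL2mod (k : fieldType) := SL2Mod {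
  sldim : nat;
  slact : forall A : comAlgType k, 'M[A]_2 -> 'M[A]_sldim;
  slact1 : forall A : comAlgType k, slact (1%:M : 'M[A]_2) = 1%:M;
  slactM : forall (A : comAlgType k) (g h : 'M[A]_2), \det g = 1 -> \det h = 1 ->
    slact (g *m h) = slact g *m slact h;
  slact_nat : forall (A B : comAlgType k) (f : {lrmorphism A -> B}) (g : 'M[A]_2),
    \det g = 1 -> map_mx f (slact g) = slact (map_mx f g)
}.

Section SL2.
Variable k : fieldType.
Implicit Types M N : SL2mod k.

Definition ext (A : comAlgType k) m n (X : 'M[k]_(m, n)) : 'M[A]_(m, n) :=
  map_mx (in_alg A) X.

(* Homomorphisms M -> N, as matrices acting on columns. *)
Definition SL2hom M N (X : 'M[k]_(sldim N, sldim M)) : Prop :=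
  forall (A : comAlgType k) (g : 'M[A]_2), \det g = 1 ->
    ext A X *m slact M g = slact N g *m ext A X.

Lemma SL2hom_subspace M N : subspace_pred (@SL2hom M N).
Proof.
split=> [A g _|a X Y hX hY A g dg].
  by rewrite /ext raddf0 mul0mx mulmx0.
have e : ext A (a *: X + Y) = (in_alg A a) *: ext A X + ext A Y.
  by apply/matrixP=> i j; rewrite !mxE rmorphD rmorphM.
by rewrite e mulmxDl mulmxDr -scalemxAl -scalemxAr hX // hY.
Qed.

Definition Hom_SL2 M N : {vspace 'M[k]_(sldim N, sldim M)} :=
  vspace_of (@SL2hom M N).

Lemma mem_Hom_SL2 M N X : X \in Hom_SL2 M N <-> SL2hom X.
Proof. exact: (mem_vspace_of (SL2hom_subspace M N)). Qed.

Lemma SL2hom_comp L M N (Y : 'M_(sldim N, sldim M)) (X : 'M_(sldim M, sldim L)) :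
  SL2hom Y -> SL2hom X -> @SL2hom L N (Y *m X).
Proof.
by move=> hY hX A g dg; rewrite /ext map_mxM -mulmxA hX // mulmxA hY // mulmxA.
Qed.

Definition SL2iso M N : Prop :=
  exists (X : 'M[k]_(sldim N, sldim M)) (Y : 'M[k]_(sldim M, sldim N)),
    [/\ SL2hom X, SL2hom Y, X *m Y = 1%:M & Y *m X = 1%:M].

Section DirectSum.
Variables M N : SL2mod k.
Definition dsum_act (A : comAlgType k) (g : 'M[A]_2) : 'M[A]_(sldim M + sldim N) :=
  block_mx (slact M g) 0 0 (slact N g).
Lemma dsum_act1 (A : comAlgType k) : dsum_act (1%:M : 'M[A]_2) = 1%:M.
Proof. by rewrite /dsum_act !slact1 -scalar_mx_block. Qed.
Lemma dsum_actM (A : comAlgType k) (g h : 'M[A]_2) : \det g = 1 -> \det h = 1 ->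
  dsum_act (g *m h) = dsum_act g *m dsum_act h.
Proof.
move=> dg dh; rewrite /dsum_act mulmx_block !mul0mx !mulmx0 !addr0 !add0r.
by rewrite !slactM.
Qed.
Lemma dsum_act_nat (A B : comAlgType k) (f : {lrmorphism A -> B}) (g : 'M[A]_2) :
  \det g = 1 -> map_mx f (dsum_act g) = dsum_act (map_mx f g).
Proof. by move=> dg; rewrite /dsum_act map_block_mx !raddf0 !slact_nat. Qed.
Definition dsum : SL2mod k := SL2Mod dsum_act1 dsum_actM dsum_act_nat.
End DirectSum.

(* For det g = 1 one has g^-1 = \adj g. *)
Section Dual.
Variable M : SL2mod k.
Definition dual_act (A : comAlgType k) (g : 'M[A]_2) : 'M[A]_(sldim M) :=
  (slact M (\adj g))^T.
Lemma adj_SL2 (A : comAlgType k) (g h : 'M[A]_2) : \det g = 1 -> g *m h = 1%:M ->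
  \adj g = h.
Proof. by move=> dg e; rewrite -[LHS]mulmx1 -e mulmxA mul_adj_mx dg mul1mx. Qed.
Lemma det_adj_SL2 (A : comAlgType k) (g : 'M[A]_2) : \det g = 1 -> \det (\adj g) = 1.
Proof.
by move=> dg; rewrite -[LHS]mul1r -{1}dg -det_mulmx mul_mx_adj dg det1.
Qed.
Lemma dual_act1 (A : comAlgType k) : dual_act (1%:M : 'M[A]_2) = 1%:M.
Proof.
by rewrite /dual_act (@adj_SL2 _ _ 1%:M) ?det1 ?mulmx1 // slact1 trmx1.
Qed.
Lemma dual_actM (A : comAlgType k) (g h : 'M[A]_2) : \det g = 1 -> \det h = 1 ->
  dual_act (g *m h) = dual_act g *m dual_act h.
Proof.
move=> dg dh; rewrite /dual_act -trmx_mul -slactM ?det_adj_SL2 //.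
congr (_^T); congr (slact _ _); apply: adj_SL2.
  by rewrite det_mulmx dg dh mulr1.
by rewrite mulmxA -(mulmxA g) mul_mx_adj dh mulmx1 mul_mx_adj dg.
Qed.
Lemma dual_act_nat (A B : comAlgType k) (f : {lrmorphism A -> B}) (g : 'M[A]_2) :
  \det g = 1 -> map_mx f (dual_act g) = dual_act (map_mx f g).
Proof.
by move=> dg; rewrite /dual_act -map_trmx slact_nat ?det_adj_SL2 // map_mx_adj.
Qed.
Definition dual : SL2mod k := SL2Mod dual_act1 dual_actM dual_act_nat.
End Dual.

(* Sym^m of the natural module, in the basis x^(m-j) y^j (0 <= j <= m) of binary
   forms: g maps x to g00 x + g10 y and y to g01 x + g11 y.  The polynomials
   below are the dehomogenisations x = 1, y = 'X. *)
Section Sym.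
Variable m : nat.
Section Ring.
Variable A : comNzRingType.
Implicit Types g h : 'M[A]_2.

Definition linform g (j : 'I_2) : {poly A} := (g 0 j)%:P + g 1 j *: 'X.
Definition sym_form g (j : nat) : {poly A} :=
  linform g 0 ^+ (m - j) * linform g 1 ^+ j.
Definition sym_mx g : 'M[A]_m.+1 := \matrix_(i, j) (sym_form g j)`_i.
End Ring.

Section Lemmas.
Variable A : comNzRingType.
Implicit Types g h : 'M[A]_2.

Lemma size_lin (u v : A) : (size (u%:P + v *: 'X)%R <= 2)%N.
Proof.
apply: (leq_trans (size_polyD _ _)); rewrite geq_max (leq_trans (size_polyC_leq1 _)) //.
by rewrite (leq_trans (size_scale_leq _ _)) // size_polyX.
Qed.

Lemma size_mul_linX t s (q : {poly A}) u v : (size q <= t.+1)%N ->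
  (size (q * (u%:P + v *: 'X) ^+ s)%R <= (s + t).+1)%N.
Proof.
move=> sq; elim: s => [|s IH]; first by rewrite mulr1.
rewrite exprSr mulrA (leq_trans (size_polyMleq _ _)) //.
by move: (leq_add IH (size_lin u v)); rewrite addn2 addSn; case: (_ + _)%N.
Qed.

(* If q is a product of t linear forms u + v y, then its homogenisation of
   degree t, evaluated at (F, G), is the product of the u F + v G. *)
Definition homog t (q F G : {poly A}) : {poly A} :=
  \sum_(l < t.+1) q`_l *: (F ^+ (t - l) * G ^+ l).

Lemma homogM t (q F G : {poly A}) u v : (size q <= t.+1)%N ->
  homog t.+1 (q * (u%:P + v *: 'X)) F G = homog t q F G * (u *: F + v *: G).
Proof.
move=> sq; rewrite /homog mulrDr mulrDr -scalerAr.
under eq_bigr => l _ do rewrite coefD coefMC coefZ coefMX scalerDl.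
rewrite big_split /=; congr (_ + _).
  rewrite big_ord_recr /= [q`_t.+1]nth_default // mul0r scale0r addr0.
  rewrite mulr_suml; apply: eq_bigr => l _.
  rewrite -scalerAl -scalerAr scalerA; congr (_ *: _).
  by rewrite subSn -1?ltnS // exprS -mulrA mulrC.
rewrite big_ord_recl /= mulr0 scale0r add0r mulr_suml; apply: eq_bigr => l _.
rewrite /bump /= add1n -scalerAl -scalerAr scalerA mulrC; congr (_ *: _).
by rewrite subSS exprSr mulrA.
Qed.

Lemma homogX t s (q F G : {poly A}) u v : (size q <= t.+1)%N ->
  homog (s + t) (q * (u%:P + v *: 'X) ^+ s) F G = homog t q F G * (u *: F + v *: G) ^+ s.
Proof.
move=> sq; elim: s => [|s IH]; first by rewrite !expr0 !mulr1.
rewrite !exprSr !mulrA addSn homogM ?IH // {IH}.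
exact: size_mul_linX.
Qed.

Lemma linformM g h j : linform (g *m h) j = h 0 j *: linform g 0 + h 1 j *: linform g 1.
Proof.
rewrite /linform !mxE !big_ord_recl !big_ord0 /= !addr0.
have -> : lift ord0 ord0 = 1 :> 'I_2 by apply: val_inj.
rewrite !scalerDr !scalerA !scalerDl !polyCD !polyCM -!mul_polyC.
by rewrite !polyCM (mulrC (h 0 j)%:P (g 0 0)%:P) (mulrC (h 1 j)%:P (g 0 1)%:P)
  (mulrC (h 0 j)%:P (g 1 0)%:P) (mulrC (h 1 j)%:P (g 1 1)%:P) addrACA.
Qed.

Lemma sym_mxM g h : sym_mx (g *m h) = sym_mx g *m sym_mx h.
Proof.
apply/matrixP=> i j; rewrite !mxE.
have jm : (j <= m)%N by rewrite -ltnS.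
have e : sym_form (g *m h) j = homog m (sym_form h j) (linform g 0) (linform g 1).
  have ej q F G : homog m q F G = homog (j + (m - j)) q F G by rewrite subnKC.
  have e0 q F G : homog (m - j) q F G = homog ((m - j) + 0) q F G by rewrite addn0.
  rewrite /sym_form !linformM ej.
  rewrite homogX; last first.
    have := @size_mul_linX 0 (m - j) 1 (h 0 0) (h 1 0).
    by rewrite mul1r addn0 size_poly1; apply.
  congr (_ * _); rewrite -(mul1r (linform h 0 ^+ _)).
  rewrite e0 homogX ?size_poly1 // /homog big_ord_recl big_ord0 /=.
  by rewrite !expr0 coef1 /= mulr1 scale1r addr0 mul1r.
rewrite e /homog coef_sum; apply: eq_bigr => l _.
by rewrite !mxE coefZ mulrC.
Qed.

Lemma sym_mx1 : sym_mx (1%:M : 'M[A]_2) = 1%:M.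
Proof.
apply/matrixP=> i j; rewrite !mxE /sym_form /linform !mxE /=.
by rewrite scale0r addr0 scale1r polyC0 add0r expr1n mul1r coefXn.
Qed.
End Lemmas.

Lemma sym_mx_nat (A B : comNzRingType) (f : {rmorphism A -> B}) (g : 'M[A]_2) :
  map_mx f (sym_mx g) = sym_mx (map_mx f g).
Proof.
apply/matrixP=> i j; rewrite !mxE -coef_map /sym_form rmorphM !rmorphXn /=.
have e l : map_poly f (linform g l) = linform (map_mx f g) l.
  by rewrite /linform rmorphD /= map_polyC linearZ /= map_polyX !mxE.
by rewrite !e.
Qed.

Definition Sym : SL2mod k :=
  @SL2Mod k m.+1 (fun A g => sym_mx g) (fun A => sym_mx1 A)
    (fun A g h _ _ => sym_mxM g h) (fun A B f g _ => sym_mx_nat f g).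
End Sym.

(* The Weyl module of highest weight m is the dual of the induced module
   H^0(m) = Sym^m(V). *)
Definition Weyl (m : nat) : SL2mod k := dual (Sym m).

Definition short_exact M' M M'' (i : 'M[k]_(sldim M, sldim M'))
    (q : 'M[k]_(sldim M'', sldim M)) : Prop :=
  [/\ SL2hom i, SL2hom q,
      injective (fun v : 'cV[k]_(sldim M') => i *m v),
      forall w : 'cV[k]_(sldim M''), exists v : 'cV[k]_(sldim M), w = q *m v &
      forall v : 'cV[k]_(sldim M), q *m v = 0 <-> exists u : 'cV[k]_(sldim M'), v = i *m u].

(* [weyl_filtration M ws]: M has a finite filtration by submodules whose
   successive subquotients, from the top, are Weyl modules with the highest
   weights listed in ws. *)
Inductive weyl_filtration : SL2mod k -> seq nat -> Prop :=
| WeylNil M : sldim M = 0%N -> weyl_filtration M [::]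
| WeylCons M' M s ws i q :
    @short_exact M' M (Weyl s) i q -> weyl_filtration M' ws ->
    weyl_filtration M (s :: ws).

(* (M : Delta(s)) = a *)
Definition weyl_mult M (s a : nat) : Prop :=
  exists2 ws, weyl_filtration M ws & a = count_mem s ws.

Definition tilting M : Prop :=
  (exists ws, weyl_filtration M ws) /\ (exists ws, weyl_filtration (dual M) ws).

Definition indecomposable M : Prop :=
  (0 < sldim M)%N /\
  forall N1 N2, SL2iso M (dsum N1 N2) -> sldim N1 = 0%N \/ sldim N2 = 0%N.

(* diag(t, u), where u is the inverse of t *)
Definition torus (A : comAlgType k) (t u : A) : 'M[A]_2 :=
  diag_mx (\row_j if j == 0 then t else u).

Definition torus_char (A : comAlgType k) (t u : A) (r : int) : A :=
  match r with Posz a => t ^+ a | Negz a => u ^+ a.+1 end.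

Definition weight_vector M (r : int) (v : 'cV[k]_(sldim M)) : Prop :=
  forall (A : comAlgType k) (t u : A), t * u = 1 ->
    slact M (torus t u) *m ext A v = torus_char t u r *: ext A v.

Definition is_weight M (r : int) : Prop :=
  exists2 v : 'cV[k]_(sldim M), v <> 0 & weight_vector r v.

Definition highest_weight M (m : nat) : Prop :=
  is_weight M m%:Z /\ forall r : int, is_weight M r -> (r <= m%:Z)%R.

(* M is (isomorphic to) T(m) *)
Definition indecomposable_tilting M (m : nat) : Prop :=
  [/\ tilting M, indecomposable M & highest_weight M m].

End SL2.

Section Tensor.
Variables (k : fieldType) (n : nat).

Definition word := {ffun 'I_n -> 'I_2}.
Notation N := #|{: word}|.

(* V^{(x) n}, in the basis e_w = e_(w 0) (x) ... (x) e_(w (n-1)). *)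
Definition tens_mx (A : comNzRingType) (g : 'M[A]_2) : 'M[A]_N :=
  \matrix_(i, j) \prod_(t < n) g ((enum_val i : word) t) ((enum_val j : word) t).

Lemma tens_mx1 (A : comNzRingType) : tens_mx (1%:M : 'M[A]_2) = 1%:M.
Proof.
apply/matrixP=> i j; rewrite !mxE -(inj_eq enum_val_inj).
case: eqP => [->|ne].
  by apply: big1 => t _; rewrite mxE eqxx.
have [t nt] : exists t, (enum_val i : word) t != (enum_val j : word) t.
  apply/existsP; rewrite -negb_forall; apply: contra_notN ne => /forallP h.
  by apply/ffunP=> t; apply/eqP.
by rewrite (bigD1 t) //= mxE (negPf nt) mul0r.
Qed.

Lemma tens_mxM (A : comNzRingType) (g h : 'M[A]_2) :
  tens_mx (g *m h) = tens_mx g *m tens_mx h.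
Proof.
apply/matrixP=> i j; rewrite !mxE.
under eq_bigr => t _ do rewrite mxE.
rewrite bigA_distr_bigA /= (reindex (fun l : 'I_N => enum_val l : word)) /=; last first.
  by exists enum_rank => x _; rewrite ?enum_valK ?enum_rankK.
by apply: eq_bigr => l _; rewrite !mxE -big_split.
Qed.

Lemma tens_mx_nat (A B : comNzRingType) (f : {rmorphism A -> B}) (g : 'M[A]_2) :
  map_mx f (tens_mx g) = tens_mx (map_mx f g).
Proof.
apply/matrixP=> i j; rewrite !mxE rmorph_prod.
by apply: eq_bigr => t _; rewrite mxE.
Qed.

Definition tensV : SL2mod k :=
  @SL2Mod k N (fun A g => tens_mx g) (fun A => tens_mx1 A)
    (fun A g h _ _ => tens_mxM g h) (fun A B f g _ => tens_mx_nat f g).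

Lemma strand_lo_subproof (i : 'I_n.-1) : (i < n)%N.
Proof. by have := ltn_ord i; rewrite ltn_predRL; apply: ltnW. Qed.
Lemma strand_hi_subproof (i : 'I_n.-1) : (i.+1 < n)%N.
Proof. by rewrite -ltn_predRL. Qed.
Definition strand_lo (i : 'I_n.-1) : 'I_n := Ordinal (strand_lo_subproof i).
Definition strand_hi (i : 'I_n.-1) : 'I_n := Ordinal (strand_hi_subproof i).

Definition swap_word (i : 'I_n.-1) (w : word) : word :=
  [ffun t => w (tperm (strand_lo i) (strand_hi i) t)].

Definition word_mx (R : nzRingType) (f : word -> word) : 'M[R]_N :=
  \matrix_(x, y) ((enum_val x : word) == f (enum_val y))%:R.

(* The operator by which e_i acts under the identification of TL_n(2) with
   End_{SL_2}(V^{(x) n}): on the tensor factors i and i+1 it is the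
   map v (x) w |-> v (x) w - w (x) v, that is, the composite of
   V (x) V -> k, e_a (x) e_b |-> det (e_a, e_b) and
   k -> V (x) V, 1 |-> e_0 (x) e_1 - e_1 (x) e_0. *)
Definition tl_op (i : 'I_n.-1) : 'M[k]_N := 1%:M - word_mx k (swap_word i).

Lemma word_mxM (R : nzRingType) f g : word_mx R f *m word_mx R g = word_mx R (f \o g).
Proof.
apply/matrixP=> x y; rewrite !mxE (bigD1 (enum_rank (g (enum_val y)))) //= big1.
  by rewrite addr0 !mxE enum_rankK eqxx mulr1.
move=> l nl; rewrite !mxE; case: (enum_val l =P g (enum_val y)) => [e|_].
  by case/eqP: nl; rewrite -e enum_valK.
by rewrite mulr0.
Qed.

Lemma word_mx_id (R : nzRingType) : word_mx R id = 1%:M.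
Proof. by apply/matrixP=> x y; rewrite !mxE (inj_eq enum_val_inj). Qed.

Lemma eq_word_mx (R : nzRingType) f g : f =1 g -> word_mx R f = word_mx R g.
Proof. by move=> e; apply/matrixP=> x y; rewrite !mxE e. Qed.

Lemma swap_wordK i : involutive (swap_word i).
Proof. by move=> w; apply/ffunP=> t; rewrite !ffunE tpermK. Qed.

Lemma swap_word_fix i (w : word) :
  w (strand_lo i) = w (strand_hi i) -> swap_word i w = w.
Proof.
by move=> e; apply/ffunP=> t; rewrite !ffunE; case: tpermP => // ->.
Qed.

Lemma swap_word_far (i j : 'I_n.-1) (w : word) : (i.+1 < j)%N || (j.+1 < i)%N ->
  swap_word i (swap_word j w) = swap_word j (swap_word i w).
Proof.
move=> far; apply/ffunP=> t; rewrite !ffunE; congr (w _).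
have [h1 h2 h3 h4] : [/\ strand_lo j != strand_lo i, strand_lo j != strand_hi i,
    strand_hi j != strand_lo i & strand_hi j != strand_hi i].
  by split; rewrite -(inj_eq val_inj) /=; move: far; lia.
case: (tpermP (strand_lo i) (strand_hi i) t) => [->|->|/eqP n1 /eqP n2].
- by rewrite (tpermD h2 h4) (tpermD h1 h3) tpermL.
- by rewrite (tpermD h1 h3) (tpermD h2 h4) tpermR.
case: (tpermP (strand_lo j) (strand_hi j) t) => [_|_|_ _].
- by rewrite tpermD // eq_sym.
- by rewrite tpermD // eq_sym.
by rewrite tpermD // eq_sym.
Qed.

Lemma tperm_braid (a b c : 'I_n) : a != c -> b != c ->
  (tperm a b * tperm b c * tperm a b)%g = tperm a c.
Proof.
move=> ac bc; have := tpermJ b c (tperm a b).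
by rewrite conjgE tpermV tpermR tpermD // mulgA => ->.
Qed.

Lemma swap_word_adj (i j : 'I_n.-1) (w : word) :
  (i.+1 == j :> nat) || (j.+1 == i :> nat) ->
  let s := swap_word i in let t := swap_word j in
  [\/ s w = w, t w = w | s (t (s w)) = w] /\ s (t (s w)) = t (s (t w)).
Proof.
have adj (i' j' : 'I_n.-1) : i'.+1 == j' :> nat ->
    let s := swap_word i' in let t := swap_word j' in
    [\/ s w = w, t w = w | s (t (s w)) = w] /\ s (t (s w)) = t (s (t w)).
  move=> /eqP e s t; set a := strand_lo i'; set b := strand_hi i'.
  set c := strand_hi j'.
  have eb : strand_lo j' = b by apply: val_inj; rewrite /= e.
  have ab : a != b by rewrite -(inj_eq val_inj) /=; lia.
  have ac : a != c by rewrite -(inj_eq val_inj) /=; lia.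
  have bc : b != c by rewrite -(inj_eq val_inj) /=; lia.
  have sts : s (t (s w)) = [ffun x => w (tperm a c x)].
    by apply/ffunP=> x; rewrite !ffunE eb -/a -/b -/c -(tperm_braid ac bc) !permM.
  have tst : t (s (t w)) = [ffun x => w (tperm a c x)].
    apply/ffunP=> x; rewrite !ffunE eb -/a -/b -/c (tpermC a c).
    have ca : c != a by rewrite eq_sym.
    have ba : b != a by rewrite eq_sym.
    by rewrite -(tperm_braid ca ba) !permM (tpermC c b) (tpermC b a).
  split; last by rewrite sts tst.
  have two (x y z : 'I_2) : [\/ x = y, y = z | x = z].
    have [->|xy] := eqVneq x y; first by constructor 1.
    have [->|yz] := eqVneq y z; first by constructor 2.
    constructor 3; apply: val_inj; move: xy yz (ltn_ord x) (ltn_ord y) (ltn_ord z).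
    by rewrite -!(inj_eq val_inj) /=; lia.
  case: (two (w a) (w b) (w c)) => h.
  - by constructor 1; apply: swap_word_fix.
  - by constructor 2; apply: swap_word_fix; rewrite eb.
  - constructor 3; rewrite sts; apply/ffunP=> x; rewrite !ffunE.
    by case: tpermP => // ->.
case/orP; first exact: adj.
move=> /adj /=; set s := swap_word i; set t := swap_word j.
by case=> [[h|h|h] e]; split; rewrite ?e //;
  [constructor 2 | constructor 1 | constructor 3; rewrite -e].
Qed.

Lemma tl_op_relations : tl_relations (2%:R : k) tl_op.
Proof.
split=> [i|i j adj|i j far]; rewrite /tl_op.
- rewrite mulmxBl mul1mx mulmxBr mulmx1 word_mxM (eq_word_mx _ (swap_wordK i)).
  by rewrite word_mx_id opprB -mulr2n scaler_nat.
- set S := word_mx k (swap_word i); set T := word_mx k (swap_word j).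
  have SS : S *m S = 1%:M by rewrite word_mxM (eq_word_mx _ (swap_wordK i)) word_mx_id.
  have antisym : 1%:M - S - T + S *m T + T *m S - S *m T *m S = 0.
    rewrite !word_mxM -word_mx_id; apply/matrixP=> x y; rewrite !mxE.
    have [[] h e] := swap_word_adj (enum_val y) adj; rewrite /= in h e *.
    + by rewrite !h; ring.
    + by rewrite e !h; ring.
    + have h1 : swap_word j (swap_word i (enum_val y)) = swap_word i (enum_val y).
        by rewrite -[LHS](swap_wordK i) h.
      have h2 : swap_word i (swap_word j (enum_val y)) = swap_word j (enum_val y).
        by rewrite -[LHS](swap_wordK j) -e h.
      by rewrite h h1 h2; ring.
  rewrite !(mulmxBl, mulmxBr, mul1mx, mulmx1) SS.
  apply/matrixP=> x y; move/matrixP: antisym => /(_ x y); rewrite !word_mxM !mxE => antisym.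
  by apply/eqP; rewrite -subr_eq0 -antisym; apply/eqP; ring.
- rewrite !(mulmxBl, mulmxBr, mul1mx, mulmx1, word_mxM).
  rewrite (eq_word_mx _ (fun w => swap_word_far w far)) !opprB.
  by apply/matrixP=> x y; rewrite !mxE; ring.
Qed.

Lemma word_mx_swap_tens (A : comNzRingType) (g : 'M[A]_2) (i : 'I_n.-1) :
  word_mx A (swap_word i) *m tens_mx g = tens_mx g *m word_mx A (swap_word i).
Proof.
apply/matrixP=> x y; rewrite !mxE.
rewrite (bigD1 (enum_rank (swap_word i (enum_val x)))) //= big1 => [|l nl]; last first.
  rewrite !mxE; case: eqP => [e|_]; last by rewrite mul0r.
  by case/eqP: nl; rewrite e swap_wordK enum_valK.
rewrite [RHS](bigD1 (enum_rank (swap_word i (enum_val y)))) //= big1 => [|l nl]; last first.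
  rewrite !mxE; case: eqP => [e|_]; last by rewrite mulr0.
  by case/eqP: nl; rewrite -e enum_valK.
rewrite !addr0 !mxE !enum_rankK swap_wordK !eqxx mul1r mulr1.
rewrite (reindex_inj (@perm_inj _ (tperm (strand_lo i) (strand_hi i)))) /=.
by apply: eq_bigr => t _; rewrite !ffunE tpermK.
Qed.

Lemma tl_op_hom (i : 'I_n.-1) : @SL2hom k tensV tensV (tl_op i).
Proof.
move=> A g dg; rewrite /= /ext /tl_op.
have -> : map_mx (in_alg A) (1%:M - word_mx k (swap_word i)) =
          1%:M - word_mx A (swap_word i).
  by apply/matrixP=> x y; rewrite !mxE rmorphB !rmorph_nat.
by rewrite mulmxBl mulmxBr mul1mx mulmx1 word_mx_swap_tens.
Qed.

Definition tl_tens : TL n (2%:R : k) -> 'M[k]_N := tl_rep tl_op.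

Lemma tl_tens_hom (a : TL n (2%:R : k)) : @SL2hom k tensV tensV (tl_tens a).
Proof.
rewrite /tl_tens /tl_rep; elim: (repr a) => /= [i|c|x hx y hy|x hx y hy].
- exact: tl_op_hom.
- by move=> A g dg; rewrite /ext map_scalar_mx scalar_mxC.
- have [_ hL] := SL2hom_subspace tensV tensV.
  by rewrite -[tleval _ x]scale1r; apply: hL.
- exact: (@SL2hom_comp k tensV tensV tensV _ _ hx hy).
Qed.

(* C_n(m) = Hom_{SL_2}(Delta(m), V^{(x) n}); TL_n(2) acts through its action on
   the target. *)
Section CellModule.
Variable m : nat.

Definition cell_sort : vectType k := subvs_of (Hom_SL2 (Weyl k m) tensV).

Definition cell_act (a : TL n (2%:R : k)) (X : cell_sort) : cell_sort :=
  vsproj (Hom_SL2 (Weyl k m) tensV) (tl_tens a *m vsval X).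

Lemma cell_actE a X : vsval (cell_act a X) = tl_tens a *m vsval X.
Proof.
rewrite /cell_act vsprojK //; apply/mem_Hom_SL2.
by apply: (SL2hom_comp (@tl_tens_hom a)); apply/mem_Hom_SL2/subvsP.
Qed.

Lemma cell_act1 X : cell_act 1 X = X.
Proof.
by apply: val_inj; rewrite /= cell_actE /tl_tens (tl_rep1 tl_op_relations) mul1mx.
Qed.

Lemma cell_actM a b X : cell_act (a * b) X = cell_act a (cell_act b X).
Proof.
apply: val_inj; rewrite /= !cell_actE /tl_tens (tl_repM tl_op_relations).
by rewrite mulmxA.
Qed.

Lemma cell_actPl (c : k) a b X :
  cell_act (c *: a + b) X = c *: cell_act a X + cell_act b X.
Proof.
apply: val_inj.
change (vsval (cell_act (c *: a + b) X) =
        c *: vsval (cell_act a X) + vsval (cell_act b X)).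
rewrite !cell_actE /tl_tens (tl_repP tl_op_relations).
by rewrite mulmxDl -scalemxAl.
Qed.

Lemma cell_actPr (c : k) a X Y :
  cell_act a (c *: X + Y) = c *: cell_act a X + cell_act a Y.
Proof.
apply: val_inj.
change (vsval (cell_act a (c *: X + Y)) =
        c *: vsval (cell_act a X) + vsval (cell_act a Y)).
by rewrite !cell_actE -[vsval (_ + _)]/(c *: vsval X + vsval Y) mulmxDr -scalemxAr.
Qed.

Definition cell_module : fdmod (TL n (2%:R : k)) :=
  FDMod cell_act1 cell_actM cell_actPl cell_actPr.

(* D_n(m).  If p = 2 and n > 0 is even, the cellular form of C_n(0) vanishes, but
   C_n(0) still has a simple head, isomorphic to D_n(2). *)
Definition simple_module : fdmod (TL n (2%:R : k)) := head cell_module.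

End CellModule.

End Tensor.

Definition Lambda (n : nat) : pred nat :=
  [pred m | (m <= n)%N && (odd m == odd n)].

Fixpoint path_number (n : nat) (m : int) : int :=
  match n with
  | 0%N => (m == 0)%:Z
  | n'.+1 => if m < 0 then 0
             else path_number n' (m - 1) + path_number n' (m + 1)
  end.

(* d is the inverse of the infinite lower unitriangular matrix c; both matrices
   being lower triangular, the entries of the two products are finite sums. *)
Definition inverse_lower (c : nat -> nat -> nat) (d : nat -> nat -> int) : Prop :=
  [/\ forall r s, (r < s)%N -> d r s = 0,
      forall r s, \sum_(j < r.+1) (c r j)%:Z * d j s = (r == s)%:Z &
      forall r s, \sum_(j < r.+1) d r j * (c j s)%:Z = (r == s)%:Z].

(* In the first nontrivial case m = p (s + 1) - 1 with s = (m + 1) / p - 1, and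
   the sum over r >= 0 is finite since path_number n m' = 0 for m' > n. *)
Fixpoint p_path_number (p : nat) (d : nat -> nat -> int) (n : nat) (m : int) : int :=
  match n with
  | 0%N => path_number 0 m
  | n'.+1 =>
    if m < 0 then 0
    else if (0 < m) && (p %| m + 1)%Z then
      \sum_(r < n'.+2)
        path_number n'.+1 ((p * r.+1)%:Z - 1) * d r (absz (m + 1)%R %/ p).-1
    else if (0 < m) && (m == -2 %[mod p])%Z then
      p_path_number p d n' (m - 1)
    else p_path_number p d n' (m - 1) + p_path_number p d n' (m + 1)
  end.

(* Main.v *)
Require Import Defs.
From HB Require Import structures.
From mathcomp Require Import all_fingroup all_boot all_order all_algebra.
From mathcomp Require Import boolp zify ring mxtens.

Set Implicit Arguments.
Unset Strict Implicit.
Unset Printing Implicit Defensive.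

Import GRing.Theory.
Local Open Scope ring_scope.

(** Let W n be the n-th tensor power of the natural module V, built by
    tensoring with V on the left, and let H(n, m) be its space of highest weight
    vectors of weight m.  Evaluation at the highest weight vector of Delta(m)
    identifies C_n(m) with H(n, m), so everything takes place inside W n.

    The head.  The standard basis of W n is orthonormal for a symmetric bilinear
    form for which the Temperley-Lieb generators are self-adjoint.  The space
    H(n, m) is spanned by the vectors x e_0^m with x a product of cups
    ([HW_span]), and x y^T lies in the Temperley-Lieb algebra for two such
    products.  Hence a vector outside the radical of the form on H(n, m) generates
    H(n, m).  If m > 0 or n = 0 the form is not zero, and the head has dimension
    D(n, m), the rank of the form ([fddim_Rad]).  If m = 0 < n the form may vanish,
    but H(n, 0) is isomorphic to H(n - 1, 1) and the form of the latter takes over: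
    the head has dimension D(n - 1, 1) ([fddim_zero]).

    Away from the walls.  If m + 1 is invertible in k then every vector of
    H(n, m + 1) lifts canonically to H(n + 1, m); the lifts are orthogonal to
    H(n, m - 1) and the form is multiplied by (m + 2) / (m + 1).  This gives
    D(n + 1, m) = D(n, m - 1) + D(n, m + 1), the last term being dropped when
    m = -2 mod p ([Ddim_rec]): these are the second and third cases of the
    recursion.

    On the walls m = p (s + 1) - 1.  Let tw M be the tensor product of the Frobenius
    twist of M with the Steinberg module Delta(p - 1).  The functor tw is fully
    faithful ([tw_full]) and maps Delta(q) to Delta(p (q + 1) - 1), so tw (T(s))
    has a Weyl filtration and a local endomorphism ring.  Homomorphisms into W n
    extend along Weyl quotients ([acyclic_W]), so two highest weight vectors u and
    v of weight m give homomorphisms from tw (T(s)) to W n and back; if (u, v) is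
    not zero, their composite is not nilpotent, hence invertible, and tw (T(s))
    is a direct summand ([split_T]).  The Casimir operator cuts out of W n the
    summand on which all highest weights are walls ([block_idem]).  By splitting
    off one tw (T(s)) at a time, that summand is a direct sum of copies of the
    tw (T(s)), the number of copies being D(n, p (s + 1) - 1) ([decomposition]).
    A comparison of characters yields
    sum_s D(n, p (s + 1) - 1) c_{s,r} = p_{n, p (r + 1) - 1} ([wall_path]), and
    inverting c gives the first case of the recursion.

    A module is a functor on commutative k-algebras, and a matrix over k is a
    homomorphism as soon as it commutes with the two generic unipotent elements
    over k[X] ([SL2hom_generic]); the coefficients of their actions are the
    divided powers of E and F. *)

(** * Algebras over the base field and their localisations *)

Local Open Scope quotient_scope.

(** An algebra structure given by its structure map, for rings that come without
    one over k, such as iterated polynomial rings and their quotients. *)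
Definition algvia (k : fieldType) (B : comNzRingType) of {rmorphism k -> B} : Type := B.

Section AlgVia.
Variables (k : fieldType) (B : comNzRingType) (f : {rmorphism k -> B}).
Local Notation T := (algvia f).
HB.instance Definition _ := GRing.ComNzRing.on T.
Definition via_scale (c : k) (x : T) : T := f c * x.
Lemma via_scaleA a b x : via_scale a (via_scale b x) = via_scale (a * b) x.
Proof. by rewrite /via_scale rmorphM mulrA. Qed.
Lemma via_scale1 : left_id 1 via_scale.
Proof. by move=> x; rewrite /via_scale rmorph1 mul1r. Qed.
Lemma via_scaleDr : right_distributive via_scale +%R.
Proof. by move=> a x y; rewrite /via_scale mulrDr. Qed.
Lemma via_scaleDl x : {morph via_scale^~ x : a b / a + b}.
Proof. by move=> a b; rewrite /via_scale rmorphD mulrDl. Qed.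
HB.instance Definition _ := GRing.Zmodule_isLmodule.Build k T
  via_scaleA via_scale1 via_scaleDr via_scaleDl.
Lemma via_scaleAl (a : k) (x y : T) : a *: (x * y) = (a *: x) * y.
Proof. exact: mulrA. Qed.
HB.instance Definition _ := GRing.Lmodule_isLalgebra.Build k T via_scaleAl.
Lemma via_scaleAr (a : k) (x y : T) : a *: (x * y) = x * (a *: y).
Proof. exact: mulrCA. Qed.
HB.instance Definition _ := GRing.Lalgebra_isAlgebra.Build k T via_scaleAr.
Definition via : comAlgType k := T.
Lemma via_alg (c : k) : c%:A = f c :> T.
Proof. exact: mulr1. Qed.
End AlgVia.

Section MkLR.
Variables (k : fieldType) (A B : comAlgType k).
Definition alg_compat (g : A -> B) := forall c : k, g c%:A = c%:A.
(** Ring morphisms that fix the scalars are algebra morphisms; the naturality of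
    [slact] is only available for the latter. *)
Definition mklr (g : {rmorphism A -> B}) of alg_compat g : A -> B := g.
Variables (g : {rmorphism A -> B}) (gk : alg_compat g).
HB.instance Definition _ := GRing.RMorphism.copy (mklr gk) g.
Lemma mklr_scalable : scalable (mklr gk).
Proof. by move=> c x; rewrite /mklr -mulr_algl rmorphM /= gk mulr_algl. Qed.
HB.instance Definition _ := GRing.isScalable.Build k A B *:%R (mklr gk) mklr_scalable.
Definition lrm : {lrmorphism A -> B} := mklr gk.
Lemma lrmE x : lrm x = g x. Proof. by []. Qed.
End MkLR.

Section HornerEval.
Variables (k : fieldType) (A : comAlgType k) (a : A).
Lemma hev_alg : alg_compat (horner_alg a : {poly k} -> A).
Proof. by move=> c; rewrite alg_polyC horner_algC. Qed.
Definition hev : {lrmorphism {poly k} -> A} :=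
  lrm (g := horner_alg a : {rmorphism {poly k} -> A}) hev_alg.
Lemma hevX : hev 'X = a. Proof. exact: horner_algX. Qed.
Lemma hevE p : hev p = \sum_(i < size p) p`_i *: a ^+ i.
Proof.
rewrite -[LHS]/((map_poly (in_alg A) p).[a]) horner_coef size_map_poly.
by apply: eq_bigr => i _; rewrite coef_map /= mulr_algl.
Qed.
End HornerEval.

Section PolyAlg.
Variables (k : fieldType) (A : comAlgType k).
Definition pk : comAlgType k := via (@polyC A \o in_alg A : {rmorphism k -> {poly A}}).
Lemma pkC_alg : alg_compat (@polyC A : A -> pk).
Proof. by move=> c; rewrite [RHS]via_alg. Qed.
Definition pkC : {lrmorphism A -> pk} :=
  lrm (g := (@polyC A : {rmorphism A -> {poly A}}) : {rmorphism A -> pk}) pkC_alg.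
End PolyAlg.

Section Loc.
Variables (k : fieldType) (A : comAlgType k).
Definition lideal (a : A) : {pred {poly A}} :=
  fun p => `[< exists q, p = q * (a *: 'X - 1) >].

(** If c = q (a X - 1), comparison of coefficients gives q_i = - a^i c, and q has
    only finitely many coefficients: the kernel of A -> A[1/a] is the a-torsion. *)
Lemma lideal_torsion a c : c%:P \in lideal a -> exists N, a ^+ N * c = 0.
Proof.
move=> /asboolP[q e]; exists (size q).
suff H i : q`_i = - (a ^+ i * c).
  by apply/eqP; rewrite -oppr_eq0 -H nth_default.
have ec j : (c%:P)`_j = (if j is j'.+1 then a * q`_j' else 0) - q`_j.
  by rewrite e mulrBr mulr1 coefB -scalerAr coefZ coefMX; case: j => [|j]; rewrite ?mulr0.
elim: i => [|i IH].
  by have := ec 0; rewrite coefC /= sub0r expr0 mul1r => e0; rewrite e0 opprK.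
have := ec i.+1; rewrite coefC /= IH => /eqP; rewrite eq_sym subr_eq0 => /eqP <-.
by rewrite mulrN mulrA exprS.
Qed.

Variables (a : A) (an : forall n, a ^+ n != 0).
Definition lideal_of of (forall n, a ^+ n != 0) := lideal a.
Local Notation I := (lideal_of an).
Lemma lideal_closed : idealr_closed I.
Proof.
split.
- by apply/asboolP; exists 0; rewrite mul0r.
- apply/negP=> /lideal_torsion[N]; rewrite mulr1 => e; by have := an N; rewrite e eqxx.
move=> u p q /asboolP[p' ->] /asboolP[q' ->]; apply/asboolP.
by exists (u * p' + q'); rewrite mulrDl mulrA.
Qed.
HB.instance Definition _ := isIdealr.Build {poly A} I lideal_closed.
Local Notation lquot := {ideal_quot I}.
Definition lpi : {rmorphism {poly A} -> lquot} := \pi_(lquot).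
(** The localisation A[1/a], realised as A[X] / (a X - 1) and nontrivial because a
    is not nilpotent. *)
Definition Loc : comAlgType k := via (lpi \o polyC \o in_alg A).
Definition lincr : {rmorphism A -> Loc} := lpi \o @polyC A.
Lemma linc_alg : alg_compat lincr.
Proof. by move=> c; rewrite [RHS]via_alg. Qed.
Definition linc : {lrmorphism A -> Loc} := lrm linc_alg.
Definition linv : Loc := lpi 'X.

Lemma lpi_eq (p q : {poly A}) : lpi p = lpi q <-> p - q \in I.
Proof.
have -> : (p - q \in I) = (p == q %[mod lquot]) by exact: (@Quotient.idealrBE {poly A} I p q).
by split=> /eqP.
Qed.
Lemma lincV : linc a * linv = 1.
Proof.
transitivity (lpi (a%:P * 'X)); first by rewrite rmorphM.
transitivity (lpi 1); last by rewrite rmorph1.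
apply/lpi_eq/asboolP.
by exists 1; rewrite mul1r mul_polyC.
Qed.
Lemma linc_eq0 c : linc c = 0 -> exists N, a ^+ N * c = 0.
Proof.
move=> h; apply: lideal_torsion.
have : lpi c%:P = lpi 0 by rewrite rmorph0.
by move/lpi_eq; rewrite subr0.
Qed.

Definition lpr : {rmorphism {poly A} -> Loc} := lpi.
Lemma lprX : lpr 'X = linv. Proof. by []. Qed.
Lemma lprC c : lpr c%:P = linc c. Proof. by []. Qed.
Lemma lpr_surj z : exists q, z = lpr q.
Proof. by exists (repr (z : lquot)); rewrite /lpr /lpi /= reprK. Qed.

Section Lift.
Variables (B : comAlgType k) (g : {lrmorphism A -> B}) (b : B) (gb : g a * b = 1).
Definition lev : {rmorphism {poly A} -> B} := horner_eval b \o map_poly g.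
Lemma lev0 p : p \in I -> lev p = 0.
Proof.
move=> /asboolP[q ->]; rewrite rmorphM rmorphB rmorph1 /= /horner_eval map_polyZ map_polyX.
by rewrite hornerZ hornerX gb subrr mulr0.
Qed.
Definition lliftf (x : Loc) : B := lev (repr (x : lquot)).
Lemma llift_pi p : lliftf (lpi p) = lev p.
Proof.
apply/eqP; rewrite -subr_eq0 -rmorphB lev0 //; apply/lpi_eq.
by rewrite /lpi /= reprK.
Qed.
Lemma llift_zmod : zmod_morphism lliftf.
Proof.
move=> x y; rewrite -[x](reprK (x : lquot)) -[y](reprK (y : lquot)).
by rewrite -[LHS]/(lliftf (lpi _ - lpi _)) -rmorphB !llift_pi rmorphB.
Qed.
Lemma llift_monoid : monoid_morphism lliftf.
Proof.
split; first by rewrite -[RHS](rmorph1 lev) -llift_pi rmorph1.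
move=> x y; rewrite -[x](reprK (x : lquot)) -[y](reprK (y : lquot)).
by rewrite -[LHS]/(lliftf (lpi _ * lpi _)) -rmorphM !llift_pi rmorphM.
Qed.
HB.instance Definition _ := GRing.isZmodMorphism.Build Loc B lliftf llift_zmod.
HB.instance Definition _ := GRing.isMonoidMorphism.Build Loc B lliftf llift_monoid.
Lemma llift_linc x : lliftf (linc x) = g x.
Proof.
rewrite -[linc x]/(lpi x%:P) llift_pi /= /horner_eval map_polyC hornerC //.
Qed.
Lemma llift_alg : alg_compat lliftf.
Proof. by move=> c; rewrite -(linc_alg c) llift_linc rmorph_alg. Qed.
Definition llift : {lrmorphism Loc -> B} := lrm (g := lliftf : {rmorphism Loc -> B}) llift_alg.
Lemma lliftE x : llift (linc x) = g x. Proof. exact: llift_linc. Qed.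
Lemma lliftV : llift linv = b.
Proof. by rewrite /llift lrmE /= llift_pi /= /horner_eval map_polyX hornerX. Qed.
End Lift.
End Loc.
Global Opaque lpr linc hev llift pkC.

(** * Two-by-two matrices and homomorphisms tested on unipotent elements *)

Section Mx2.
Variable A : comNzRingType.
Implicit Types a b c d : A.
Definition mx2 a b c d : 'M[A]_2 :=
  \matrix_(i, j) if i == 0 then if j == 0 then a else b else if j == 0 then c else d.

Lemma ord2P (i : 'I_2) : i = 0 \/ i = 1.
Proof. by case: i => [[|[|//]] h]; [left | right]; apply: val_inj. Qed.

Lemma mx2P (g h : 'M[A]_2) :
  [/\ g 0 0 = h 0 0, g 0 1 = h 0 1, g 1 0 = h 1 0 & g 1 1 = h 1 1] -> g = h.
Proof.
by case=> *; apply/matrixP=> i j; case: (ord2P i) => ->; case: (ord2P j) => ->.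
Qed.

Lemma mx2_eta (g : 'M[A]_2) : g = mx2 (g 0 0) (g 0 1) (g 1 0) (g 1 1).
Proof. by apply: mx2P; rewrite !mxE. Qed.

Lemma sum2 (V : nmodType) (F : 'I_2 -> V) : \sum_i F i = F 0 + F 1.
Proof.
by rewrite !big_ord_recl big_ord0 addr0; congr (_ + F _); apply: val_inj.
Qed.

Lemma mx2M a b c d a' b' c' d' : mx2 a b c d *m mx2 a' b' c' d' =
  mx2 (a * a' + b * c') (a * b' + b * d') (c * a' + d * c') (c * b' + d * d').
Proof. by apply: mx2P; rewrite !mxE !sum2 !mxE. Qed.

Lemma cofactor2 (g : 'M[A]_2) (i j : 'I_2) :
  cofactor g i j = (-1) ^+ (i + j) * g (1 - i) (1 - j).
Proof.
rewrite /cofactor; congr (_ * _).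
rewrite [X in \det X](_ : _ = (g (1 - i) (1 - j))%:M) ?det_scalar1 //.
apply/matrixP=> x y; rewrite !ord1 !mxE mulr1n; congr (g _ _);
  [case: (ord2P i) => -> | case: (ord2P j) => ->]; exact: val_inj.
Qed.

Lemma sub2E : ((1 - 0 = 1 :> 'I_2) * (1 - 1 = 0 :> 'I_2))%type.
Proof. by split; apply: val_inj. Qed.

Lemma det2 (g : 'M[A]_2) : \det g = g 0 0 * g 1 1 - g 0 1 * g 1 0.
Proof.
by rewrite (expand_det_row _ 0) sum2 !cofactor2 !sub2E /= expr0 expr1 mul1r mulN1r mulrN.
Qed.

Lemma det_mx2 a b c d : \det (mx2 a b c d) = a * d - b * c.
Proof. by rewrite det2 !mxE. Qed.

Definition up a := mx2 1 a 0 1.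
Definition lo a := mx2 1 0 a 1.
Lemma det_up a : \det (up a) = 1. Proof. by rewrite det_mx2; ring. Qed.
Lemma det_lo a : \det (lo a) = 1. Proof. by rewrite det_mx2; ring. Qed.
Lemma mx2_1 : mx2 1 0 0 1 = 1%:M.
Proof. by apply: mx2P; rewrite !mxE. Qed.
Lemma upD a b : up (a + b) = up a *m up b.
Proof. by rewrite mx2M; congr mx2; ring. Qed.
Lemma loD a b : lo (a + b) = lo a *m lo b.
Proof. by rewrite mx2M; congr mx2; ring. Qed.
Lemma up0 : up 0 = 1%:M. Proof. exact: mx2_1. Qed.
Lemma lo0 : lo 0 = 1%:M. Proof. exact: mx2_1. Qed.

Lemma adj2 (g : 'M[A]_2) : \adj g = mx2 (g 1 1) (- g 0 1) (- g 1 0) (g 0 0).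
Proof.
apply: mx2P; rewrite !mxE !cofactor2 !sub2E /= ?expr0 ?expr1 ?mul1r ?mulN1r.
by split=> //; rewrite -signr_odd expr0 mul1r.
Qed.
End Mx2.

Lemma map_mx2 (A B : comNzRingType) (f : {rmorphism A -> B}) a b c d :
  map_mx f (mx2 a b c d) = mx2 (f a) (f b) (f c) (f d).
Proof. by apply: mx2P; rewrite !mxE. Qed.
Lemma map_up (A B : comNzRingType) (f : {rmorphism A -> B}) a : map_mx f (up a) = up (f a).
Proof. by rewrite map_mx2 rmorph1 rmorph0. Qed.
Lemma map_lo (A B : comNzRingType) (f : {rmorphism A -> B}) a : map_mx f (lo a) = lo (f a).
Proof. by rewrite map_mx2 rmorph1 rmorph0. Qed.

Section Ext.
Variable k : fieldType.
Lemma ext_map (A B : comAlgType k) (f : {lrmorphism A -> B}) m n (X : 'M[k]_(m, n)) :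
  map_mx f (ext A X) = ext B X.
Proof. by apply/matrixP=> i j; rewrite !mxE rmorph_alg. Qed.
Variable A : comAlgType k.
Lemma extM m n q (X : 'M[k]_(m, n)) (Y : 'M_(n, q)) : ext A (X *m Y) = ext A X *m ext A Y.
Proof. exact: map_mxM. Qed.
Lemma extD m n (X Y : 'M[k]_(m, n)) : ext A (X + Y) = ext A X + ext A Y.
Proof. exact: raddfD. Qed.
Lemma extB m n (X Y : 'M[k]_(m, n)) : ext A (X - Y) = ext A X - ext A Y.
Proof. exact: raddfB. Qed.
Lemma extN m n (X : 'M[k]_(m, n)) : ext A (- X) = - ext A X.
Proof. exact: raddfN. Qed.
Lemma ext0 m n : ext A (0 : 'M[k]_(m, n)) = 0.
Proof. exact: raddf0. Qed.
Lemma ext1 n : ext A (1%:M : 'M[k]_n) = 1%:M.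
Proof. by rewrite /ext map_scalar_mx rmorph1. Qed.
Lemma extZ c m n (X : 'M[k]_(m, n)) : ext A (c *: X) = c%:A *: ext A X.
Proof. by apply/matrixP=> i j; rewrite !mxE; exact: rmorphM. Qed.
Lemma extT m n (X : 'M[k]_(m, n)) : ext A X^T = (ext A X)^T.
Proof. by rewrite /ext map_trmx. Qed.
Lemma ext_inj m n : injective (@ext k A m n).
Proof.
move=> X Y e; apply/matrixP=> i j; apply: (fmorph_inj (in_alg A)).
by move/matrixP: e => /(_ i j); rewrite !mxE.
Qed.
Lemma ext_col m1 m2 n (X : 'M[k]_(m1, n)) (Y : 'M_(m2, n)) :
  ext A (col_mx X Y) = col_mx (ext A X) (ext A Y).
Proof. exact: map_col_mx. Qed.
Lemma ext_row m n1 n2 (X : 'M[k]_(m, n1)) (Y : 'M_(m, n2)) :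
  ext A (row_mx X Y) = row_mx (ext A X) (ext A Y).
Proof. exact: map_row_mx. Qed.
Lemma ext_block m1 m2 n1 n2 (X : 'M[k]_(m1, n1)) (Y : 'M_(m1, n2)) Z (T : 'M_(m2, n2)) :
  ext A (block_mx X Y Z T) = block_mx (ext A X) (ext A Y) (ext A Z) (ext A T).
Proof. exact: map_block_mx. Qed.
Lemma ext_sum I (r : seq I) (P : pred I) m n (F : I -> 'M[k]_(m, n)) :
  ext A (\sum_(i <- r | P i) F i) = \sum_(i <- r | P i) ext A (F i).
Proof. exact: raddf_sum. Qed.
End Ext.

Section Density.
Variables (k : fieldType) (M N : SL2mod k) (X : 'M[k]_(sldim N, sldim M)).
Definition homat (A : comAlgType k) (g : 'M[A]_2) : Prop :=
  ext A X *m slact M g = slact N g *m ext A X.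

Lemma homat_map (A B : comAlgType k) (f : {lrmorphism A -> B}) g :
  \det g = 1 -> homat g -> homat (map_mx f g).
Proof. by move=> dg /(congr1 (map_mx f)); rewrite !map_mxM !slact_nat // !ext_map. Qed.

Lemma homatM (A : comAlgType k) (g h : 'M[A]_2) : \det g = 1 -> \det h = 1 ->
  homat g -> homat h -> homat (g *m h).
Proof.
by rewrite /homat => dg dh hg hh; rewrite !slactM // mulmxA hg -!mulmxA hh.
Qed.

Hypotheses (hup : homat (up 'X : 'M[{poly k}]_2)) (hlo : homat (lo 'X : 'M[{poly k}]_2)).

Lemma homat_up (A : comAlgType k) (a : A) : homat (up a).
Proof. by rewrite -(hevX a) -map_up; apply: homat_map hup; apply: det_up. Qed.
Lemma homat_lo (A : comAlgType k) (a : A) : homat (lo a).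
Proof. by rewrite -(hevX a) -map_lo; apply: homat_map hlo; apply: det_lo. Qed.

Lemma homat_ulu (A : comAlgType k) (a b c : A) : homat (up a *m lo b *m up c).
Proof.
by do !(apply: homatM; rewrite ?det_mulmx ?det_up ?det_lo ?mulr1 //);
  [apply: homat_up | apply: homat_lo | apply: homat_up].
Qed.

Lemma det_ulu (A : comNzRingType) (a b c : A) : \det (up a *m lo b *m up c) = 1.
Proof. by rewrite !det_mulmx ?det_up ?det_lo !mulr1. Qed.

(** An element of SL_2 with invertible upper left entry lies in the big cell, that
    is, it is a product of unipotent elements. *)
Lemma homat_unit (A : comAlgType k) (a b c d a' : A) :
  a * a' = 1 -> a * d - b * c = 1 -> homat (mx2 a b c d).
Proof.
move=> aa dt.
(* lower times diagonal times upper, the diagonal matrix being the product of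
   two representatives of the Weyl group element *)
have -> : mx2 a b c d = lo (c * a') *m ((up a *m lo (- a') *m up a) *m
    (up (-1) *m lo 1 *m up (-1))) *m up (a' * b).
  have -> : up a *m lo (- a') *m up a = mx2 0 a (- a') 0.
    by rewrite !mx2M; congr mx2; ring: aa.
  have -> : up (-1) *m lo 1 *m up (-1) = mx2 0 (-1) 1 0 :> 'M[A]_2.
    by rewrite !mx2M; congr mx2; ring.
  have -> : d = a' * (1 + b * c).
    by rewrite -dt subrK mulrCA mulrA aa mul1r.
  by rewrite !mx2M; congr mx2; ring: aa.
apply: homatM; rewrite ?det_mulmx ?det_ulu ?det_up ?det_lo ?mulr1 //; last exact: homat_up.
apply: homatM; rewrite ?det_mulmx ?det_ulu ?det_up ?det_lo ?mulr1 //; first exact: homat_lo.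
by apply: homatM; rewrite ?det_ulu //; apply: homat_ulu.
Qed.

(** Multiplication by the Weyl group element moves an invertible lower left entry
    to the upper left corner. *)
Lemma homat_unit21 (A : comAlgType k) (a b c d c' : A) :
  c * c' = 1 -> a * d - b * c = 1 -> homat (mx2 a b c d).
Proof.
move=> cc dt.
have -> : mx2 a b c d = (up 1 *m lo (-1) *m up 1) *m mx2 (- c) (- d) a b.
  by rewrite !mx2M; congr mx2; ring.
apply: homatM; rewrite ?det_ulu ?det_mx2 //; [by rewrite -[RHS]dt; ring | exact: homat_ulu |].
by apply: (homat_unit (a' := - c')); [rewrite mulrNN | rewrite -[RHS]dt; ring].
Qed.

(** The defect of equivariance at g vanishes over A[1/x], so it is killed by a power
    of x; the case of a nilpotent x is trivial. *)
Lemma homat_loc (A : comAlgType k) (x : A) (g : 'M[A]_2) : \det g = 1 ->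
  (forall (B : comAlgType k) (f : {lrmorphism A -> B}) y, f x * y = 1 -> homat (map_mx f g)) ->
  forall i j, exists n, x ^+ n * (ext A X *m slact M g - slact N g *m ext A X) i j = 0.
Proof.
move=> dg H i j; case: (pselect (exists n, x ^+ n = 0)) => [[n e]|ne].
  by exists n; rewrite e mul0r.
have xn n : x ^+ n != 0 by apply/eqP => e; apply: ne; exists n.
apply: (@linc_eq0 _ _ _ xn).
have := H _ (linc xn) _ (lincV xn); rewrite /homat -!slact_nat // -(ext_map (linc xn) X).
rewrite -!map_mxM => /eqP; rewrite -subr_eq0 -raddfB => /eqP/matrixP/(_ i j).
by rewrite mxE [RHS]mxE.
Qed.

(** The two entries of a column of an element of SL_2 generate the unit ideal, and
    then so do all their powers. *)
Lemma comax_eq0 (A : comNzRingType) (a b c d z : A) n m : a * d - b * c = 1 ->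
  a ^+ n * z = 0 -> c ^+ m * z = 0 -> z = 0.
Proof.
move=> dt; move: {2}(n + m)%N (leqnn (n + m)) => s; elim: s n m z => [|s IH] [|n] [|m] z //=;
  rewrite ?expr0 ?mul1r // => le ha hc.
have az : a * z = 0.
  apply: (IH n m.+1); [by lia | by rewrite mulrA -exprSr | ].
  by rewrite mulrCA hc mulr0.
have cz : c * z = 0.
  apply: (IH n.+1 m); [by lia | by rewrite mulrCA ha mulr0 | by rewrite mulrA -exprSr].
by rewrite -[z]mul1r -dt mulrBl -!mulrA cz mulr0 (mulrCA a) az mulr0 subr0.
Qed.

(** Equivariance at the generic unipotent elements specialises to all unipotent
    elements.  The locus where an entry of the first column of g is invertible is
    covered by the big cell or its translate, and these two loci cover SL_2. *)
Theorem SL2hom_generic : SL2hom X.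
Proof.
move=> A g dg; apply/eqP; rewrite -subr_eq0; apply/eqP/matrixP=> i j; rewrite [RHS]mxE.
have dt : g 0 0 * g 1 1 - g 0 1 * g 1 0 = 1 by rewrite -det2.
have dB (B : comAlgType k) (f : {lrmorphism A -> B}) :
  f (g 0 0) * f (g 1 1) - f (g 0 1) * f (g 1 0) = 1.
  by rewrite -!rmorphM -rmorphB dt rmorph1.
have [n hn] : exists n, g 0 0 ^+ n * (ext A X *m slact M g - slact N g *m ext A X) i j = 0.
  apply: homat_loc => // B f y e; rewrite [g]mx2_eta map_mx2.
  exact: (homat_unit e (dB B f)).
have [m hm] : exists n, g 1 0 ^+ n * (ext A X *m slact M g - slact N g *m ext A X) i j = 0.
  apply: homat_loc => // B f y e; rewrite [g]mx2_eta map_mx2.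
  exact: (homat_unit21 e (dB B f)).
exact: (comax_eq0 dt hn hm).
Qed.
End Density.

(** * Coefficients of matrices of polynomials *)

Section PolyMx.
Variable k : fieldType.
Implicit Types (m n : nat).

Definition mcoef m n (i : nat) (P : 'M[{poly k}]_(m, n)) : 'M[k]_(m, n) :=
  map_mx (coefp i) P.
Definition msz m n (P : 'M[{poly k}]_(m, n)) : nat := \max_i \max_j size (P i j).

Lemma msz_le m n (P : 'M[{poly k}]_(m, n)) i j : (size (P i j) <= msz P)%N.
Proof.
apply: leq_trans (leq_bigmax i); exact: (leq_bigmax (F := fun j => size (P i j)) j).
Qed.

Lemma mhev (A : comAlgType k) (a : A) m n (P : 'M[{poly k}]_(m, n)) :
  map_mx (hev a) P = \sum_(i < msz P) a ^+ i *: ext A (mcoef i P).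
Proof.
apply/matrixP=> x y; rewrite mxE hevE summxE.
rewrite (big_ord_widen _ (fun i => (P x y)`_i *: a ^+ i) (msz_le P x y)) big_mkcond /=.
apply: eq_bigr => i _; rewrite !mxE /= mulrC mulr_algl.
by case: ltnP => // le; rewrite nth_default ?scale0r.
Qed.

Lemma mcoef_ge m n (P : 'M[{poly k}]_(m, n)) i : (msz P <= i)%N -> mcoef i P = 0.
Proof.
move=> le; apply/matrixP=> x y; rewrite !mxE /=.
by apply: nth_default; apply: leq_trans le; apply: msz_le.
Qed.

Lemma mcoefD m n i (P R : 'M[{poly k}]_(m, n)) : mcoef i (P + R) = mcoef i P + mcoef i R.
Proof. by apply/matrixP=> x y; rewrite !mxE /= coefD. Qed.
Lemma mcoefB m n i (P R : 'M[{poly k}]_(m, n)) : mcoef i (P - R) = mcoef i P - mcoef i R.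
Proof. by apply/matrixP=> x y; rewrite !mxE /= coefB. Qed.
Lemma mcoef_extl m n p i (X : 'M[k]_(m, n)) (P : 'M[{poly k}]_(n, p)) :
  mcoef i (ext _ X *m P) = X *m mcoef i P.
Proof.
apply/matrixP=> x y; rewrite !mxE /= coef_sum; apply: eq_bigr => j _.
by rewrite !mxE /= alg_polyC coefCM.
Qed.
Lemma mcoef_extr m n p i (P : 'M[{poly k}]_(m, n)) (X : 'M[k]_(n, p)) :
  mcoef i (P *m ext _ X) = mcoef i P *m X.
Proof.
apply/matrixP=> x y; rewrite !mxE /= coef_sum; apply: eq_bigr => j _.
by rewrite !mxE /= alg_polyC coefMC.
Qed.
Lemma mcoef_ext m n i (X : 'M[k]_(m, n)) : mcoef i (ext {poly k} X) = (i == 0%N)%:R *: X.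
Proof.
by apply/matrixP=> x y; rewrite !mxE /= alg_polyC coefC; case: eqP => _; rewrite ?mul1r ?mul0r.
Qed.
Lemma mcoefXn m n i j (X : 'M[k]_(m, n)) :
  mcoef i ('X^j *: ext {poly k} X) = (i == j)%:R *: X.
Proof.
by apply/matrixP=> x y; rewrite !mxE /= alg_polyC coefMC coefXn mulr_natl.
Qed.
Lemma mcoef_sum m n i I (r : seq I) (Q : pred I) (F : I -> 'M[{poly k}]_(m, n)) :
  mcoef i (\sum_(j <- r | Q j) F j) = \sum_(j <- r | Q j) mcoef i (F j).
Proof.
by apply: (big_morph (mcoef i)) => [P R|]; [exact: mcoefD | apply/matrixP=> x y; rewrite !mxE /= coef0].
Qed.
End PolyMx.

Section PkCoef.
Variables (k : fieldType) (A : comAlgType k).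
Definition pkX : pk A := 'X.
(** Extracting coefficients in a new variable, which turns an identity valid in all
    k-algebras into identities between matrices over A. *)
Lemma pk_coef m n K (C : nat -> 'M[A]_(m, n)) :
  \sum_(j < K) pkX ^+ j *: map_mx (pkC A) (C j) = 0 -> forall j, (j < K)%N -> C j = 0.
Proof.
move=> H j jK; apply/matrixP=> x y; rewrite [RHS]mxE.
have := congr1 (fun p : {poly A} => p`_j) (congr1 (fun Z : 'M[pk A]_(m, n) => Z x y) H).
rewrite /= summxE [X in polyseq X](_ : _ = \sum_(l < K) (C l x y)%:P * 'X^l); last first.
  by apply: eq_bigr => l _; rewrite !mxE mulrC.
rewrite mxE coef0 coef_sum (bigD1 (Ordinal jK)) //= coefCM coefXn eqxx mulr1 big1 ?addr0 // => l nl.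
rewrite coefCM coefXn (_ : _ == _ = false) ?mulr0 //.
by apply/eqP => e; case/eqP: nl; apply: val_inj.
Qed.
Lemma pk_coef2 m n K (C D : nat -> 'M[A]_(m, n)) :
  \sum_(j < K) pkX ^+ j *: map_mx (pkC A) (C j) = \sum_(j < K) pkX ^+ j *: map_mx (pkC A) (D j) ->
  forall j, (j < K)%N -> C j = D j.
Proof.
move=> /eqP; rewrite -subr_eq0 -sumrB => /eqP H j jK; apply/eqP; rewrite -subr_eq0; apply/eqP.
apply: (pk_coef (C := fun j => C j - D j)) jK; rewrite -[RHS]H; apply: eq_bigr => i _.
by rewrite -scalerBr map_mxB.
Qed.
End PkCoef.

Section TwoVar.
Variable k : fieldType.
(** The polynomial ring k[x, y]. *)
Definition R2 : comAlgType k := pk {poly k}.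
Definition xx : R2 := ('X : {poly k})%:P.
Definition yy : R2 := ('X : {poly {poly k}}).
Lemma R2_idom (a b : R2) : a * b = 0 -> a = 0 \/ b = 0.
Proof.
move=> h; have : ((a : {poly {poly k}}) * (b : {poly {poly k}})) == 0 by apply/eqP.
by rewrite mulf_eq0 => /orP[/eqP|/eqP]; [left | right].
Qed.
Lemma R2_expn0 (a : R2) : a <> 0 -> forall n, a ^+ n != 0.
Proof.
move=> a0; elim=> [|n IH]; first by rewrite expr0 oner_eq0.
by apply/eqP; rewrite exprS => /R2_idom[//|e]; rewrite e eqxx in IH.
Qed.
Lemma R2_linc_inj (a : R2) (an : forall n, a ^+ n != 0) : injective (linc an).
Proof.
move=> b c e; apply/eqP; rewrite -subr_eq0; apply/eqP.
have /linc_eq0[N] : linc an (b - c) = 0 by rewrite [LHS](rmorphB (linc an)); apply/eqP; rewrite subr_eq0; apply/eqP.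
by case/R2_idom => // h; have := an N; rewrite h eqxx.
Qed.
Lemma R2_xy_neq0 : xx * yy <> 0.
Proof.
case/R2_idom => /eqP; last by rewrite polyX_eq0.
by rewrite polyC_eq0 polyX_eq0.
Qed.
Lemma R2_1xy_neq0 : 1 + pkC {poly k} 'X * pkX {poly k} <> 0 :> R2.
Proof.
move=> /(congr1 (fun p : {poly {poly k}} => p`_0)).
have -> : 1 + pkC {poly k} 'X * pkX {poly k} = 1 + ('X : {poly k})%:P * 'X :> {poly {poly k}} by [].
rewrite coefD coef1 coefMX addr0 /= (_ : (0 : R2) = (0 : {poly {poly k}})) // coef0 => /eqP.
by rewrite oner_eq0.
Qed.
(** The element 1 + x y of k[x][y] divides c y^K only if c = 0, because its leading
    coefficient in y is not a constant. *)
Lemma R2_div (c : k) K (z : R2) :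
  pkX {poly k} ^+ K * c%:A = (1 + pkC {poly k} 'X * pkX {poly k}) * z -> c = 0.
Proof.
move=> e; have {e} : ('X^K * c%:P%:P : {poly {poly k}}) = (1 + ('X : {poly k})%:P * 'X) * (z : {poly {poly k}}).
  rewrite -[RHS]/((1 + pkC {poly k} 'X * pkX {poly k}) * z) -e.
  by rewrite via_alg /= alg_polyC.
move=> /(congr1 lead_coef); rewrite !lead_coefM lead_coefXn lead_coefC mul1r.
have -> : lead_coef (1 + ('X : {poly k})%:P * 'X : {poly {poly k}}) = 'X.
  rewrite addrC lead_coefDl ?lead_coefMX ?lead_coefC // size_poly1 size_mulX ?polyC_eq0 ?polyX_eq0 //.
  by rewrite size_polyC polyX_eq0.
move=> e; apply/eqP; rewrite -polyC_eq0; apply/eqP.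
have := congr1 (fun q : {poly k} => q`_0) e; rewrite /= coefXM coefC /= => ->.
by rewrite polyC0.
Qed.
Definition bcoef m n (i j : nat) (P : 'M[R2]_(m, n)) : 'M[k]_(m, n) :=
  \matrix_(x, y) ((P x y : {poly {poly k}})`_j)`_i.
Lemma bcoefD m n i j (P Q : 'M[R2]_(m, n)) : bcoef i j (P + Q) = bcoef i j P + bcoef i j Q.
Proof.
by apply/matrixP=> x y; rewrite !mxE -!coefD.
Qed.
Lemma bcoef_sum m n i j I (r : seq I) (Q : pred I) (F : I -> 'M[R2]_(m, n)) :
  bcoef i j (\sum_(l <- r | Q l) F l) = \sum_(l <- r | Q l) bcoef i j (F l).
Proof.
apply: (big_morph (bcoef i j)) => [P R|]; first exact: bcoefD.
by apply/matrixP=> x y; rewrite !mxE !coef0.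
Qed.
Lemma bcoefXY m n i j a b (X : 'M[k]_(m, n)) :
  bcoef i j ((xx ^+ a * yy ^+ b) *: ext R2 X) = ((i == a) && (j == b))%:R *: X.
Proof.
apply/matrixP=> x y; rewrite !mxE.
have -> : ((xx ^+ a * yy ^+ b * in_alg R2 (X x y)) : {poly {poly k}}) =
   ((X x y)%:P * 'X^a)%:P * 'X^b.
  rewrite -[in_alg _ _]/((X x y)%:A : R2) via_alg /= alg_polyC -mulrA mulrC -mulrA.
  by rewrite mulrC !rmorphM rmorphXn.
rewrite coefCM coefXn; case: (j == b); last by rewrite mulr0 coef0 andbF mul0r.
by rewrite mulr1 coefCM coefXn andbT mulrC.
Qed.
End TwoVar.
Global Opaque bcoef.

(** * The action of the torus *)

Lemma torusE (k : fieldType) (A : comAlgType k) (t u : A) : torus t u = mx2 t 0 0 u.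
Proof. by apply: mx2P; rewrite !mxE. Qed.
Lemma det_torus (k : fieldType) (A : comAlgType k) (t u : A) : t * u = 1 -> \det (torus t u) = 1.
Proof. by move=> tu; rewrite torusE det_mx2 mul0r subr0. Qed.
Lemma map_torus (k : fieldType) (A B : comAlgType k) (f : {rmorphism A -> B}) (t u : A) :
  map_mx f (torus t u) = torus (f t) (f u).
Proof. by rewrite !torusE map_mx2 rmorph0. Qed.

Lemma torusM (k : fieldType) (A : comAlgType k) (t u t' u' : A) :
  torus t u *m torus t' u' = torus (t * t') (u * u').
Proof. by rewrite !torusE mx2M; congr mx2; ring. Qed.

Lemma map_mx_sum2 (k : fieldType) (A B : comAlgType k) (f : {lrmorphism A -> B}) m n K
  (a : nat -> nat -> A) (C : nat -> nat -> 'M[k]_(m, n)) :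
  map_mx f (\sum_(i < K) \sum_(j < K) a i j *: ext A (C i j)) =
  \sum_(i < K) \sum_(j < K) f (a i j) *: ext B (C i j).
Proof.
rewrite raddf_sum; apply: eq_bigr => i _; rewrite raddf_sum; apply: eq_bigr => j _.
by rewrite /= map_mxZ /= ext_map.
Qed.
Lemma rmorphXY (k : fieldType) (A B : comAlgType k) (f : {lrmorphism A -> B}) a b i j :
  f (a ^+ i * b ^+ j) = f a ^+ i * f b ^+ j.
Proof. by rewrite rmorphM !rmorphXn. Qed.

(** Multiplication by (t t')^N clears the denominators from a product of two
    expansions with N powers of the inverses u and u'. *)
Lemma torus_cancel (A : comNzRingType) (t u t' u' : A) N i j : (t * t') * (u * u') = 1 ->
  (t * t') ^+ N * (t ^+ i * u ^+ N * (t' ^+ j * u' ^+ N)) = t ^+ i * t' ^+ j.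
Proof.
move=> tt; transitivity ((t ^+ i * t' ^+ j) * ((t * t') ^+ N * (u * u') ^+ N)).
  by rewrite !exprMn; ring.
by rewrite -exprMn tt expr1n mulr1.
Qed.

Lemma lr_mx_inj (k : fieldType) (A B : comAlgType k) (f : {lrmorphism A -> B}) m n :
  injective f -> injective (map_mx f : 'M_(m, n) -> 'M_(m, n)).
Proof.
by move=> fi X Y /matrixP e; apply/matrixP=> i j; apply: fi; have := e i j; rewrite !mxE.
Qed.

Lemma unit_factors (A : comNzRingType) (a b c : A) : a * b * c = 1 ->
  exists u u', a * u = 1 /\ b * u' = 1.
Proof. by move=> e; exists (b * c), (a * c); split; rewrite -e; ring. Qed.

Section TorusChar.
Variables (k : fieldType) (A : comAlgType k) (t u : A) (tu : t * u = 1).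
Lemma tu_expn n : t ^+ n * u ^+ n = 1.
Proof. by rewrite -exprMn tu expr1n. Qed.
Lemma tcE r (a b : nat) : r = a%:Z - b%:Z -> torus_char t u r = t ^+ a * u ^+ b.
Proof.
case: r => c e /=.
  have -> : a = (c + b)%N by lia.
  by rewrite exprD -mulrA tu_expn mulr1.
have -> : b = (a + c.+1)%N by lia.
by rewrite exprD mulrA tu_expn mul1r.
Qed.
Lemma intab (r : int) : exists a b : nat, r = a%:Z - b%:Z.
Proof.
case: r => c; [exists c, 0%N | exists 0%N, c.+1]; lia.
Qed.
Lemma tcD r s : torus_char t u (r + s) = torus_char t u r * torus_char t u s.
Proof.
have [a [b er]] := intab r; have [c [d es]] := intab s.
rewrite (tcE er) (tcE es) (@tcE (r + s) (a + c) (b + d)); last by lia.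
by rewrite !exprD mulrACA.
Qed.
Lemma tc1 : torus_char t u 1 = t. Proof. exact: expr1. Qed.
Lemma tcN1 : torus_char t u (-1) = u. Proof. exact: expr1. Qed.
End TorusChar.

Lemma loc_repr (k : fieldType) (A : comAlgType k) (a : A) (an : forall n, a ^+ n != 0) (z : Loc an) :
  exists N p, linc an a ^+ N * z = linc an p.
Proof.
have [q ->] := lpr_surj z; elim/poly_ind: q => [|q c [N [p IH]]].
  by exists 0%N, 0; rewrite !rmorph0 mulr0.
exists N.+1, (p + a ^+ N.+1 * c).
rewrite rmorphD rmorphM lprX lprC mulrDr rmorphD /= -IH; congr (_ + _).
  by rewrite exprSr mulrACA lincV mulr1.
by rewrite rmorphM rmorphXn /=.
Qed.

Section Weights.
Variable k : fieldType.

Lemma polyX_expn0 n : ('X : {poly k}) ^+ n != 0.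
Proof. by rewrite expf_neq0 // polyX_eq0. Qed.
(** The ring k[t, 1/t] of Laurent polynomials, over which the generic element of the
    torus lives. *)
Definition Lau : comAlgType k := Loc polyX_expn0.
Definition lt : Lau := linc polyX_expn0 'X.
Definition lu : Lau := linv polyX_expn0.
Lemma ltu : lt * lu = 1. Proof. exact: lincV. Qed.
Lemma Lau_inj : injective (linc polyX_expn0).
Proof.
move=> b c e; apply/eqP; rewrite -subr_eq0; apply/eqP.
have /linc_eq0[N] : linc polyX_expn0 (b - c) = 0.
  by rewrite [LHS](rmorphB (linc polyX_expn0)); apply/eqP; rewrite subr_eq0; apply/eqP.
by move/eqP; rewrite mulf_eq0 (negPf (polyX_expn0 N)) => /eqP.
Qed.
Section LauLift.
Variables (A : comAlgType k) (t u : A) (tu : t * u = 1).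
Lemma lau_subproof : hev t 'X * u = 1. Proof. by rewrite hevX. Qed.
Definition lauf : {lrmorphism Lau -> A} := llift polyX_expn0 lau_subproof.
Lemma lauft : lauf lt = t. Proof. by rewrite /lauf lliftE hevX. Qed.
Lemma laufu : lauf lu = u. Proof. exact: lliftV. Qed.
Lemma lauf_linc p : lauf (linc polyX_expn0 p) = hev t p. Proof. exact: lliftE. Qed.
End LauLift.

Variable M : SL2mod k.
Notation d := (sldim M).

(** The action of the generic element of the torus is a matrix of Laurent
    polynomials, and every element of the torus is a specialisation of it. *)
Lemma torus_poly : exists N (P : 'M[{poly k}]_d), forall (A : comAlgType k) (t u : A), t * u = 1 ->
  slact M (torus t u) = u ^+ N *: map_mx (hev t) P.
Proof.
have [N [P e]] : exists N (P : 'M[{poly k}]_d),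
    lt ^+ N *: slact M (torus lt lu) = map_mx (linc polyX_expn0) P.
  have H i j : exists Np : nat * {poly k},
      lt ^+ Np.1 * slact M (torus lt lu) i j = linc polyX_expn0 Np.2.
    by have [N [p e]] := loc_repr (slact M (torus lt lu) i j); exists (N, p).
  have [F HF] := choice (fun ij : 'I_d * 'I_d => H ij.1 ij.2).
  exists (\sum_ij (F ij).1)%N.
  exists (\matrix_(i, j) ('X ^+ (\sum_(ij | ij != (i, j)) (F ij).1)%N * (F (i, j)).2)).
  apply/matrixP=> i j; rewrite !mxE (bigD1 (i, j)) //= addnC exprD -mulrA (HF (i, j)).
  by rewrite [RHS]rmorphM rmorphXn.
exists N, P => A t u tu.
have := congr1 (map_mx (lauf tu)) e.
rewrite map_mxZ slact_nat ?det_torus ?ltu // map_torus /= lauft laufu rmorphXn /= lauft => {}e.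
rewrite -[LHS]scale1r -(tu_expn tu N) mulrC -scalerA e; congr (_ *: _).
apply/matrixP=> i j; rewrite !mxE; exact: lauf_linc.
Qed.

Lemma torus_expand : exists N K (Q : nat -> 'M[k]_d), forall (A : comAlgType k) (t u : A), t * u = 1 ->
  slact M (torus t u) = \sum_(i < K) (t ^+ i * u ^+ N) *: ext A (Q i).
Proof.
have [N [P H]] := torus_poly; exists N, (msz P), (fun i => mcoef i P) => A t u tu.
rewrite H // mhev scaler_sumr; apply: eq_bigr => i _.
by rewrite scalerA mulrC.
Qed.

Lemma bcoef_sumXY m n K (C : nat -> nat -> 'M[k]_(m, n)) (i0 j0 : nat) : (i0 < K)%N -> (j0 < K)%N ->
  bcoef i0 j0 (\sum_(i < K) \sum_(j < K) (xx k ^+ i * yy k ^+ j) *: ext (R2 k) (C i j)) = C i0 j0.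
Proof.
move=> hi hj.
transitivity (\sum_(i < K) \sum_(j < K) ((i0 == i) && (j0 == j))%:R *: C i j).
  rewrite (@bcoef_sum k m n i0 j0 'I_K); apply: eq_bigr => i _.
  by rewrite (@bcoef_sum k m n i0 j0 'I_K); apply: eq_bigr => j _; exact: bcoefXY.
rewrite (bigD1 (Ordinal hi)) //= [X in _ + X]big1 ?addr0 => [|i ni]; last first.
  rewrite big1 // => j _; rewrite (_ : _ && _ = false) ?scale0r //.
  by apply/negP => /andP[/eqP e _]; case/eqP: ni; apply: val_inj.
rewrite (bigD1 (Ordinal hj)) //= [X in _ + X]big1 ?addr0 => [|j nj]; last first.
  rewrite (_ : _ && _ = false) ?scale0r //.
  by apply/negP => /andP[_ /eqP e]; case/eqP: nj; apply: val_inj.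
by rewrite !eqxx scale1r.
Qed.

Definition torus_expands N K (Q : nat -> 'M[k]_d) :=
  forall (A : comAlgType k) (t u : A), t * u = 1 ->
    slact M (torus t u) = \sum_(i < K) (t ^+ i * u ^+ N) *: ext A (Q i).

Lemma torus_expands_mul N K Q (A : comAlgType k) (t u t' u' : A) : torus_expands N K Q ->
  t * u = 1 -> t' * u' = 1 ->
  \sum_(i < K) \sum_(j < K) (t ^+ i * t' ^+ j) *: ext A (Q i *m Q j) =
  \sum_(i < K) \sum_(j < K) (t ^+ i * t' ^+ j) *: ext A ((i == j :> nat)%:R *: Q j).
Proof.
move=> H tu tu'; have tt : (t * t') * (u * u') = 1 by rewrite mulrACA tu tu' mulr1.
have cancel := torus_cancel N _ _ tt.
transitivity ((t * t') ^+ N *: (slact M (torus t u) *m slact M (torus t' u'))).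
  rewrite !H // mulmx_suml scaler_sumr; apply: eq_bigr => i _.
  rewrite mulmx_sumr scaler_sumr; apply: eq_bigr => j _.
  by rewrite -scalemxAl -scalemxAr !scalerA extM -mulrA cancel.
rewrite -slactM ?det_torus // torusM H // scaler_sumr; apply: eq_bigr => i _.
rewrite (bigD1 i) //= eqxx scale1r big1 ?addr0 => [|j nj]; last first.
  by rewrite (_ : _ == _ = false) ?scale0r ?ext0 ?scaler0 // eq_sym; apply/eqP => /val_inj/eqP; apply/negP.
rewrite scalerA -(cancel i i); congr (_ *: _).
by congr (_ * _); rewrite !exprMn mulrACA.
Qed.

(** The product of two generic elements of the torus is again an element of the
    torus.  Comparing coefficients over k[x, y][1/(x y)] shows that the
    coefficients of the action are orthogonal idempotents. *)
Lemma torus_orth N K Q : torus_expands N K Q ->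
  (forall i j, (i < K)%N -> (j < K)%N -> Q i *m Q j = (i == j)%:R *: Q j) /\
  \sum_(i < K) Q i = 1%:M.
Proof.
move=> H; split; last first.
  apply: (@ext_inj k {poly k}); rewrite ext_sum ext1.
  have := H {poly k} 1 1 (mulr1 1); rewrite torusE mx2_1 slact1 => ->.
  by apply: eq_bigr => i _; rewrite !expr1n mulr1 scale1r.
pose f := linc (R2_expn0 (@R2_xy_neq0 k)).
have [u [u' [tu tu']]] : exists u u', f (xx k) * u = 1 /\ f (yy k) * u' = 1.
  by apply: unit_factors; rewrite -(rmorphM f); exact: lincV.
pose C1 := (fun i j : nat => Q i *m Q j).
pose C2 := (fun i j : nat => (i == j)%:R *: Q j : 'M[k]_d).
have fsum (C : nat -> nat -> 'M[k]_d) :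
  map_mx f (\sum_(i < K) \sum_(j < K) (xx k ^+ i * yy k ^+ j) *: ext (R2 k) (C i j)) =
  \sum_(i < K) \sum_(j < K) (f (xx k) ^+ i * f (yy k) ^+ j) *: ext _ (C i j).
  rewrite (map_mx_sum2 f K (fun i j => xx k ^+ i * yy k ^+ j)).
  apply: eq_bigr => i _; apply: eq_bigr => j _; congr (_ *: _); exact: (rmorphXY f).
have key := lr_mx_inj (@R2_linc_inj _ _ (R2_expn0 (@R2_xy_neq0 k)))
  (etrans (fsum C1) (etrans (torus_expands_mul H tu tu') (esym (fsum C2)))).
move=> i j hi hj.
exact: (etrans (esym (@bcoef_sumXY _ _ K C1 _ _ hi hj))
  (etrans (congr1 (bcoef i j) key) (@bcoef_sumXY _ _ K C2 _ _ hi hj))).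
Qed.
End Weights.

(** * Weight space decompositions *)

Section WeightProj.
Variable k : fieldType.

Lemma map_mx_sumX (A B : comAlgType k) (f : {lrmorphism A -> B}) m n K
  (x : A) b (C : nat -> 'M[k]_(m, n)) :
  map_mx f (\sum_(i < K) x ^+ (i + b) *: ext A (C i)) = \sum_(i < K) f x ^+ (i + b) *: ext B (C i).
Proof.
rewrite raddf_sum; apply: eq_bigr => i _.
by rewrite /= map_mxZ rmorphXn /= ext_map.
Qed.

Lemma lau_coef m n K (C : nat -> 'M[k]_(m, n)) b e (D : 'M[k]_(m, n)) :
  \sum_(i < K) lt k ^+ (i + b) *: ext (Lau k) (C i) = lt k ^+ e *: ext (Lau k) D ->
  forall i, (i < K)%N -> C i = (i + b == e)%:R *: D.
Proof.
move=> h i iK.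
have h' : map_mx (linc (@polyX_expn0 k)) (\sum_(i < K) 'X ^+ (i + b) *: ext {poly k} (C i)) =
          map_mx (linc (@polyX_expn0 k)) ('X ^+ e *: ext {poly k} D).
  apply: (etrans (map_mx_sumX _ _ _ _ _)); apply: (etrans h).
  by rewrite map_mxZ rmorphXn ext_map.
have := congr1 (mcoef (i + b)) (lr_mx_inj (@Lau_inj k) h').
rewrite mcoefXn => <-; rewrite mcoef_sum (bigD1 (Ordinal iK)) //= mcoefXn eqxx scale1r.
rewrite big1 ?addr0 // => j nj; rewrite mcoefXn eqn_add2r (_ : _ == _ = false) ?scale0r //.
by apply/eqP => e'; case/eqP: nj; apply: val_inj.
Qed.

Lemma expand_weight (A : comAlgType k) (t u : A) (tu : t * u = 1) n N K (Q : nat -> 'cV[k]_n) r a b v :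
  r = a%:Z - b%:Z ->
  \sum_(i < K) (t ^+ i * u ^+ N) *: ext A (Q i) = torus_char t u r *: v ->
  \sum_(i < K) t ^+ (i + b) *: ext A (Q i) = t ^+ (a + N) *: v.
Proof.
move=> er /(congr1 (fun z => t ^+ (N + b) *: z)); rewrite (tcE tu er) scalerA.
have -> : t ^+ (N + b) * (t ^+ a * u ^+ b) = t ^+ (a + N).
  transitivity (t ^+ a * t ^+ N * (t ^+ b * u ^+ b)); first by rewrite !exprD; ring.
  by rewrite tu_expn // mulr1 exprD.
move=> <-; rewrite scaler_sumr; apply: eq_bigr => i _; rewrite scalerA; congr (_ *: _).
transitivity (t ^+ i * t ^+ b * (t ^+ N * u ^+ N)); last by rewrite !exprD; ring.
by rewrite tu_expn // mulr1 exprD.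
Qed.

Variable M : SL2mod k.
Notation d := (sldim M).

(** Over Laurent polynomials the different powers of t are independent, so only one
    coefficient of the action can be nonzero on a weight vector. *)
Lemma weight_coef N K Q r v : torus_expands (M := M) N K Q -> weight_vector r v ->
  forall i, (i < K)%N -> Q i *m v = (i%:Z - N%:Z == r)%:R *: v.
Proof.
move=> H wv i iK; have [a [b er]] := intab r.
have e : \sum_(i < K) (lt k ^+ i * lu k ^+ N) *: ext (Lau k) (Q i *m v) =
         torus_char (lt k) (lu k) r *: ext (Lau k) v.
  rewrite -wv ?ltu // H ?ltu // mulmx_suml; apply: eq_bigr => j _.
  by rewrite extM scalemxAl.
pose C i := Q i *m v.
have e' := @expand_weight (Lau k) _ _ (@ltu k) d N K C r a b (ext _ v) er e.
have -> : Q i *m v = _ := @lau_coef _ _ K C b (a + N)%N v e' i iK.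
by congr (_%:R *: _); congr nat_of_bool; apply/eqP/eqP; lia.
Qed.

(** The coefficients of the generic element of the torus are the projections onto
    the weight spaces. *)
Lemma wproj_exists : exists P : int -> 'M[k]_d, exists s : seq int,
  [/\ forall r v, weight_vector r (P r *m v),
      forall r v, weight_vector r v -> P r *m v = v,
      forall r r' v, weight_vector r' v -> r <> r' -> P r *m v = 0 &
      \sum_(r <- s) P r = 1%:M].
Proof.
have [N [K [Q H]]] := torus_expand M.
have [orth sum1] := torus_orth H.
pose P (r : int) := if r + N%:Z is Posz i then if (i < K)%N then Q i else 0 else 0.
have PE i : (i < K)%N -> P (i%:Z - N%:Z) = Q i.
  by move=> iK; rewrite /P subrK iK.
have Pcase r : (exists2 i, (i < K)%N & r = i%:Z - N%:Z) \/ P r = 0.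
  case e : (r + N%:Z) => [i|i]; last by right; rewrite /P e.
  case: (ltnP i K) => iK; last by right; rewrite /P e ltnNge iK.
  by left; exists i => //; lia.
have Qsum v : v = \sum_(i < K) Q i *m v by rewrite -mulmx_suml sum1 mul1mx.
exists P, [seq i%:Z - N%:Z | i <- iota 0 K]; split.
- move=> r v A t u tu; case: (Pcase r) => [[i iK ->]|->]; last by rewrite mul0mx ext0 mulmx0 scaler0.
  rewrite PE // H // mulmx_suml (bigD1 (Ordinal iK)) //= big1 ?addr0 => [|j nj]; last first.
    rewrite -scalemxAl -extM mulmxA orth // (_ : _ == _ = false) ?scale0r ?mul0mx ?ext0 ?scaler0 //.
    by apply/eqP => e'; case/eqP: nj; apply: val_inj.
  by rewrite -scalemxAl -extM mulmxA orth // eqxx scale1r (tcE tu (erefl (i%:Z - N%:Z))).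
- move=> r v wv; case: (Pcase r) => [[i iK e]|e0].
    by rewrite e PE // (weight_coef H wv) // -e eqxx scale1r.
  rewrite e0 mul0mx [RHS]Qsum big1 // => i _.
  have [e|ne] := eqVneq (i%:Z - N%:Z) r; first by rewrite -PE // e e0 mul0mx.
  by rewrite (weight_coef H wv) // (negPf ne) scale0r.
- move=> r r' v wv ne; case: (Pcase r) => [[i iK e]|->]; last by rewrite mul0mx.
  by rewrite e PE // (weight_coef H wv) // -e; case: eqP => // _; rewrite scale0r.
rewrite big_map -sum1 (_ : iota 0 K = index_iota 0 K) ?big_mkord; last by rewrite /index_iota subn0.
by apply: eq_bigr => i _; rewrite PE.
Qed.
End WeightProj.

Section Wproj.
Variables (k : fieldType).
Implicit Types M N : SL2mod k.
Definition wproj M : int -> 'M[k]_(sldim M) := projT1 (cid (wproj_exists M)).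
Definition wrange M : seq int := projT1 (cid (projT2 (cid (wproj_exists M)))).

Lemma wproj_spec M : [/\ forall r v, weight_vector r (wproj M r *m v),
      forall r v, weight_vector r v -> wproj M r *m v = v,
      forall r r' v, weight_vector r' v -> r <> r' -> wproj M r *m v = 0 &
      \sum_(r <- wrange M) wproj M r = 1%:M].
Proof. by rewrite /wproj /wrange; case: cid => P h /=; case: cid. Qed.

Lemma wprojW M r v : weight_vector r (wproj M r *m v).
Proof. by case: (wproj_spec M). Qed.
Lemma wproj_id M r v : weight_vector r v -> wproj M r *m v = v.
Proof. by case: (wproj_spec M) => _ h _ _; apply: h. Qed.
Lemma wproj_ne M r r' v : weight_vector r' v -> r <> r' -> wproj M r *m v = 0.
Proof. by case: (wproj_spec M) => _ _ h _; apply: h. Qed.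
Lemma wproj_sum M (v : 'cV_(sldim M)) : v = \sum_(r <- wrange M) wproj M r *m v.
Proof. by case: (wproj_spec M) => _ _ _ h; rewrite -mulmx_suml h mul1mx. Qed.

Lemma weight_subspace M r : subspace_pred (@weight_vector k M r).
Proof.
split=> [A t u _|c x y hx hy A t u tu]; first by rewrite ext0 mulmx0 scaler0.
by rewrite extD extZ mulmxDr -scalemxAr hx // hy // scalerDr !scalerA mulrC.
Qed.
Lemma weight0 M r : @weight_vector k M r 0.
Proof. by have [] := weight_subspace M r. Qed.
Lemma weightZ M r c v : weight_vector r v -> @weight_vector k M r (c *: v).
Proof.
by move=> h; have [h0 hl] := weight_subspace M r; rewrite -[_ *: _]addr0; apply: hl.
Qed.
Lemma weight_hom M N (X : 'M_(sldim N, sldim M)) r v : SL2hom X -> weight_vector r v ->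
  @weight_vector k N r (X *m v).
Proof.
move=> hX hv A t u tu.
by rewrite extM mulmxA -hX ?det_torus // -mulmxA hv // scalemxAr.
Qed.
Lemma weight_uniq M r s v : @weight_vector k M r v -> weight_vector s v -> r <> s -> v = 0.
Proof. by move=> hr hs ne; rewrite -(wproj_id hr); apply: wproj_ne hs ne. Qed.

(** The list [wrange M] may contain repetitions; the factor c that accounts for
    them is eliminated by comparison with the identity homomorphism. *)
Lemma wproj_hom M N (X : 'M_(sldim N, sldim M)) r (v : 'cV_(sldim M)) : SL2hom X ->
  wproj N r *m (X *m v) = X *m (wproj M r *m v).
Proof.
move=> hX; pose c : k := \sum_(s <- wrange M) (r == s)%:R.
have H L (Y : 'M_(sldim L, sldim M)) : SL2hom Y ->
    wproj L r *m (Y *m v) = c *: (Y *m (wproj M r *m v)).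
  move=> hY; rewrite {1}[v]wproj_sum !mulmx_sumr /c scaler_suml; apply: eq_bigr => s _.
  have w := weight_hom hY (wprojW s v).
  case: eqP => [->|ne]; first by rewrite wproj_id // scale1r.
  by rewrite (wproj_ne w ne) scale0r.
have h1 : SL2hom (1%:M : 'M_(sldim M, sldim M)).
  by move=> A g _; rewrite ext1 mul1mx mulmx1.
have := H M 1%:M h1; rewrite !mul1mx => e.
by rewrite H // scalemxAr -e.
Qed.

(** Weight vectors lift along surjections, by projecting any lift to the weight
    space. *)
Lemma weight_lift M N (q : 'M_(sldim N, sldim M)) r w : SL2hom q -> weight_vector r w ->
  (exists v, w = q *m v) -> exists2 v, @weight_vector k M r v & q *m v = w.
Proof.
move=> hq hw [v e]; exists (wproj M r *m v); first exact: wprojW.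
by rewrite -(wproj_hom _ _ hq) -e wproj_id.
Qed.

Lemma weight_sub M N (i : 'M_(sldim N, sldim M)) r v : SL2hom i ->
  injective (fun v : 'cV[k]_(sldim M) => i *m v) ->
  weight_vector r (i *m v) -> @weight_vector k M r v.
Proof.
move=> hi inj hw; rewrite -(_ : wproj M r *m v = v); first exact: wprojW.
by apply: inj; rewrite -wproj_hom // wproj_id.
Qed.
End Wproj.

(** * Tensoring with the natural module; explicit Weyl modules *)

Section VM.
Variables (k : fieldType).
Implicit Types M N : SL2mod k.

Section Def.
Variable M : SL2mod k.
Definition vm_act (A : comAlgType k) (g : 'M[A]_2) : 'M[A]_(sldim M + sldim M) :=
  block_mx (g 0 0 *: slact M g) (g 0 1 *: slact M g) (g 1 0 *: slact M g) (g 1 1 *: slact M g).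
Lemma vm_act1 (A : comAlgType k) : vm_act (1%:M : 'M[A]_2) = 1%:M.
Proof. by rewrite /vm_act !mxE !slact1 /= !scale1r !scale0r -scalar_mx_block. Qed.
Lemma vm_actM (A : comAlgType k) (g h : 'M[A]_2) : \det g = 1 -> \det h = 1 ->
  vm_act (g *m h) = vm_act g *m vm_act h.
Proof.
move=> dg dh; rewrite /vm_act mulmx_block slactM // !mxE !sum2.
by rewrite -!scalemxAl -!scalemxAr !scalerA -!scalerDl.
Qed.
Lemma vm_act_nat (A B : comAlgType k) (f : {lrmorphism A -> B}) (g : 'M[A]_2) :
  \det g = 1 -> map_mx f (vm_act g) = vm_act (map_mx f g).
Proof. by move=> dg; rewrite /vm_act map_block_mx !map_mxZ slact_nat // !mxE. Qed.
(** The tensor product of the natural module with M, in block form. *)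
Definition VM : SL2mod k := SL2Mod vm_act1 vm_actM vm_act_nat.
End Def.

Definition triv : SL2mod k :=
  @SL2Mod k 1 (fun A g => 1%:M) (fun A => erefl) (fun A g h _ _ => esym (mulmx1 _))
    (fun A B f g _ => map_mx1 f 1).

Fixpoint W n : SL2mod k := if n is n'.+1 then VM (W n') else triv.

Definition dg2 m n (X : 'M[k]_(m, n)) : 'M_(m + m, n + n) := block_mx X 0 0 X.

Lemma VM_hom M N (X : 'M_(sldim N, sldim M)) : SL2hom X -> @SL2hom k (VM M) (VM N) (dg2 X).
Proof.
move=> hX A g dg; rewrite /= /vm_act /dg2 ext_block !ext0 !mulmx_block !mul0mx !mulmx0.
by rewrite !addr0 !add0r -!scalemxAr -!scalemxAl hX.
Qed.

Lemma weight_VM M r (v0 v1 : 'cV_(sldim M)) :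
  @weight_vector k (VM M) r (col_mx v0 v1) <->
  weight_vector (r - 1) v0 /\ weight_vector (r + 1) v1.
Proof.
have key (A : comAlgType k) (t u : A) : t * u = 1 ->
    slact (VM M) (torus t u) *m ext A (col_mx v0 v1) =
    col_mx (t *: (slact M (torus t u) *m ext A v0)) (u *: (slact M (torus t u) *m ext A v1)).
  move=> tu; rewrite /= /vm_act ext_col mul_block_col torusE !mxE /= !scale0r !mul0mx addr0 add0r.
  by rewrite -!scalemxAl.
split=> [h|[h0 h1] A t u tu]; last first.
  rewrite key // h0 // h1 // !scalerA ext_col scale_col_mx; congr (col_mx (_ *: _) (_ *: _)).
    by rewrite -{1}(tc1 t u) -tcD // [in LHS]addrC subrK.
  by rewrite -{1}(tcN1 t u) -tcD // [in LHS]addrC addrK.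
split=> A t u tu; have := h A t u tu; rewrite key // ext_col scale_col_mx => /eq_col_mx[e0 e1].
  rewrite -[LHS]scale1r -tu mulrC -scalerA e0 scalerA; congr (_ *: _).
  by rewrite -{1}(tcN1 t u) -tcD // addrC.
rewrite -[LHS]scale1r -tu -scalerA e1 scalerA; congr (_ *: _).
by rewrite -{1}(tc1 t u) -tcD // addrC.
Qed.

(** The natural module is self-dual through the determinant, so tensoring with it is
    self-adjoint: one half of the adjunction. *)
Lemma adj_to M N (f0 f1 : 'M_(sldim N, sldim M)) :
  @SL2hom k M (VM N) (col_mx f0 f1) -> @SL2hom k (VM M) N (row_mx f1 (- f0)).
Proof.
move=> h A g dg; have := h A g dg.
rewrite /= /vm_act !ext_col mul_block_col mul_col_mx => /eq_col_mx[e0 e1].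
rewrite ext_row mul_row_block mul_mx_row extN !mulNmx !mulmxN -!scalemxAr e0 e1.
have dt : g 0 0 * g 1 1 - g 0 1 * g 1 0 = 1 by rewrite -det2.
rewrite -!scalemxAl !scalerDr !scalerA; congr row_mx.
  rewrite opprD addrACA [g 1 0 * g 0 0]mulrC subrr add0r -scalerBl [g 1 0 * _]mulrC.
  by rewrite dt scale1r.
rewrite opprD addrACA [g 1 1 * g 0 1]mulrC subrr addr0 -scalerBl -[RHS]scaleN1r -dt.
by congr (_ *: _); ring.
Qed.

(** The other half of the adjunction [adj_to]. *)
Lemma adj_of M N (h0 h1 : 'M_(sldim N, sldim M)) :
  @SL2hom k (VM M) N (row_mx h0 h1) -> @SL2hom k M (VM N) (col_mx (- h1) h0).
Proof.
move=> h A g dg; have := h A g dg.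
rewrite /= /vm_act !ext_row mul_row_block mul_mx_row => /eq_row_mx[e0 e1].
rewrite !ext_col mul_block_col mul_col_mx extN !mulNmx !mulmxN -!scalemxAl -e0 -e1.
have dt : g 0 0 * g 1 1 - g 0 1 * g 1 0 = 1 by rewrite -det2.
rewrite -!scalemxAr !scalerDr !scalerA; congr col_mx.
  rewrite opprD addrACA [g 0 1 * g 0 0]mulrC addNr add0r -scaleNr -scalerDl -[LHS]scaleN1r -dt.
  by congr (_ *: _); ring.
rewrite opprD addrACA [g 1 1 * g 1 0]mulrC addNr addr0 -scaleNr -scalerDl -[LHS]scale1r -dt.
by congr (_ *: _); ring.
Qed.
End VM.

Section MxE.
Variables (R : comNzRingType) (m n : nat).
Implicit Types (X Y : 'M[R]_(m, n)).
Lemma mxDE X Y i j : (X + Y) i j = X i j + Y i j. Proof. exact: mxE. Qed.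
Lemma mxNE X i j : (- X) i j = - X i j. Proof. exact: mxE. Qed.
Lemma mxZE a X i j : (a *: X) i j = a * X i j. Proof. exact: mxE. Qed.
End MxE.

Section WeylRows.
Variables (k : fieldType).

(** A row of a Weyl module as a polynomial: the product of powers of the two linear
    forms given by the inverse matrix. *)
Definition wrow (A : comNzRingType) m (g : 'M[A]_2) (i : nat) : {poly A} :=
  ((g 1 1)%:P - (g 1 0) *: 'X) ^+ (m - i) * (- (g 0 1)%:P + g 0 0 *: 'X) ^+ i.

Lemma weylE m (A : comAlgType k) (g : 'M[A]_2) i j :
  slact (Weyl k m) g i j = (wrow m g i)`_j.
Proof.
rewrite /= /dual_act mxE /= mxE /sym_form /linform adj2 !mxE /= /wrow.
by rewrite polyCN scaleNr.
Qed.

Lemma size_wrow (A : comNzRingType) m (g : 'M[A]_2) i : (i <= m)%N -> (size (wrow m g i) <= m.+1)%N.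
Proof.
move=> im; rewrite /wrow -[- (g 0 1)%:P]polyCN -scaleNr.
have h (u v : A) e : (size ((u%:P + v *: 'X) ^+ e)%R <= e.+1)%N.
  by have := @size_mul_linX A 0 e 1 u v; rewrite mul1r size_poly1 addn0; apply.
have := @size_mul_linX A (m - i) i _ (- g 0 1) (g 0 0) (h (g 1 1) (- g 1 0) (m - i)%N).
by rewrite subnKC.
Qed.

Definition shl m : 'M[k]_(m.+1, m.+2) := \matrix_(i, j) (j == i.+1 :> nat)%:R.
Definition idl m : 'M[k]_(m.+1, m.+2) := \matrix_(i, j) (j == i :> nat)%:R.

Lemma shl_mul (A : comAlgType k) m n (P : 'M[A]_(m.+2, n)) i j :
  (ext A (shl m) *m P) i j = P (lift ord0 i) j.
Proof.
rewrite mxE (bigD1 (lift ord0 i)) //= big1 ?addr0 => [|l nl].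
  by rewrite !mxE eqxx rmorph1 mul1r.
rewrite !mxE (_ : _ == _ = false) ?rmorph0 ?mul0r //.
by apply: contraNF nl => /eqP e; apply/eqP/val_inj; rewrite /= e.
Qed.
Lemma idl_mul (A : comAlgType k) m n (P : 'M[A]_(m.+2, n)) i j :
  (ext A (idl m) *m P) i j = P (widen_ord (leqnSn _) i) j.
Proof.
rewrite mxE (bigD1 (widen_ord (leqnSn _) i)) //= big1 ?addr0 => [|l nl].
  by rewrite !mxE eqxx rmorph1 mul1r.
rewrite !mxE (_ : _ == _ = false) ?rmorph0 ?mul0r //.
by apply: contraNF nl => /eqP e; apply/eqP/val_inj; rewrite /= e.
Qed.
Lemma mul_shl (A : comAlgType k) m n (P : 'M[A]_(n, m.+1)) i j (R : {poly A}) :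
  (forall j, P i j = R`_j) -> (size R <= m.+1)%N ->
  (P *m ext A (shl m)) i j = (R * 'X)`_j.
Proof.
move=> e sR; rewrite mxE coefMX; case: j => [[|j] hj] /=.
  by rewrite big1 // => l _; rewrite !mxE /= scale0r mulr0.
rewrite (bigD1 (Ordinal (hj : (j < m.+1)%N))) //= big1 ?addr0 => [|l nl].
  by rewrite !mxE /= eqxx scale1r mulr1 e.
rewrite !mxE /= (_ : _ == _ = false) ?scale0r ?mulr0 //.
by apply: contraNF nl => /eqP[e']; apply/eqP/val_inj; rewrite /= e'.
Qed.
Lemma mul_idl (A : comAlgType k) m n (P : 'M[A]_(n, m.+1)) i j (R : {poly A}) :
  (forall j, P i j = R`_j) -> (size R <= m.+1)%N ->
  (P *m ext A (idl m)) i j = R`_j.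
Proof.
move=> e sR; rewrite mxE; case: j => [j hj] /=.
have [jm|mj] := ltnP j m.+1; last first.
  rewrite nth_default ?(leq_trans sR) // big1 // => l _.
  by rewrite !mxE /= gtn_eqF ?scale0r ?mulr0 // (leq_trans (ltn_ord l)).
rewrite (bigD1 (Ordinal jm)) //= big1 ?addr0 => [|l nl].
  by rewrite !mxE /= eqxx scale1r mulr1 e.
rewrite !mxE /= (_ : _ == _ = false) ?scale0r ?mulr0 //.
by apply: contraNF nl => /eqP e'; apply/eqP/val_inj; rewrite /= e'.
Qed.

(** The inclusion of Delta(m + 1) in V (x) Delta(m), dual to the multiplication of
    binary forms. *)
Definition weyl_in m : 'M[k]_(m.+1 + m.+1, m.+2) := col_mx (shl m) (- idl m).
Lemma weyl_in_hom m : @SL2hom k (Weyl k m.+1) (VM (Weyl k m)) (weyl_in m).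
Proof.
move=> A g dg; rewrite /weyl_in ext_col mul_col_mx extN mulNmx [slact (VM _) g]/= /vm_act.
rewrite mul_block_col -!scalemxAl !mulmxN.
have sz (i : 'I_m.+1) := @size_wrow A m g i (ltn_ord i : (i <= m)%N).
congr col_mx; apply/matrixP=> i j; rewrite !(mxDE, mxNE, mxZE)
    (mul_shl _ (weylE g i) (sz i)) (mul_idl _ (weylE g i) (sz i)).
  rewrite shl_mul weylE /wrow /= /bump /= add1n subSS exprSr mulrA mulrDr coefD addrC.
  rewrite -scalerAr coefZ mulrN coefN coefMC [in RHS]mulrN; congr (_ - _); exact: mulrC.
rewrite idl_mul weylE /wrow /= subSn ?leq_ord // exprSr mulrAC mulrBr coefB opprB.
rewrite -scalerAr coefZ coefMC [in RHS]mulrN; congr (_ - _); exact: mulrC.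
Qed.

(** The projection of V (x) Delta(m + 1) onto Delta(m), dual to the multiplication
    of binary forms by the invariant of two copies of V. *)
Definition weyl_out m : 'M[k]_(m.+1, m.+2 + m.+2) := row_mx (idl m) (shl m).
Lemma weyl_out_hom m : @SL2hom k (VM (Weyl k m.+1)) (Weyl k m) (weyl_out m).
Proof.
move=> A g dg; rewrite /weyl_out ext_row [slact (VM _) g]/= /vm_act.
rewrite mul_row_block mul_mx_row -!scalemxAr.
have dt : g 0 0 * g 1 1 - g 0 1 * g 1 0 = 1 by rewrite -det2.
have sz (i : 'I_m.+1) := @size_wrow A m g i (ltn_ord i : (i <= m)%N).
have eW (i : 'I_m.+1) : wrow m.+1 g i = wrow m g i * ((g 1 1)%:P - g 1 0 *: 'X).
  by rewrite /wrow subSn -1?ltnS ?ltn_ord // exprSr mulrAC.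
have eS (i : 'I_m.+1) : wrow m.+1 g i.+1 = wrow m g i * (- (g 0 1)%:P + g 0 0 *: 'X).
  by rewrite /wrow subSS exprSr mulrA.
congr row_mx; apply/matrixP=> i j; rewrite !(mxDE, mxZE)
  idl_mul shl_mul !weylE /= /bump /= add1n eW eS.
  rewrite (mul_idl _ (weylE g i) (sz i)) -!coefZ -coefD !scalerAr -!mulrDr.
  rewrite (_ : _ + _ = 1) ?mulr1 //.
  rewrite !scalerDr !scalerN !scalerA -!mul_polyC -!polyCM -!polyCN -polyC1 -dt !polyCB !polyCM; ring.
rewrite (mul_shl _ (weylE g i) (sz i)) -!coefZ -coefD !scalerAr -!mulrDr.
congr (polyseq (_ * _))`_ _.
transitivity ((g 0 0 * g 1 1 - g 0 1 * g 1 0)%:P * 'X); last by rewrite dt polyC1 mul1r.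
rewrite -!mul_polyC polyCB !polyCM; ring.
Qed.
End WeylRows.

(** * Divided powers and highest weight vectors *)

Section Divided.
Variable k : fieldType.
Implicit Types M N : SL2mod k.

(** The divided power E^(j): the coefficient of X^j in the action of the generic
    upper unipotent element. *)
Definition Ec M j : 'M[k]_(sldim M) := mcoef j (slact M (up ('X : {poly k}))).
(** The divided power F^(j). *)
Definition Fc M j : 'M[k]_(sldim M) := mcoef j (slact M (lo ('X : {poly k}))).
Definition dK M := (msz (slact M (up ('X : {poly k}))) + msz (slact M (lo ('X : {poly k})))).+1.

Lemma Ec_ge M j : (dK M <= j)%N -> Ec M j = 0.
Proof. by move=> le; apply: mcoef_ge; apply: leq_trans le; rewrite leqW // leq_addr. Qed.
Lemma Fc_ge M j : (dK M <= j)%N -> Fc M j = 0.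
Proof. by move=> le; apply: mcoef_ge; apply: leq_trans le; rewrite leqW // leq_addl. Qed.

Lemma sum_trunc (V : nmodType) K K' (F : nat -> V) : (K <= K')%N ->
  (forall j, (K <= j)%N -> F j = 0) -> \sum_(j < K) F j = \sum_(j < K') F j.
Proof.
move=> le F0; rewrite (big_ord_widen _ F le) [RHS](bigID (fun j : 'I_K' => (j < K)%N)) /=.
by rewrite [X in _ = _ + X]big1 ?addr0 // => j; rewrite -leqNgt => /F0.
Qed.

Lemma slact_up M (A : comAlgType k) (x : A) :
  slact M (up x) = \sum_(j < dK M) x ^+ j *: ext A (Ec M j).
Proof.
rewrite -{1}(hevX x) -map_up -slact_nat ?det_up // mhev.
apply: (sum_trunc (F := fun j => x ^+ j *: ext A (Ec M j))); first by rewrite leqW // leq_addr.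
by move=> j le; rewrite /Ec mcoef_ge // ext0 scaler0.
Qed.
Lemma slact_lo M (A : comAlgType k) (x : A) :
  slact M (lo x) = \sum_(j < dK M) x ^+ j *: ext A (Fc M j).
Proof.
rewrite -{1}(hevX x) -map_lo -slact_nat ?det_lo // mhev.
apply: (sum_trunc (F := fun j => x ^+ j *: ext A (Fc M j))); first by rewrite leqW // leq_addl.
by move=> j le; rewrite /Fc mcoef_ge // ext0 scaler0.
Qed.
Lemma slact_upv M (A : comAlgType k) (x : A) n (v : 'M_(_, n)) :
  slact M (up x) *m ext A v = \sum_(j < dK M) x ^+ j *: ext A (Ec M j *m v).
Proof. by rewrite slact_up mulmx_suml; apply: eq_bigr => j _; rewrite -scalemxAl extM. Qed.
Lemma slact_lov M (A : comAlgType k) (x : A) n (v : 'M_(_, n)) :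
  slact M (lo x) *m ext A v = \sum_(j < dK M) x ^+ j *: ext A (Fc M j *m v).
Proof. by rewrite slact_lo mulmx_suml; apply: eq_bigr => j _; rewrite -scalemxAl extM. Qed.

Lemma Ec0 M : Ec M 0 = 1%:M.
Proof.
apply: (@ext_inj k {poly k}); rewrite ext1 -(slact1 M) -up0 slact_up /dK big_ord_recl.
rewrite expr0 scale1r big1 ?addr0 // => j _; by rewrite expr0n scale0r.
Qed.
Lemma Fc0 M : Fc M 0 = 1%:M.
Proof.
apply: (@ext_inj k {poly k}); rewrite ext1 -(slact1 M) -lo0 slact_lo /dK big_ord_recl.
rewrite expr0 scale1r big1 ?addr0 // => j _; by rewrite expr0n scale0r.
Qed.

Lemma torus_up (A : comAlgType k) (t u x : A) : t * u = 1 ->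
  torus t u *m up x = up (t ^+ 2 * x) *m torus t u.
Proof. by move=> tu; rewrite torusE !mx2M; congr mx2; ring: tu. Qed.
Lemma torus_lo (A : comAlgType k) (t u x : A) : t * u = 1 ->
  torus t u *m lo x = lo (u ^+ 2 * x) *m torus t u.
Proof. by move=> tu; rewrite torusE !mx2M; congr mx2; ring: tu. Qed.

(** Conjugation by the torus rescales the parameter of an upper unipotent element by
    t^2; this is the generating function of the statements for each j. *)
Lemma weight_E_gen M r (v : 'cV_(sldim M)) (A B : comAlgType k) (f : {lrmorphism A -> B}) (x : B) (t u : A) :
  t * u = 1 -> weight_vector r v ->
  \sum_(j < dK M) x ^+ j *: map_mx f (slact M (torus t u) *m ext A (Ec M j *m v)) =
  \sum_(j < dK M) x ^+ j *: map_mx f ((t ^+ (2 * j) * torus_char t u r) *: ext A (Ec M j *m v)).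
Proof.
move=> tu wv; have ftu : f t * f u = 1 by rewrite -rmorphM tu rmorph1.
transitivity (slact M (torus (f t) (f u)) *m (slact M (up x) *m ext B v)).
  rewrite slact_upv mulmx_sumr; apply: eq_bigr => j _.
  by rewrite map_mxM slact_nat ?det_torus // map_torus ext_map scalemxAr.
rewrite mulmxA -slactM ?det_torus ?det_up // torus_up // slactM ?det_torus ?det_up //.
rewrite -mulmxA wv // -scalemxAr slact_upv scaler_sumr; apply: eq_bigr => j _.
have [a [b er]] := intab r; rewrite (tcE tu er) (tcE ftu er).
rewrite scalerA map_mxZ ext_map scalerA; congr (_ *: _).
by rewrite !rmorphM !rmorphXn /= exprMn -exprM; ring.
Qed.

Lemma weight_F_gen M r (v : 'cV_(sldim M)) (A B : comAlgType k) (f : {lrmorphism A -> B}) (x : B) (t u : A) :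
  t * u = 1 -> weight_vector r v ->
  \sum_(j < dK M) x ^+ j *: map_mx f (slact M (torus t u) *m ext A (Fc M j *m v)) =
  \sum_(j < dK M) x ^+ j *: map_mx f ((u ^+ (2 * j) * torus_char t u r) *: ext A (Fc M j *m v)).
Proof.
move=> tu wv; have ftu : f t * f u = 1 by rewrite -rmorphM tu rmorph1.
transitivity (slact M (torus (f t) (f u)) *m (slact M (lo x) *m ext B v)).
  rewrite slact_lov mulmx_sumr; apply: eq_bigr => j _.
  by rewrite map_mxM slact_nat ?det_torus // map_torus ext_map scalemxAr.
rewrite mulmxA -slactM ?det_torus ?det_lo // torus_lo // slactM ?det_torus ?det_lo //.
rewrite -mulmxA wv // -scalemxAr slact_lov scaler_sumr; apply: eq_bigr => j _.
have [a [b er]] := intab r; rewrite (tcE tu er) (tcE ftu er).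
rewrite scalerA map_mxZ ext_map scalerA; congr (_ *: _).
by rewrite !rmorphM !rmorphXn /= exprMn -exprM; ring.
Qed.

Lemma weight_E M r v j : weight_vector r v -> @weight_vector k M (r + (2 * j)%:Z) (Ec M j *m v).
Proof.
move=> wv; case: (ltnP j (dK M)) => jK; last by rewrite Ec_ge // mul0mx; apply: weight0.
move=> A t u tu.
have -> := pk_coef2 (C := fun j => slact M (torus t u) *m ext A (Ec M j *m v))
  (D := fun j => (t ^+ (2 * j) * torus_char t u r) *: ext A (Ec M j *m v))
  (weight_E_gen (pkC A) (pkX A) tu wv) jK.
congr (_ *: _); rewrite tcD // mulrC; congr (_ * _).
Qed.
Lemma weight_F M r v j : weight_vector r v -> @weight_vector k M (r - (2 * j)%:Z) (Fc M j *m v).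
Proof.
move=> wv; case: (ltnP j (dK M)) => jK; last by rewrite Fc_ge // mul0mx; apply: weight0.
move=> A t u tu.
have -> := pk_coef2 (C := fun j => slact M (torus t u) *m ext A (Fc M j *m v))
  (D := fun j => (u ^+ (2 * j) * torus_char t u r) *: ext A (Fc M j *m v))
  (weight_F_gen (pkC A) (pkX A) tu wv) jK.
congr (_ *: _); rewrite tcD // mulrC; congr (_ * _).
by rewrite (tcE tu (_ : _ = 0%N%:Z - (2 * j)%N%:Z)) ?expr0 ?mul1r // sub0r.
Qed.

Lemma Ec_hom M N (X : 'M_(sldim N, sldim M)) j : SL2hom X -> X *m Ec M j = Ec N j *m X.
Proof.
by move=> hX; have := congr1 (mcoef j) (hX _ _ (det_up ('X : {poly k}))); rewrite mcoef_extl mcoef_extr.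
Qed.
Lemma Fc_hom M N (X : 'M_(sldim N, sldim M)) j : SL2hom X -> X *m Fc M j = Fc N j *m X.
Proof.
by move=> hX; have := congr1 (mcoef j) (hX _ _ (det_lo ('X : {poly k}))); rewrite mcoef_extl mcoef_extr.
Qed.

(** Vectors fixed by the upper unipotent subgroup, tested at its generic element. *)
Definition upfix M (v : 'cV_(sldim M)) : Prop := slact M (up ('X : {poly k})) *m ext {poly k} v = ext {poly k} v.
Lemma upfixE M v : upfix v <-> forall j, (0 < j)%N -> Ec M j *m v = 0.
Proof.
split=> [h [//|j] _|h].
  by have := congr1 (mcoef j.+1) h; rewrite mcoef_extr mcoef_ext scale0r.
rewrite /upfix slact_upv /dK big_ord_recl expr0 scale1r Ec0 mul1mx big1 ?addr0 // => j _.
by rewrite h // ext0 scaler0.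
Qed.
Lemma upfix_at M v (A : comAlgType k) (x : A) : @upfix M v -> slact M (up x) *m ext A v = ext A v.
Proof.
move/upfixE => h; rewrite slact_upv /dK big_ord_recl expr0 scale1r Ec0 mul1mx big1 ?addr0 // => j _.
by rewrite h // ext0 scaler0.
Qed.
Lemma upfix_hom M N (X : 'M_(sldim N, sldim M)) v : SL2hom X -> upfix v -> @upfix N (X *m v).
Proof. by move=> hX /upfixE h; apply/upfixE => j j0; rewrite mulmxA -Ec_hom // -mulmxA h ?mulmx0. Qed.
Definition HW M r (v : 'cV_(sldim M)) : Prop := weight_vector r v /\ upfix v.
Lemma HW_hom M N (X : 'M_(sldim N, sldim M)) r v : SL2hom X -> HW r v -> @HW N r (X *m v).
Proof. by move=> hX [h1 h2]; split; [apply: weight_hom | apply: upfix_hom]. Qed.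
Lemma HW_subspace M r : subspace_pred (@HW M r).
Proof.
have [w0 wl] := weight_subspace M r.
split=> [|c x y [hx ux] [hy uy]].
  by split=> //; rewrite /upfix ext0 mulmx0.
split; first exact: wl.
by rewrite /upfix extD extZ mulmxDr -scalemxAr ux uy.
Qed.

End Divided.

(** * The highest weight vector of a Weyl module *)

Section WeylVectors.
Variable k : fieldType.
Implicit Types (s : nat).

Definition wv s (i : 'I_s.+1) : 'cV[k]_(sldim (Weyl k s)) := delta_mx i 0.
Definition hwv s : 'cV[k]_(sldim (Weyl k s)) := wv ord_max.

Lemma weyl_torus s (A : comAlgType k) (t u : A) i j :
  slact (Weyl k s) (torus t u) i j = (i == j)%:R * (u ^+ (s - i) * t ^+ i).
Proof.
rewrite weylE /wrow torusE !mxE /= scale0r subr0 oppr0 add0r exprZn -polyC_exp.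
rewrite coefCM coefZ coefXn -val_eqE /= mulrA [LHS]mulrC eq_sym.
by [].
Qed.

Lemma ext_delta (A : comAlgType k) m n i j : ext A (delta_mx i j : 'M[k]_(m, n)) = delta_mx i j.
Proof. by rewrite /ext map_delta_mx. Qed.

Lemma weight_wv s (i : 'I_s.+1) : @weight_vector k (Weyl k s) ((2 * i)%N%:Z - s%:Z) (wv i).
Proof.
move=> A t u tu; rewrite /wv ext_delta -colE; apply/matrixP=> x y.
rewrite [y]ord1 mxE weyl_torus mxZE mxE eqxx andbT.
case: eqP => [->|_]; last by rewrite mul0r mulr0.
have hi : (i <= s)%N by rewrite -ltnS.
rewrite mul1r mulr1 (tcE tu (_ : _ = i%:Z - (s - i)%N%:Z)) 1?mulrC //.
by lia.
Qed.

Lemma weight_hwv s : @weight_vector k (Weyl k s) s (hwv s).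
Proof. by have := weight_wv (@ord_max s); rewrite /= (_ : _ - _ = s%:Z) //; lia. Qed.

Lemma coef_lin_top (A : comNzRingType) (c a : A) n : ((c%:P + a *: 'X) ^+ n)`_n = a ^+ n.
Proof.
elim: n => [|n IH]; first by rewrite !expr0 coef1.
rewrite exprSr mulrDr coefD coefMC -scalerAr coefZ coefMX /= IH nth_default ?mul0r ?add0r ?exprS //.
by have := @size_mul_linX A 0 n 1 c a; rewrite mul1r size_poly1 addn0; apply.
Qed.

(** The lower unipotent orbit of the highest weight vector meets every basis vector:
    the divided powers of F produce the basis of the Weyl module up to signs. *)
Lemma weyl_lo_hwv s (A : comAlgType k) (x : A) l :
  (slact (Weyl k s) (lo x) *m ext A (hwv s)) l 0 = (- x) ^+ (s - l).
Proof.
rewrite /hwv /wv ext_delta -colE mxE weylE /wrow !mxE /= oppr0 add0r scale1r.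
by rewrite coefMXn ltnNge -ltnS ltn_ord /= -scaleNr coef_lin_top.
Qed.

Lemma weyl_F_hwv s j l : (Fc (Weyl k s) j *m hwv s) l 0 = (-1) ^+ (s - l) * (j == (s - l)%N)%:R.
Proof.
have := congr1 (fun z => mcoef j z l 0) (erefl (slact (Weyl k s) (lo ('X : {poly k})) *m ext _ (hwv s))).
rewrite /= {1}mcoef_extr -/(Fc _ j) => ->.
have eX n : (- 'X : {poly k}) ^+ n = ((-1) ^+ n)%:P * 'X^n.
  by rewrite [LHS]exprNn rmorph_sign.
by rewrite mxE /= weyl_lo_hwv eX coefCM coefXn.
Qed.

Lemma upfix_hwv s : upfix (hwv s).
Proof.
rewrite /upfix /hwv /wv ext_delta -colE; apply/matrixP=> l y; rewrite [y]ord1 mxE weylE /wrow !mxE /=.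
rewrite scale0r subr0 scale1r expr1n mul1r eqxx andbT.
have [->|nl] := eqVneq l ord_max.
  by have := coef_lin_top (- 'X : {poly k}) 1 s; rewrite polyCN scale1r expr1n => ->.
rewrite nth_default // .
have := @size_mul_linX {poly k} 0 l 1 (- 'X) 1; rewrite mul1r size_poly1 addn0 polyCN scale1r => h.
apply: leq_trans (h _) _ => //; have := ltn_ord l; move: nl; rewrite -val_eqE /=; lia.
Qed.

Lemma HW_hwv s : HW s (hwv s).
Proof. by split; [exact: weight_hwv | exact: upfix_hwv]. Qed.
End WeylVectors.

Section Swap.
Variable k : fieldType.
(** The decomposition of an element of the big cell in the opposite order; it exists
    where 1 + x y is invertible. *)
Lemma uplo_swap (A : comAlgType k) (x y d' : A) : (1 + x * y) * d' = 1 ->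
  up x *m lo y = lo (y * d') *m torus (1 + x * y) d' *m up (d' * x).
Proof.
move=> e; rewrite torusE !mx2M; congr mx2; last first.
- transitivity (y * d' * x * ((1 + x * y) * d') + d'); last by ring.
  by rewrite e; transitivity ((1 + x * y) * d'); [rewrite e; ring | ring].
- by transitivity ((1 + x * y) * d' * y); [rewrite e mul1r; ring | ring].
- by transitivity ((1 + x * y) * d' * x); [rewrite e mul1r; ring | ring].
- by ring.
Qed.

Variable M : SL2mod k.
Lemma slact_swap (A : comAlgType k) (x y d' : A) : (1 + x * y) * d' = 1 ->
  slact M (up x) *m slact M (lo y) =
  slact M (lo (y * d')) *m slact M (torus (1 + x * y) d') *m slact M (up (d' * x)).
Proof.
move=> e; rewrite -!slactM ?det_mulmx ?det_up ?det_lo ?det_torus ?mulr1 //.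
by rewrite (uplo_swap e).
Qed.

Section Kill.
Variables (r : int) (v : 'cV[k]_(sldim M)) (phi : 'M[k]_(1, sldim M)).
Hypotheses (wv : weight_vector r v) (H1 : forall j, phi *m (Fc M j *m v) = 0).
Hypothesis H2 : forall j, (0 < j)%N -> forall (A : comAlgType k) (g : 'M[A]_2), \det g = 1 ->
  ext A phi *m (slact M g *m ext A (Ec M j *m v)) = 0.

Lemma kill_lo (A : comAlgType k) (y : A) : ext A phi *m (slact M (lo y) *m ext A v) = 0.
Proof.
rewrite slact_lov mulmx_sumr big1 // => j _; rewrite -scalemxAr -extM H1 ext0 scaler0 //.
Qed.

(** After moving the upper unipotent element to the right with [slact_swap], it acts
    on v as the identity up to the vectors E^(j) v, on which phi vanishes. *)
Lemma kill_uplo (A : comAlgType k) (x y d' : A) : (1 + x * y) * d' = 1 ->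
  ext A phi *m (slact M (up x) *m (slact M (lo y) *m ext A v)) = 0.
Proof.
move=> e; rewrite [slact M (up x) *m _]mulmxA (slact_swap e) -!mulmxA slact_upv.
rewrite /dK big_ord_recl expr0 scale1r Ec0 mul1mx !mulmxDr.
rewrite [X in _ + X]mulmxA [X in _ + X]mulmxA.
rewrite [X in _ + X](_ : _ = 0) ?addr0; last first.
  rewrite mulmx_sumr big1 // => j _; rewrite -scalemxAr -!mulmxA [X in _ *m X]mulmxA -slactM ?det_lo ?det_torus //.
  by rewrite H2 ?scaler0 // det_mulmx det_lo det_torus // mulr1.
by rewrite wv // -scalemxAr -scalemxAr kill_lo scaler0.
Qed.

Lemma map_uplo (A B : comAlgType k) (h : {lrmorphism A -> B}) (x y : A) :
  map_mx h (ext A phi *m (slact M (up x) *m (slact M (lo y) *m ext A v))) =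
  ext B phi *m (slact M (up (h x)) *m (slact M (lo (h y)) *m ext B v)).
Proof. by rewrite !map_mxM !ext_map !slact_nat ?det_up ?det_lo // map_up map_lo. Qed.

(** The identity [kill_uplo] holds over k[x, y][1/(1 + x y)], hence over k[x, y], and
    the coefficients of the powers of y separate the vectors F^(j) v. *)
Lemma kill_uplo_poly j : ext {poly k} phi *m (slact M (up ('X : {poly k})) *m ext _ (Fc M j *m v)) = 0.
Proof.
case: (ltnP j (dK M)) => jK; last by rewrite Fc_ge // mul0mx ext0 !mulmx0.
pose C j := ext {poly k} phi *m (slact M (up ('X : {poly k})) *m ext _ (Fc M j *m v)).
have fsum (B : comAlgType k) (f : {lrmorphism {poly k} -> B}) (y : B) :
   ext B phi *m (slact M (up (f 'X)) *m (slact M (lo y) *m ext B v)) =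
   \sum_(j < dK M) y ^+ j *: map_mx f (C j).
  rewrite slact_lov !mulmx_sumr; apply: eq_bigr => i _.
  by rewrite -!scalemxAr /C !map_mxM !ext_map slact_nat ?det_up // map_up.
apply: (pk_coef (C := C) _ jK); rewrite -(fsum (pk {poly k}) (pkC {poly k}) (pkX {poly k})).
have dn0 : 1 + pkC {poly k} 'X * pkX {poly k} <> 0 :> R2 k.
  exact: R2_1xy_neq0.
pose h := linc (R2_expn0 dn0).
apply: (lr_mx_inj (f := h) (@R2_linc_inj _ _ (R2_expn0 dn0))).
have e : (1 + h (pkC {poly k} 'X) * h (pkX {poly k})) * linv (R2_expn0 dn0) = 1.
  by have := lincV (R2_expn0 dn0); rewrite -/h (rmorphD h) (rmorphM h) (rmorph1 h).
apply: (etrans (map_uplo h _ _)); apply: (etrans (kill_uplo e)).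
by symmetry; exact: (map_mx0 h).
Qed.
Lemma kill_lolo_poly j : ext {poly k} phi *m (slact M (lo ('X : {poly k})) *m ext _ (Fc M j *m v)) = 0.
Proof.
case: (ltnP j (dK M)) => jK; last by rewrite Fc_ge // mul0mx ext0 !mulmx0.
pose C j := ext {poly k} phi *m (slact M (lo ('X : {poly k})) *m ext _ (Fc M j *m v)).
have fsum (B : comAlgType k) (f : {lrmorphism {poly k} -> B}) (y : B) :
   0 = \sum_(j < dK M) y ^+ j *: map_mx f (C j).
  apply: (etrans (esym (kill_lo (f 'X + y)))); rewrite loD slactM ?det_lo // -mulmxA (slact_lov y v) !mulmx_sumr.
  apply: eq_bigr => i _.
  by rewrite -!scalemxAr /C !map_mxM !ext_map slact_nat ?det_lo // map_lo.
by apply: (pk_coef (C := C) _ jK); rewrite -(fsum (pk {poly k}) (pkC {poly k}) (pkX {poly k})).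
Qed.
End Kill.
End Swap.

(** * Extending homomorphisms along Weyl quotients: the trivial module *)

Lemma colM (A : comNzRingType) m n p (X : 'M[A]_(m, n)) (Y : 'M_(n, p)) j :
  col j (X *m Y) = X *m col j Y.
Proof. by rewrite !colE mulmxA. Qed.

Section LinAlg.
Variable k : fieldType.
Lemma inj_left_inv m n (i : 'M[k]_(m, n)) : injective (fun v : 'cV[k]_n => i *m v) ->
  exists i', i' *m i = 1%:M.
Proof.
move=> inj; have /row_freeP[B e] : row_free i^T.
  rewrite -kermx_eq0; apply/eqP/row_matrixP => j; rewrite row0.
  have : i *m (row j (kermx i^T))^T = 0.
    by apply: trmx_inj; rewrite trmx_mul trmxK -row_mul mulmx_ker row0 trmx0.
  move=> e; apply: trmx_inj; rewrite trmx0; apply: inj; by rewrite e mulmx0.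
by exists B^T; apply: trmx_inj; rewrite trmx_mul trmxK trmx1.
Qed.
Lemma eq_mx_cols m n (X Y : 'M[k]_(m, n)) : (forall v : 'cV_n, X *m v = Y *m v) -> X = Y.
Proof.
move=> h; apply/matrixP=> a b; have := h (delta_mx b 0); rewrite -!colE => /matrixP/(_ a 0).
by rewrite !mxE.
Qed.
End LinAlg.

Section Exact.
Variable k : fieldType.
Implicit Types M N : SL2mod k.

Lemma exact_split M' M Q i q : @short_exact k M' M Q i q ->
  exists2 i', i' *m i = 1%:M & forall n (Y : 'M_(_, n)), q *m Y = 0 -> Y = i *m (i' *m Y).
Proof.
move=> [hi hq inj sur ex]; have [i' ei] := inj_left_inv inj; exists i' => // n Y qY.
apply: eq_mx_cols => v; rewrite -!mulmxA.
have /ex[u ->] : q *m (Y *m v) = 0 by rewrite mulmxA qY mul0mx.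
by rewrite [i' *m _]mulmxA ei mul1mx.
Qed.
Lemma exact_comp0 M' M Q i q : @short_exact k M' M Q i q -> q *m i = 0.
Proof.
by move=> [hi hq inj sur ex]; apply: eq_mx_cols => v; rewrite mul0mx -mulmxA; apply/ex; exists v.
Qed.

(** The instance of the vanishing of Ext^1(Q, N) in which homomorphisms are extended
    along an inclusion with quotient Q. *)
Definition extends N Q := forall M' M i q, @short_exact k M' M Q i q ->
  forall f, @SL2hom k M' N f -> exists2 f', @SL2hom k M N f' & f' *m i = f.
Definition acyclic N := forall s, extends N (Weyl k s).

Lemma SL2hom1 M : @SL2hom k M M 1%:M.
Proof. by move=> A g _; rewrite ext1 mul1mx mulmx1. Qed.

Lemma weight_triv v : @weight_vector k (triv k) 0 v.
Proof. by move=> A t u tu; rewrite /= mul1mx scale1r. Qed.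

(** Ext^1(Delta(s), k) = 0.  A highest weight vector of the quotient lifts to a
    weight vector v.  The vectors F^(j) v with j <= s span a complement of the submodule.  The
    extension phi of f that vanishes on it is equivariant: the vectors by which v
    fails to be a highest weight vector, or F^(j) v to vanish for j > s, lie in the
    submodule and have nonzero weight, and f vanishes on such vectors. *)
Lemma acyclic_triv : acyclic (triv k).
Proof.
move=> s M' M i q ex f hf.
have [i' ei split] := exact_split ex; have qi := exact_comp0 ex.
case: ex => hi hq inj sur ex.
have [v wv qv] := weight_lift hq (@weight_hwv k s) (sur (hwv k s)).
(* the signs of weyl_F_hwv turn q B into the identity *)
pose B : 'M_(sldim M, s.+1) := \matrix_(a, l) ((-1) ^+ (s - l) * (Fc M (s - l) *m v) a 0).
have colB l : col l B = (-1) ^+ (s - l) *: (Fc M (s - l) *m v).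
  by apply/matrixP=> a b; rewrite !mxE [b]ord1.
have qB : q *m B = 1%:M.
  apply/matrixP=> a l; have -> : (q *m B) a l = (q *m col l B) a 0 by rewrite -colM [RHS]mxE.
  rewrite colB -scalemxAr mulmxA (Fc_hom _ hq) -mulmxA qv mxZE weyl_F_hwv mxE.
  have -> : (s - l == s - a)%N = (a == l).
    have E x y : (x < s.+1)%N -> (y < s.+1)%N -> (s - y == s - x)%N = (x == y) by lia.
    exact: E (ltn_ord a) (ltn_ord l).
  case: eqP => [->|_]; last by rewrite !mulr0.
  by rewrite mulr1 -expr2 sqrr_sign.
pose C := i' *m (1%:M - B *m q).
have iC : i *m C = 1%:M - B *m q.
  by rewrite -split // mulmxBr mulmx1 mulmxA qB mul1mx subrr.
have dec : 1%:M = i *m C + B *m q by rewrite iC subrK.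
pose phi : 'M_(1, sldim M) := f *m C.
have phii : phi *m i = f.
  by rewrite /phi -mulmxA /C -mulmxA mulmxBl mul1mx -mulmxA qi mulmx0 subr0 ei mulmx1.
have phiB : phi *m B = 0.
  by rewrite /phi /C -!mulmxA mulmxBl mul1mx -mulmxA qB mulmx1 subrr !mulmx0.
have cc r z : weight_vector r z -> r <> 0 -> q *m z = 0 -> phi *m z = 0.
  move=> wz r0 qz; have ez := split _ _ qz.
  rewrite ez mulmxA phii; apply: (weight_uniq (weight_hom hf _) (weight_triv _) r0).
  by apply: (weight_sub hi inj); rewrite -ez.
have gg (A : comAlgType k) (g : 'M[A]_2) n (Y : 'M_(_, n)) : \det g = 1 ->
    ext A phi *m (slact M g *m ext A (i *m Y)) = ext A (f *m Y).
  move=> dg; have e1 : ext A phi *m ext A i = ext A f by rewrite -phii; exact: esym (extM _ _ _).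
  by rewrite [ext A (i *m Y)]extM [slact M g *m _]mulmxA -hi // !mulmxA e1 hf // mul1mx extM.
have H1 j : phi *m (Fc M j *m v) = 0.
  have [js|sj] := leqP j s.
    have -> : Fc M j *m v = (-1) ^+ j *: (B *m delta_mx (inord (s - j)) 0).
      rewrite -colE colB scalerA inordK ?ltnS ?leq_subr // subKn //.
      by rewrite -expr2 sqrr_sign scale1r.
    by rewrite -scalemxAr mulmxA phiB mul0mx scaler0.
  apply: (cc _ _ (weight_F j wv)); first by lia.
  rewrite mulmxA (Fc_hom _ hq) -mulmxA qv; apply/matrixP=> a b; rewrite [b]ord1 weyl_F_hwv mxE.
  by rewrite gtn_eqF ?mulr0 // (leq_ltn_trans (leq_subr _ _)).
have H2 j : (0 < j)%N -> forall (A : comAlgType k) (g : 'M[A]_2), \det g = 1 ->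
  ext A phi *m (slact M g *m ext A (Ec M j *m v)) = 0.
  move=> j0 A g dg.
  have qE : q *m (Ec M j *m v) = 0.
    by have /upfixE h := @upfix_hwv k s; rewrite mulmxA (Ec_hom _ hq) -mulmxA qv h.
  rewrite (split _ _ qE) gg // -phii -mulmxA -(split _ _ qE) (cc _ _ (weight_E j wv)) ?ext0 //.
  by lia.
exists phi => //.
have fin (g : 'M[{poly k}]_2) : \det g = 1 ->
    (forall j, ext {poly k} phi *m (slact M g *m ext _ (Fc M j *m v)) = 0) -> homat (N := triv k) phi g.
  move=> dg h; rewrite /homat /= mul1mx -[LHS]mulmx1 -(ext1 _ (sldim M)) dec extD mulmxDr.
  rewrite -mulmxA gg // [ext _ (B *m q)]extM !mulmxA.
  have -> : ext {poly k} phi *m slact M g *m ext {poly k} B = 0.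
    apply/matrixP=> a l.
    have -> : (ext {poly k} phi *m slact M g *m ext {poly k} B) a l =
       (ext {poly k} phi *m slact M g *m ext {poly k} (col l B)) a 0.
      by rewrite /ext map_col -colM [RHS]mxE.
    by rewrite colB extZ -scalemxAr -mulmxA h scaler0 !mxE.
  by rewrite mul0mx addr0 /phi /C mulmxA.
apply: SL2hom_generic; apply: fin; rewrite ?det_up ?det_lo // => j.
  exact: (kill_uplo_poly wv H1 H2).
exact: (kill_lolo_poly H1).
Qed.
End Exact.

(** * Extending homomorphisms along Weyl quotients: tensor powers *)

Section Kernels.
Variable k : fieldType.
Implicit Types M N : SL2mod k.

Lemma factor_ker m n p (X : 'M[k]_(m, p)) (Y : 'M[k]_(n, p)) :
  (forall v : 'cV_p, Y *m v = 0 -> X *m v = 0) -> exists S, X = S *m Y.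
Proof.
move=> h; apply/submxP; rewrite submxE; apply/eqP/eq_mx_cols => v.
by rewrite mul0mx -mulmxA h // mulmxA mulmx_coker mul0mx.
Qed.

Section SubRep.
Variables (M : SL2mod k) (e : nat) (J : 'M[k]_(sldim M, e)) (L : 'M[k]_(e, sldim M)).
Definition stable_cols := L *m J = 1%:M /\
  forall (A : comAlgType k) (g : 'M[A]_2), \det g = 1 ->
    slact M g *m ext A J = ext A J *m (ext A L *m slact M g *m ext A J).
Hypothesis st : stable_cols.
Definition sub_act (A : comAlgType k) (g : 'M[A]_2) : 'M[A]_e := ext A L *m slact M g *m ext A J.
Lemma sub_act1 (A : comAlgType k) : sub_act (1%:M : 'M[A]_2) = 1%:M.
Proof. by rewrite /sub_act slact1 mulmx1 -extM st.1 ext1. Qed.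
Lemma sub_actM (A : comAlgType k) (g h : 'M[A]_2) : \det g = 1 -> \det h = 1 ->
  sub_act (g *m h) = sub_act g *m sub_act h.
Proof.
move=> dg dh; transitivity (ext A L *m slact M g *m (slact M h *m ext A J)).
  by rewrite /sub_act slactM // !mulmxA.
by rewrite st.2 // /sub_act !mulmxA.
Qed.
Lemma sub_act_nat (A B : comAlgType k) (f : {lrmorphism A -> B}) (g : 'M[A]_2) :
  \det g = 1 -> map_mx f (sub_act g) = sub_act (map_mx f g).
Proof. by move=> dg; rewrite /sub_act !map_mxM !ext_map slact_nat. Qed.
Definition subrep : SL2mod k := SL2Mod sub_act1 sub_actM sub_act_nat.
Lemma subrep_hom : @SL2hom k subrep M J.
Proof. by move=> A g dg; rewrite st.2. Qed.
End SubRep.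

Lemma hom_lift_inj M N P (j : 'M_(sldim P, sldim N)) j' (X : 'M_(sldim N, sldim M)) :
  @SL2hom k N P j -> j' *m j = 1%:M -> @SL2hom k M P (j *m X) -> @SL2hom k M N X.
Proof.
move=> hj e hX A g dg; have := congr1 (mulmx (ext A j')) (hX A g dg).
rewrite !extM !mulmxA -[ext A j' *m slact P g *m _]mulmxA -hj // !mulmxA -extM e ext1 !mul1mx //.
Qed.

Lemma hom_inv M N (X : 'M_(sldim N, sldim M)) Y :
  @SL2hom k M N X -> Y *m X = 1%:M -> X *m Y = 1%:M -> @SL2hom k N M Y.
Proof.
move=> hX YX XY; apply: (hom_lift_inj hX YX); rewrite XY; exact: SL2hom1.
Qed.

Section Ker.
Variables (M Q : SL2mod k) (p : 'M[k]_(sldim Q, sldim M)) (hp : @SL2hom k M Q p).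
(** A matrix whose columns form a basis of the kernel of p. *)
Definition kerJ := (row_base (kermx p^T))^T.
Lemma kerJ0 : p *m kerJ = 0.
Proof.
apply: trmx_inj; rewrite trmx_mul trmxK trmx0; apply/sub_kermxP.
by rewrite eq_row_base.
Qed.
Lemma kerJP v : p *m v = 0 -> exists w : 'cV_ _, v = kerJ *m w.
Proof.
move=> pv; have /submxP[D e] : (v^T <= row_base (kermx p^T))%MS.
  rewrite eq_row_base; apply/sub_kermxP; by rewrite -trmx_mul pv trmx0.
by exists D^T; apply: trmx_inj; rewrite trmx_mul !trmxK.
Qed.
Lemma kerL_ex : exists L, L *m kerJ = 1%:M.
Proof.
have /row_freeP[B e] := row_base_free (kermx p^T).
by exists B^T; apply: trmx_inj; rewrite trmx_mul !trmxK trmx1.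
Qed.
Lemma ker_stable L : L *m kerJ = 1%:M -> stable_cols kerJ L.
Proof.
move=> e; split=> // A g dg.
have [S eS] : exists S, 1%:M - kerJ *m L = S *m p.
  apply: factor_ker => v /kerJP[w ->].
  by rewrite mulmxBl mul1mx -mulmxA [L *m _]mulmxA e mul1mx subrr.
have z : ext A p *m (slact M g *m ext A kerJ) = 0.
  by rewrite mulmxA hp // -mulmxA -extM kerJ0 ext0 mulmx0.
have := congr1 (fun Z => ext A Z *m (slact M g *m ext A kerJ)) eS.
rewrite extM -mulmxA z mulmx0 extB ext1 extM mulmxBl mul1mx => /eqP.
by rewrite subr_eq0 -!mulmxA => /eqP.
Qed.
End Ker.

(** The extension is made in two steps, first to the preimage of the submodule Q' of
    Q and then to the whole module. *)
Lemma extends_comp N Q' Q Q'' j pi : @short_exact k Q' Q Q'' j pi ->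
  extends N Q' -> extends N Q'' -> extends N Q.
Proof.
move=> exQ e1 e2 M' M i q ex f hf.
have [j' ej jspl] := exact_split exQ; have pij := exact_comp0 exQ.
have [i' ei ispl] := exact_split ex; have qi := exact_comp0 ex.
case: exQ => hj hpi _ surpi exj; case: ex => hi hq inji surq exi.
pose p := pi *m q; have hp : SL2hom p by apply: SL2hom_comp.
have [L eL] := kerL_ex p; have st := ker_stable hp eL.
set J := kerJ p in eL st *; pose K := subrep st.
have hJ : @SL2hom k K M J := subrep_hom st.
have Ji : J *m (L *m i) = i.
  apply: eq_mx_cols => v; have [w e] : exists w, i *m v = J *m w.
    by apply: kerJP; rewrite /p -!mulmxA [q *m _]mulmxA qi mul0mx mulmx0.
  by rewrite -!mulmxA e [L *m _]mulmxA eL mul1mx.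
have hi1 : @SL2hom k M' K (L *m i) by apply: (hom_lift_inj hJ eL); rewrite Ji.
have jq1 : j *m (j' *m (q *m J)) = q *m J.
  by rewrite -jspl // mulmxA; apply: kerJ0.
have hq1 : @SL2hom k K Q' (j' *m (q *m J)).
  by apply: (hom_lift_inj hj ej); rewrite jq1; apply: SL2hom_comp.
have ex1 : @short_exact k M' K Q' (L *m i) (j' *m (q *m J)).
  split=> //.
  - by move=> u v /= /(congr1 (mulmx J)); rewrite (mulmxA J (L *m i) u) (mulmxA J (L *m i) v) Ji; apply: inji.
  - move=> w; have [m em] := surq (j *m w).
    have [l el] : exists l, m = J *m l.
      by apply: kerJP; rewrite /p -mulmxA -em mulmxA pij mul0mx.
    by exists l; rewrite -!mulmxA -el -em mulmxA ej mul1mx.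
  move=> v; split=> [h|[u ->]].
    have : q *m (J *m v) = 0 by rewrite mulmxA -jq1 -mulmxA h mulmx0.
    move/exi => [u eu]; exists u.
    by rewrite -mulmxA -eu mulmxA eL mul1mx.
  by rewrite -mulmxA -[q *m J *m _]mulmxA [J *m _]mulmxA Ji [q *m _]mulmxA qi mul0mx mulmx0.
have [f1 hf1 ef1] := e1 _ _ _ _ ex1 f hf.
have ex2 : @short_exact k K M Q'' J p.
  split=> //.
  - by move=> u v /= /(congr1 (mulmx L)); rewrite !mulmxA eL !mul1mx.
  - move=> w; have [a ea] := surpi w; have [b eb] := surq a.
    by exists b; rewrite /p -mulmxA -eb.
  by move=> v; split=> [/kerJP|[u ->]] //; rewrite mulmxA kerJ0 mul0mx.
have [f2 hf2 ef2] := e2 _ _ _ _ ex2 f1 hf1.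
by exists f2 => //; rewrite -Ji mulmxA ef2.
Qed.

Lemma extends_iso N Q Q' th th' : @SL2hom k Q Q' th -> th' *m th = 1%:M -> th *m th' = 1%:M ->
  extends N Q' -> extends N Q.
Proof.
move=> h e1 e2 ext' M' M i q ex f hf.
apply: (ext' _ _ i (th *m q)) hf; case: ex => hi hq inji sur exi; split=> //.
- exact: SL2hom_comp.
- by move=> w; have [v ev] := sur (th' *m w); exists v; rewrite -mulmxA -ev mulmxA e2 mul1mx.
move=> v; rewrite -exi; split=> [|e]; last by rewrite -mulmxA e mulmx0.
by move/(congr1 (mulmx th')); rewrite !mulmxA e1 mul1mx mulmx0.
Qed.

Lemma VM_exact M' M Q i q : @short_exact k M' M Q i q ->
  @short_exact k (VM M') (VM M) (VM Q) (dg2 i) (dg2 q).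
Proof.
case=> hi hq inj sur ex; split; try exact: VM_hom.
- move=> u v; rewrite -[u]vsubmxK -[v]vsubmxK /dg2 !mul_block_col !mul0mx !addr0 !add0r.
  by move/eq_col_mx => [/inj -> /inj ->].
- move=> w; have [a ea] := sur (usubmx w); have [b eb] := sur (dsubmx w).
  by exists (col_mx a b); rewrite /dg2 mul_block_col !mul0mx addr0 add0r -ea -eb vsubmxK.
move=> v; rewrite -[v]vsubmxK /dg2 mul_block_col !mul0mx addr0 add0r; split.
  rewrite -[0]vsubmxK => /eq_col_mx[]; rewrite !linear0 => /ex[a ea] /ex[b eb].
  by exists (col_mx a b); rewrite mul_block_col !mul0mx addr0 add0r -ea -eb.
move=> [u]; rewrite -[u]vsubmxK mul_block_col !mul0mx addr0 add0r => /eq_col_mx[-> ->].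
rewrite !mulmxA (_ : q *m i = 0) ?mul0mx ?col_mx0 //; apply: eq_mx_cols => x.
by rewrite mul0mx -mulmxA; apply/ex; exists x.
Qed.

(** The self-adjointness of tensoring with V, applied to an extension problem. *)
Lemma extends_VM N Q : extends N (VM Q) -> extends (VM N) Q.
Proof.
move=> e M' M i q ex f hf.
rewrite -[f]vsubmxK in hf *; set f0 := usubmx f in hf *; set f1 := dsubmx f in hf *.
have [h hh] := e _ _ _ _ (VM_exact ex) _ (adj_to hf).
rewrite -[h]hsubmxK /dg2 mul_row_block !mulmx0 addr0 add0r => /eq_row_mx[e0 e1].
rewrite -[h]hsubmxK in hh; exists (col_mx (- rsubmx h) (lsubmx h)); first exact: adj_of.
by rewrite mul_col_mx mulNmx e0 e1 opprK.
Qed.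

Lemma idl_mulv m (v : 'cV[k]_m.+2) i : (idl k m *m v) i 0 = v (widen_ord (leqnSn _) i) 0.
Proof.
rewrite mxE (bigD1 (widen_ord (leqnSn _) i)) //= big1 ?addr0 => [|l nl].
  by rewrite !mxE eqxx mul1r.
rewrite !mxE (_ : _ == _ = false) ?mul0r //.
by apply: contraNF nl => /eqP e; apply/eqP/val_inj; rewrite /= e.
Qed.
Lemma shl_mulv m (v : 'cV[k]_m.+2) i : (shl k m *m v) i 0 = v (lift ord0 i) 0.
Proof.
rewrite mxE (bigD1 (lift ord0 i)) //= big1 ?addr0 => [|l nl].
  by rewrite !mxE eqxx mul1r.
rewrite !mxE (_ : _ == _ = false) ?mul0r //.
by apply: contraNF nl => /eqP e; apply/eqP/val_inj; rewrite /= e.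
Qed.

Lemma weyl_in_inj m : injective (fun v : 'cV[k]_(m.+2) => weyl_in k m *m v).
Proof.
move=> u v; rewrite /weyl_in !mul_col_mx !mulNmx => /eq_col_mx[/matrixP h1 /oppr_inj/matrixP h2].
apply/matrixP=> i j; rewrite [j]ord1; case: (unliftP ord0 i) => [l ->|->].
  by rewrite -!shl_mulv h1.
have := h2 ord0 0; rewrite !idl_mulv.
by rewrite (_ : widen_ord _ _ = ord0) //; apply: val_inj.
Qed.

(** The Weyl filtration of V (x) Delta(m + 1): a Clebsch-Gordan rule that holds in
    every characteristic. *)
Lemma weyl_exact m : @short_exact k (Weyl k m.+2) (VM (Weyl k m.+1)) (Weyl k m) (weyl_in k m.+1) (weyl_out k m).
Proof.
split; [exact: weyl_in_hom | exact: weyl_out_hom | exact: weyl_in_inj | |].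
  move=> w; exists (col_mx (\col_i w (inord i) 0) 0).
  rewrite mul_row_col mulmx0 addr0; apply/matrixP=> i j; rewrite [j]ord1 idl_mulv mxE; congr (w _ _).
  by apply: val_inj; rewrite /= inordK //; apply: ltn_ord.
move=> v; rewrite -[v]vsubmxK mul_row_col; set u0 := usubmx v; set u1 := dsubmx v; split.
  move=> /matrixP h.
  exists (\col_(i < m.+3) if unlift ord0 i is Some l then u0 l 0 else - u1 ord0 0).
  rewrite mul_col_mx mulNmx; congr col_mx; apply/matrixP=> i j; rewrite [j]ord1.
    by rewrite shl_mulv mxE liftK.
  rewrite [RHS]mxE idl_mulv mxE; case: (unliftP ord0 i) => [l ->|->].
    have := h l 0; rewrite mxDE idl_mulv shl_mulv [RHS]mxE => /eqP; rewrite addrC addr_eq0 => /eqP ->.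
    rewrite (_ : widen_ord _ _ = lift ord0 (widen_ord (leqnSn _) l)) ?liftK //.
    exact: val_inj.
  rewrite (_ : widen_ord _ _ = ord0) ?unlift_none ?opprK //; exact: val_inj.
move=> [w]; rewrite mul_col_mx mulNmx => /eq_col_mx[-> ->].
apply/matrixP=> i j; rewrite [j]ord1 mxDE !(idl_mulv, shl_mulv, mxNE) [RHS]mxE.
by apply/eqP; rewrite subr_eq0; apply/eqP; congr (w _ _); apply: val_inj.
Qed.

(** By adjunction the problem for V (x) N and Delta(s) becomes one for N and
    V (x) Delta(s), which is filtered by Delta(s + 1) and Delta(s - 1). *)
Lemma acyclic_VM N : acyclic N -> acyclic (VM N).
Proof.
move=> aN [|m]; apply: extends_VM; last exact: (extends_comp (weyl_exact m)).
have [Y e] := inj_left_inv (@weyl_in_inj 0); have e' := mulmx1C e.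
exact: (extends_iso (hom_inv (@weyl_in_hom k 0) e e') e' e (aN 1%N)).
Qed.

Lemma acyclic_W n : acyclic (W k n).
Proof. by elim: n => [|n IH]; [exact: acyclic_triv | exact: acyclic_VM]. Qed.
End Kernels.

(** * Highest weight vectors of tensor powers and cups *)

Section Negative.
Variables (k : fieldType) (M : SL2mod k).

(** Let K be maximal with F^(K) v <> 0.  For a highest weight vector of weight -j,
    moving the upper unipotent element to the right produces denominators
    (1 + x y)^(j + K), and only the term of index K survives modulo 1 + x y once
    they are cleared. *)
Lemma neg_identity (A : comAlgType k) (x y d' : A) j K (v : 'cV[k]_(sldim M)) :
  (1 + x * y) * d' = 1 -> HW (- j%:Z) v -> (K < dK M)%N ->
  (forall i, (K < i)%N -> Fc M i *m v = 0) ->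
  (1 + x * y) ^+ (j + K) *: (slact M (up x) *m (slact M (lo y) *m ext A v)) =
  y ^+ K *: ext A (Fc M K *m v) +
  (1 + x * y) *: \sum_(i < K) (y ^+ i * (1 + x * y) ^+ (K - i).-1) *: ext A (Fc M i *m v).
Proof.
move=> e [wv uv] KK F0; set D := 1 + x * y.
rewrite mulmxA (slact_swap _ e) -!mulmxA upfix_at // wv // -/D.
rewrite (tcE e (_ : _ = 0%N%:Z - j%:Z)); last by lia.
rewrite expr0 mul1r -scalemxAr slact_lov scalerA scaler_sumr.
rewrite -(sum_trunc (K := K.+1) (F := fun i => D ^+ (j + K) * d' ^+ j *: ((y * d') ^+ i *: ext A (Fc M i *m v)))) //; last first.
  by move=> i Ki; rewrite F0 // ext0 !scaler0.
have key i : (i <= K)%N -> D ^+ (j + K) * d' ^+ j * (y * d') ^+ i = y ^+ i * D ^+ (K - i).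
  move=> iK; have -> : (j + K = j + (i + (K - i)))%N by rewrite subnKC.
  transitivity (y ^+ i * D ^+ (K - i) * (D * d') ^+ j * (D * d') ^+ i).
    by rewrite !exprD !exprMn; ring.
  by rewrite e !expr1n !mulr1.
rewrite big_ord_recr /= scalerA key // subnn expr0 mulr1 addrC; congr (_ + _).
rewrite scaler_sumr; apply: eq_bigr => i _; rewrite !scalerA key 1?ltnW //; congr (_ *: _).
have -> : (K - i = (K - i).-1.+1)%N by rewrite prednK // subn_gt0.
by rewrite exprS mulrCA.
Qed.

(** The identity [neg_identity] descends along an injective morphism, here the
    localisation at 1 + x y. *)
Lemma neg_map (A B : comAlgType k) (h : {lrmorphism A -> B}) (x y : A) (j : nat -> nat) J K (v : 'cV[k]_(sldim M)) :
  injective h ->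
  (1 + h x * h y) ^+ J *: (slact M (up (h x)) *m (slact M (lo (h y)) *m ext B v)) =
  h y ^+ K *: ext B (Fc M K *m v) +
  (1 + h x * h y) *: \sum_(i < K) (h y ^+ i * (1 + h x * h y) ^+ j i) *: ext B (Fc M i *m v) ->
  (1 + x * y) ^+ J *: (slact M (up x) *m (slact M (lo y) *m ext A v)) =
  y ^+ K *: ext A (Fc M K *m v) +
  (1 + x * y) *: \sum_(i < K) (y ^+ i * (1 + x * y) ^+ j i) *: ext A (Fc M i *m v).
Proof.
move=> hi e; apply: (lr_mx_inj hi).
have hD : h (1 + x * y) = 1 + h x * h y by rewrite rmorphD rmorphM rmorph1.
rewrite map_mxD !map_mxZ !map_mxM !slact_nat ?det_up ?det_lo // map_up map_lo !ext_map.
rewrite !rmorphXn /= hD e; congr (_ + _ *: _).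
rewrite raddf_sum; apply: eq_bigr => i _; rewrite /= map_mxZ ext_map rmorphM !rmorphXn /= hD.
by [].
Qed.

Lemma neg_div (A : comAlgType k) (D y : A) J K n (P S : 'cV[A]_n) (w : 'cV[k]_n) :
  D ^+ J.+1 *: P = y ^+ K *: ext A w + D *: S ->
  forall a, exists z, y ^+ K * (w a 0)%:A = D * z.
Proof.
move=> e a; exists (D ^+ J * P a 0 - S a 0).
have := congr1 (fun Z : 'cV_n => Z a 0) e; rewrite mxDE !mxZE [ext _ _ _ _]mxE exprS => /eqP.
by rewrite -subr_eq => /eqP /= <-; rewrite mulrBr mulrA.
Qed.

(** There are no highest weight vectors of negative weight: by [neg_identity],
    1 + x y would divide y^K F^(K) v in k[x, y]. *)
Lemma HW_neg r v : @HW k M r v -> r < 0 -> v = 0.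
Proof.
move=> hv r0; have [j er j0] : exists2 j : nat, r = - j%:Z & (0 < j)%N by exists `|r|%N; lia.
apply/eqP; apply/negPn/negP => vn0.
have ex : exists i, Fc M i *m v != 0 by exists 0%N; rewrite Fc0 mul1mx.
have bd i : Fc M i *m v != 0 -> (i <= dK M)%N.
  by apply: contraR; rewrite -ltnNge => /ltnW h; rewrite Fc_ge // mul0mx.
case: (ex_maxnP ex bd) => K FK Kmax.
have KK : (K < dK M)%N.
  by rewrite ltnNge; apply: contra FK => h; rewrite Fc_ge // mul0mx.
have F0 i : (K < i)%N -> Fc M i *m v = 0.
  by rewrite ltnNge => h; apply/eqP; apply: contraR h; apply: Kmax.
case/eqP: FK; apply/matrixP=> a b; rewrite [b]ord1 [RHS]mxE.
rewrite er in hv.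
have en := lincV (R2_expn0 (@R2_1xy_neq0 k)).
pose h := linc (R2_expn0 (@R2_1xy_neq0 k)).
have e : (1 + h (pkC {poly k} 'X) * h (pkX {poly k})) * linv (R2_expn0 (@R2_1xy_neq0 k)) = 1.
  by have := en; rewrite -/h (rmorphD h) (rmorphM h) (rmorph1 h).
have E0 := neg_identity e hv KK F0.
have E := @neg_map (R2 k) _ h (pkC {poly k} 'X) (pkX {poly k}) (fun i => (K - i).-1) (j + K) K v
  (@R2_linc_inj _ _ (R2_expn0 (@R2_1xy_neq0 k))) E0.
have jK : (j + K = (j + K).-1.+1)%N by lia.
rewrite jK in E; have [z ez] := neg_div E a.
exact: R2_div ez.
Qed.
End Negative.

Section Cups.
Variable k : fieldType.
Notation W := (W k).
Notation d n := (sldim (W n)).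

(** The map from W n to W (n + 2) that inserts the invariant of two copies of V at the
    tensor positions i and i + 1. *)
Fixpoint cup (i n : nat) {struct i} : 'M[k]_(d n.+2, d n) :=
  match i with
  | 0 => col_mx (col_mx 0 1%:M) (col_mx (- 1%:M) 0)
  | i'.+1 => match n return 'M[k]_(d n.+2, d n) with
            | 0 => 0 | n'.+1 => dg2 (cup i' n') end
  end.

Lemma cup0_hom (M : SL2mod k) :
  @SL2hom k M (VM (VM M)) (col_mx (col_mx 0 1%:M) (col_mx (- 1%:M) 0)).
Proof.
move=> A g dg; have dt : g 0 0 * g 1 1 - g 0 1 * g 1 0 = 1 by rewrite -det2.
rewrite !(ext_col, ext0, extN, ext1).
rewrite [LHS](_ : _ = col_mx (col_mx 0 (slact M g)) (col_mx (- slact M g) 0)); last first.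
  by rewrite !mul_col_mx mul0mx mul1mx mulNmx mul1mx.
rewrite /= /vm_act /= /vm_act.
rewrite mul_block_col -!scalemxAl !mul_block_col !mulmx0 !mulmx1 !mulmxN !mulmx1 !addr0 !add0r.
rewrite !scale_col_mx !add_col_mx !scalerN !scalerA -!scalerBl.
rewrite dt [g 0 1 * g 0 0]mulrC subrr [g 1 1 * g 1 0]mulrC subrr !scale0r scale1r.
congr (col_mx (col_mx _ _) (col_mx _ _)).
by rewrite -scaleN1r -dt; congr (_ *: _); ring.
Qed.

Lemma cup_hom i n : (i <= n)%N -> @SL2hom k (W n) (W n.+2) (cup i n).
Proof.
by elim: i n => [|i IH] [|n] //= le; [exact: cup0_hom | exact: cup0_hom | apply: VM_hom; apply: IH].
Qed.

Lemma dg2M m n p (X : 'M[k]_(m, n)) (Y : 'M_(n, p)) : dg2 X *m dg2 Y = dg2 (X *m Y).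
Proof. by rewrite /dg2 mulmx_block !mul0mx !mulmx0 !addr0 add0r. Qed.
Lemma dg2T m n (X : 'M[k]_(m, n)) : (dg2 X)^T = dg2 X^T.
Proof. by rewrite /dg2 tr_block_mx !trmx0. Qed.
Lemma dg2Z c m n (X : 'M[k]_(m, n)) : dg2 (c *: X) = c *: dg2 X.
Proof. by rewrite /dg2 scale_block_mx !scaler0. Qed.
Lemma dg2_1 n : dg2 (1%:M : 'M[k]_n) = 1%:M.
Proof. by rewrite /dg2 -scalar_mx_block. Qed.
Lemma dg2_col m n p (X : 'M[k]_(m, n)) (u v : 'M_(n, p)) : dg2 X *m col_mx u v = col_mx (X *m u) (X *m v).
Proof. by rewrite /dg2 mul_block_col !mul0mx addr0 add0r. Qed.

Lemma cap_cup0 q : (dg2 (col_mx (col_mx (0 : 'M[k]_q) 1%:M) (col_mx (- 1%:M) (0 : 'M[k]_q))))^T *m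
  col_mx (col_mx (0 : 'M[k]_(q + q)) 1%:M) (col_mx (- 1%:M) (0 : 'M[k]_(q + q))) = - 1%:M.
Proof.
rewrite dg2T dg2_col !tr_col_mx !trmx0 linearN /= trmx1.
rewrite !mul_row_col !mulmx0 !mulmx1 mulmxN mulmx1 addr0 add0r opp_row_mx oppr0.
by rewrite -[RHS]scaleN1r scalar_mx_block scale_block_mx !scaler0 scaleN1r.
Qed.

(** The zigzag relation; the sign comes from the antisymmetry of the invariant. *)
Lemma cap_cup_adj i n : (i < n)%N -> (cup i.+1 n)^T *m cup i n = - 1%:M.
Proof.
elim: i n => [|i IH] [|n] // le.
  exact: (cap_cup0 (d n)).
rewrite [cup i.+2 n.+1]/= [cup i.+1 n.+1]/= dg2T dg2M IH // -[RHS]scaleN1r -dg2_1 -dg2Z scaleN1r.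
by [].
Qed.

(** A generator of the Temperley-Lieb algebra: a cap followed by a cup. *)
Definition tg N (i : nat) : 'M[k]_(d N) :=
  match N return 'M[k]_(d N) with n.+2 => cup i n *m (cup i n)^T | _ => 0 end.
Lemma tg_dg2 N i : (i.+1 < N)%N -> dg2 (tg N i) = tg N.+1 i.+1.
Proof. by case: N => [|[|n]] // _; rewrite /= dg2T dg2M. Qed.
Lemma tgT N i : (tg N i)^T = tg N i.
Proof. by case: N => [|[|n]] //=; rewrite ?trmx0 // trmx_mul trmxK. Qed.

(** Products of generators up to scalars.  Linear combinations are added where they
    are needed, through subspaces. *)
Inductive alg N : 'M[k]_(d N) -> Prop :=
| alg_one : alg 1%:M
| alg_gen i of (i.+1 < N)%N : alg (tg N i)
| alg_mul a b of alg a & alg b : alg (a *m b)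
| alg_scale c a of alg a : alg (c *: a).

Lemma algT N (a : 'M[k]_(d N)) : alg a -> alg a^T.
Proof.
elim=> [|i le|{}a b _ ha _ hb|c {}a _ ha].
- by rewrite trmx1; exact: alg_one.
- by rewrite tgT; exact: alg_gen.
- by rewrite trmx_mul; exact: alg_mul.
by rewrite linearZ; exact: alg_scale.
Qed.
Lemma alg_dg2 N (a : 'M[k]_(d N)) : alg a -> @alg N.+1 (dg2 a).
Proof.
elim=> [|i le|{}a b _ ha _ hb|c {}a _ ha].
- by rewrite dg2_1; exact: (@alg_one N.+1).
- by rewrite tg_dg2 //; apply: (@alg_gen N.+1).
- by rewrite -dg2M; exact: (@alg_mul N.+1).
by rewrite dg2Z; exact: (@alg_scale N.+1).
Qed.
Lemma cup0_comm n (a : 'M[k]_(d n)) : cup 0 n *m a = dg2 (dg2 a) *m cup 0 n.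
Proof.
by rewrite /= dg2_col !dg2_col !mul_col_mx mulNmx mulmxN !mul0mx !mulmx0 !mul1mx !mulmx1.
Qed.
(** All cups are obtained from the first one by acting with the algebra, by the
    zigzag relation. *)
Lemma cup_reach i n : (i <= n)%N -> exists2 a, @alg n.+2 a & cup i n = a *m cup 0 n.
Proof.
elim: i => [|i IH] le; first by exists 1%:M; [exact: (@alg_one n.+2) | rewrite mul1mx].
have [a ha ea] := IH (ltnW le).
exists (- (1) *: (tg n.+2 i.+1 *m a)).
  by apply: (@alg_scale n.+2); apply: (@alg_mul n.+2) => //; apply: (@alg_gen n.+2).
rewrite -scalemxAl -mulmxA -ea [tg _ _]/(cup i.+1 n *m (cup i.+1 n)^T) -mulmxA cap_cup_adj //.
by rewrite mulmxN mulmx1 scaleN1r opprK.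
Qed.

(** Products of cups: half-diagrams with m through strands. *)
Inductive cupc m : forall n, 'M[k]_(d n, d m) -> Prop :=
| cupc_id : @cupc m m 1%:M
| cupc_cup i n (x : 'M[k]_(d n, d m)) of (i <= n)%N & cupc x : @cupc m n.+2 (cup i n *m x).

Lemma cupc_le m n (x : 'M_(d n, d m)) : cupc x -> (m <= n)%N.
Proof. by elim=> // i n' x' _ _ le; apply: leq_trans le _; apply: leqW. Qed.

Definition is1 m n (x : 'M[k]_(m, n)) := forall a b, x a b = (a == b :> nat)%:R.
Lemma is1_eq n (x : 'M[k]_n) : is1 x -> x = 1%:M.
Proof. by move=> h; apply/matrixP=> a b; rewrite h mxE. Qed.
Lemma cupc_inv m n (x : 'M_(d n, d m)) : cupc x ->
  (n = m /\ is1 x) \/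
  match n return 'M_(d n, d m) -> Prop with
  | n'.+2 => fun x => exists i y, [/\ (i <= n')%N, @cupc m n' y & x = cup i n' *m y]
  | _ => fun _ => False
  end x.
Proof.
case=> [|i n' y le hy]; first by left; split=> // a b; rewrite mxE.
by right; exists i, y.
Qed.

(** The diagram obtained from two half-diagrams with the same number of through
    strands is a product of generators.  Peel off one cup on either side, move both
    to the first position, and let the rest of the diagram pass through. *)
Lemma cupc_alg m n (x y : 'M_(d n, d m)) : cupc x -> cupc y -> alg (x *m y^T).
Proof.
move=> hx; elim: hx y => {n x} [|i n' x' le hx' IH] y hy.
  case: (cupc_inv hy) => [[_ /is1_eq ->]|]; first by rewrite trmx1 mulmx1; exact: alg_one.
  case: m y hy => [|[|m]] y // hy [i [z [_ /cupc_le h _]]].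
  by move: h; rewrite ltnNge leqnSn.
case: (cupc_inv hy) => [[e _]|[j [z [lj hz ->]]]].
  by have h := cupc_le hx'; rewrite -e ltnNge leqnSn in h.
have hw := IH _ hz; rewrite trmx_mul -mulmxA [x' *m _]mulmxA; move: (x' *m z^T) hw => w hw.
have [a ha ->] := cup_reach le; have [b hb ->] := cup_reach lj.
rewrite trmx_mul !mulmxA -[a *m _ *m _]mulmxA cup0_comm !mulmxA.
apply: (@alg_mul n'.+2); last exact: algT.
rewrite -mulmxA; apply: (@alg_mul n'.+2); last exact: (@alg_gen n'.+2 0).
apply: (@alg_mul n'.+2) => //; apply: (@alg_dg2 n'.+1); exact: alg_dg2.
Qed.

Lemma cupc_hom m n (x : 'M_(d n, d m)) : cupc x -> @SL2hom k (W m) (W n) x.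
Proof.
elim=> [|i n' x' le _ IH]; first exact: SL2hom1.
exact: SL2hom_comp (cup_hom le) IH.
Qed.
Lemma cupc_dg2 m n (x : 'M_(d n, d m)) : cupc x -> @cupc m.+1 n.+1 (dg2 x).
Proof.
elim=> [|i n' x' le _ IH]; first by rewrite dg2_1; exact: (@cupc_id m.+1).
by rewrite -dg2M; apply: (@cupc_cup m.+1 i.+1 n'.+1).
Qed.
(** Bending a through strand of a half-diagram into a cup that starts at a new first
    position. *)
Lemma cupc_through m n (x : 'M_(d n, d m.+1)) : cupc x -> @cupc m n.+1 (dg2 x *m cup 0 m).
Proof.
move=> hx; elim: hx => [|i n' x' le _ IH].
  by rewrite dg2_1 mul1mx -[cup 0 m]mulmx1; apply: cupc_cup; last exact: cupc_id.
by rewrite -dg2M -mulmxA; apply: (@cupc_cup m i.+1 n'.+1).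
Qed.

(** The vector e_0 (x) ... (x) e_0, a highest weight vector of weight m. *)
Fixpoint topvec m : 'cV[k]_(d m) := if m is m'.+1 then col_mx (topvec m') 0 else 1%:M.

Lemma HW_col0 M r (v : 'cV[k]_(sldim M)) : @HW k (VM M) r (col_mx v 0) <-> HW (r - 1) v.
Proof.
split=> [[/weight_VM[w _] u]|[w u]]; split=> //.
- move: u; rewrite /upfix /= /vm_act ext_col ext0 mul_block_col !mulmx0 !addr0 !mxE /= scale1r.
  by move/eq_col_mx=> [].
- by apply/weight_VM; split=> //; apply: weight0.
rewrite /upfix /= /vm_act ext_col ext0 mul_block_col !mulmx0 !addr0 !mxE /= scale1r.
by rewrite u scale0r mul0mx.
Qed.
Lemma HW_col1 M r (v0 v1 : 'cV[k]_(sldim M)) : @HW k (VM M) r (col_mx v0 v1) -> HW (r + 1) v1.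
Proof.
case=> [/weight_VM[_ w] u]; split=> //.
move: u; rewrite /upfix /= /vm_act ext_col mul_block_col !mxE /= scale0r mul0mx add0r scale1r.
by move/eq_col_mx=> [].
Qed.

Lemma HW_topvec m : @HW k (W m) m (topvec m).
Proof.
elim: m => [|m IH]; first by split; [exact: weight_triv | rewrite /upfix /= mul1mx].
by rewrite /=; apply/HW_col0; rewrite (_ : m.+1%:Z - 1 = m) //; lia.
Qed.

(** Membership in the span of the vectors given by half-diagrams, phrased through all
    subspaces so as to serve as an induction principle. *)
Definition spanc n m (v : 'cV[k]_(d n)) := forall Q : 'cV[k]_(d n) -> Prop, subspace_pred Q ->
  (forall x, @cupc m n x -> Q (x *m topvec m)) -> Q v.

Lemma spanc_subspace n m : subspace_pred (@spanc n m).
Proof.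
split=> [Q [] //|c u v hu hv' Q hQ hx].
by apply: hQ.2; [apply: hu | apply: hv'].
Qed.

(** Induction on n.  The e_1 component of a highest weight vector is one of weight
    m + 1, a combination of half-diagrams by induction; bending the first through
    strand lifts each of them to W (n + 1).  The difference has only an e_0
    component, a highest weight vector of weight m - 1. *)
Lemma HW_span n (m : nat) v : @HW k (W n) m v -> spanc m v.
Proof.
elim: n m v => [|n IH] m v hw.
  move=> Q hQ hx; case: m hw hx => [|m] [w _] hx; last first.
    by rewrite (weight_uniq w (weight_triv v)) //; apply: hQ.1.
  have -> : v = v 0 0 *: (1%:M *m topvec 0) + 0.
    by apply/matrixP=> a b; rewrite !mxE big_ord_recl big_ord0 !mxE !ord1 /= !addr0 !mulr1.
  by apply: hQ.2; [apply: hx; exact: cupc_id | exact: hQ.1].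
rewrite -[v]vsubmxK in hw *; set v0 := usubmx v in hw *; set v1 := dsubmx v in hw *.
have [v' [hv' sv' ev']] : exists v' : 'cV_(d n.+1),
    [/\ @HW k (W n.+1) m v', spanc m v' & dsubmx (v' : 'cV_(d n + d n)) = v1].
  have w1 : @HW k (W n) m.+1 v1 by have := HW_col1 hw; rewrite (_ : m%:Z + 1 = m.+1) //; lia.
  apply: (IH _ _ w1 (fun z => exists v' : 'cV_(d n.+1),
    [/\ @HW k (W n.+1) m v', spanc m v' & dsubmx (v' : 'cV_(d n + d n)) = z])).
    split; first by exists 0; split; [exact: (HW_subspace _ _).1 | exact: (spanc_subspace _ _).1 | exact: linear0].
    move=> c x y [x' [hx sx ex]] [y' [hy sy ey]]; exists (c *: x' + y'); split.
    - exact: (HW_subspace _ _).2.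
    - exact: (spanc_subspace _ _).2.
    by rewrite linearP /= ex ey.
  move=> x hx; exists (- (1) *: (dg2 x *m cup 0 m *m topvec m)); split.
  - rewrite -[X in HW _ X]addr0; apply: (HW_subspace _ _).2; last exact: (HW_subspace _ _).1.
    exact: (HW_hom (cupc_hom (cupc_through hx)) (HW_topvec m)).
  - rewrite -[X in spanc _ X]addr0; apply: (spanc_subspace _ _).2; last exact: (spanc_subspace _ _).1.
    by move=> Q _ h; apply: h; apply: cupc_through.
  have e0 : cup 0 m *m topvec m = col_mx (col_mx 0 (topvec m)) (col_mx (- topvec m) 0).
    by rewrite /= !mul_col_mx mul0mx mul1mx mulNmx mul1mx.
  rewrite linearZ -mulmxA e0 dg2_col /= col_mxKd scaleN1r -mulmxN; congr (x *m _).
  by rewrite opp_col_mx opprK oppr0.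
have [z0 [ez hz]] : exists z0, col_mx v0 v1 = v' + col_mx z0 0 /\ @HW k (W n.+1) m (col_mx z0 0).
  exists (v0 - usubmx (v' : 'cV_(d n + d n))).
  have e : col_mx v0 v1 = v' + col_mx (v0 - usubmx (v' : 'cV_(d n + d n))) 0.
    by rewrite -[v' in RHS]vsubmxK add_col_mx addr0 col_mxKu ev' addrC subrK.
  split=> //; have -> : col_mx (v0 - usubmx (v' : 'cV_(d n + d n))) 0 = -(1) *: v' + col_mx v0 v1.
    by rewrite e scaleN1r addKr.
  exact: (HW_subspace _ _).2.
rewrite ez -[v']scale1r; apply: (spanc_subspace _ _).2 => //.
move/HW_col0: hz; case: m {hw hv' sv' ez} => [|m] hz.
  by rewrite (HW_neg hz) // col_mx0; exact: (spanc_subspace _ _).1.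
have {}hz : HW m z0 by move: hz; rewrite (_ : m.+1%:Z - 1 = m) //; lia.
move=> Q hQ hx; apply: (IH _ _ hz (fun z => Q (col_mx z 0))).
  split; first by rewrite col_mx0; exact: hQ.1.
  move=> c x y hx' hy; have -> : col_mx (c *: x + y) 0 = c *: col_mx x 0 + col_mx y 0 :> 'cV[k]_(d n + d n).
    by rewrite scale_col_mx add_col_mx scaler0 addr0.
  exact: hQ.2.
move=> x xc; have := hx _ (cupc_dg2 xc); by rewrite /= dg2_col mulmx0.
Qed.
End Cups.

(** * The two models of the tensor power *)

Section Words.
Definition wcons n (c : 'I_2) (w : word n) : word n.+1 :=
  [ffun t => if unlift ord0 t is Some s then w s else c].
Lemma wcons0 n c (w : word n) : wcons c w ord0 = c.
Proof. by rewrite ffunE unlift_none. Qed.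
Lemma wconsS n c (w : word n) s : wcons c w (lift ord0 s) = w s.
Proof. by rewrite ffunE liftK. Qed.
Lemma wcons_eq n c c' (w w' : word n) : (wcons c w == wcons c' w') = (c == c') && (w == w').
Proof.
apply/eqP/andP => [e|[/eqP -> /eqP ->] //]; split; apply/eqP.
  by rewrite -(wcons0 c w) e wcons0.
by apply/ffunP => s; rewrite -(wconsS c w) e wconsS.
Qed.

Lemma swap_wcons n (i : 'I_n.+1.-1) (j : 'I_n.-1) c (w : word n) : i = j.+1 :> nat ->
  swap_word i (wcons c w) = wcons c (swap_word j w).
Proof.
move=> e; apply/ffunP => t; rewrite ffunE.
have el : strand_lo i = lift ord0 (strand_lo j) by apply: val_inj; rewrite /= e.
have eh : strand_hi i = lift ord0 (strand_hi j) by apply: val_inj; rewrite /= e.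
case: (unliftP ord0 t) => [s ->|->]; last by rewrite wcons0 tpermD ?wcons0 // ?el ?eh eq_sym neq_lift.
rewrite wconsS [RHS]ffunE el eh.
have -> : tperm (lift ord0 (strand_lo j)) (lift ord0 (strand_hi j)) (lift ord0 s) =
          lift ord0 (tperm (strand_lo j) (strand_hi j) s).
  case: (tpermP (strand_lo j) (strand_hi j) s) => [->|->|/eqP n1 /eqP n2]; rewrite ?tpermL ?tpermR //.
  by rewrite tpermD // (inj_eq lift_inj) eq_sym.
by rewrite wconsS.
Qed.

Lemma swap_wcons0 n (i : 'I_n.+2.-1) c c' (w : word n) : i = 0%N :> nat ->
  swap_word i (wcons c (wcons c' w)) = wcons c' (wcons c w).
Proof.
move=> e; apply/ffunP => t; rewrite ffunE.
have el : strand_lo i = ord0 by apply: val_inj; rewrite /= e.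
have eh : strand_hi i = lift ord0 ord0 by apply: val_inj; rewrite /= e.
rewrite el eh; case: (unliftP ord0 t) => [s ->|->]; last by rewrite tpermL wconsS !wcons0.
rewrite wconsS; case: (unliftP ord0 s) => [r ->|->]; last by rewrite tpermR !wcons0.
by rewrite tpermD ?wconsS // ?neq_lift // (inj_eq lift_inj) neq_lift.
Qed.
End Words.

Section Phi.
Variable k : fieldType.
Notation W := (W k).
Notation d n := (sldim (W n)).

Fixpoint wd n : 'I_(d n) -> word n :=
  match n return 'I_(d n) -> word n with
  | 0 => fun _ => [ffun _ => 0]
  | n'.+1 => fun j : 'I_(d n' + d n') =>
     match split j with inl a => wcons 0 (wd a) | inr b => wcons 1 (wd b) end
  end.
Lemma wd_l n (a : 'I_(d n)) : @wd n.+1 (lshift (d n) a) = wcons 0 (wd a).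
Proof. by rewrite /= (unsplitK (inl a)). Qed.
Lemma wd_r n (a : 'I_(d n)) : @wd n.+1 (rshift (d n) a) = wcons 1 (wd a).
Proof. by rewrite /= (unsplitK (inr a)). Qed.

Lemma dsplit n (P : 'I_(d n.+1) -> Prop) :
  (forall a : 'I_(d n), P (lshift (d n) a)) -> (forall a : 'I_(d n), P (rshift (d n) a)) -> forall i, P i.
Proof. by move=> h0 h1 i; case: (split_ordP (i : 'I_(d n + d n))) => j ->. Qed.

Lemma wd_inj n : injective (@wd n).
Proof.
elim: n => [|n IH] i j.
  by move=> _; rewrite [i]ord1 [j]ord1.
elim/dsplit: i => a; elim/dsplit: j => b; rewrite ?wd_l ?wd_r => /eqP;
  rewrite wcons_eq //= => /eqP/IH -> //.
Qed.
Lemma card_d n : d n = (2 ^ n)%N.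
Proof. by elim: n => //= n ->; rewrite expnS mul2n addnn. Qed.
Lemma wd_surj n (w : word n) : exists i, wd i = w.
Proof.
have h : #|'I_(d n)| = #|{: word n}| by rewrite card_ffun !card_ord card_d.
have hh : (#|{: word n}| <= #|'I_(d n)|)%N by rewrite h.
by have [f _ fK] := inj_card_bij (@wd_inj n) hh; exists (f w).
Qed.

(** Both models act by the same products of matrix entries. *)
Lemma W_entry n (A : comAlgType k) (g : 'M[A]_2) (i j : 'I_(d n)) :
  slact (W n) g i j = \prod_(t < n) g (wd i t) (wd j t).
Proof.
elim: n i j => [|n IH] i j.
  by rewrite [i]ord1 [j]ord1 big_ord0 /= mxE eqxx.
have key c c' (w w' : word n) : \prod_(t < n.+1) g (wcons c w t) (wcons c' w' t) =
    g c c' * \prod_(t < n) g (w t) (w' t).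
  rewrite big_ord_recl !wcons0; congr (_ * _); apply: eq_bigr => t _; by rewrite !wconsS.
elim/dsplit: i => a; elim/dsplit: j => b; rewrite ?wd_l ?wd_r key -IH /= /vm_act.
- by rewrite block_mxEul mxE.
- by rewrite block_mxEur mxE.
- by rewrite block_mxEdl mxE.
by rewrite block_mxEdr mxE.
Qed.

(** The change of basis between the tensor power indexed by words and the recursive
    one; the basis is the same up to its enumeration, so [Phi] is orthogonal. *)
Definition Phi n : 'M[k]_(sldim (tensV k n), d n) :=
  \matrix_(x, j) ((enum_val x : word n) == wd j)%:R.

Lemma mul_Phi n (A : comAlgType k) p (X : 'M[A]_(p, sldim (tensV k n))) x j :
  (X *m ext A (Phi n)) x j = X x (enum_rank (wd j)).
Proof.
rewrite mxE (bigD1 (enum_rank (wd j))) //= big1 ?addr0 => [|y ny].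
  by rewrite !mxE enum_rankK eqxx rmorph1 mulr1.
rewrite !mxE; case: eqP => [e|_]; last by rewrite rmorph0 mulr0.
by case/eqP: ny; rewrite -e enum_valK.
Qed.
Lemma Phi_mul n (A : comAlgType k) p (Y : 'M[A]_(d n, p)) i j :
  (ext A (Phi n) *m Y) (enum_rank (wd i)) j = Y i j.
Proof.
rewrite mxE (bigD1 i) //= big1 ?addr0 => [|y ny].
  by rewrite !mxE enum_rankK eqxx rmorph1 mul1r.
rewrite !mxE enum_rankK (inj_eq (@wd_inj n)) eq_sym (negPf ny) rmorph0 mul0r //.
Qed.
Lemma rank_wd n (x : 'I_(sldim (tensV k n))) : exists i, x = enum_rank (wd i : word n).
Proof. by have [i e] := wd_surj (enum_val x); exists i; rewrite e enum_valK. Qed.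

Lemma Phi_hom n : @SL2hom k (W n) (tensV k n) (Phi n).
Proof.
move=> A g dg; apply/matrixP => x j; have [i ->] := rank_wd x.
rewrite Phi_mul mul_Phi W_entry /= mxE; apply: eq_bigr => t _; by rewrite !enum_rankK.
Qed.
Lemma PhiT_Phi n : (Phi n)^T *m Phi n = 1%:M.
Proof.
apply/matrixP=> i j; rewrite !mxE (bigD1 (enum_rank (wd i))) //= big1 ?addr0 => [|y ny].
  by rewrite !mxE enum_rankK eqxx mul1r (inj_eq (@wd_inj n)).
rewrite !mxE; case: eqP => [e|_]; last by rewrite mul0r.
by case/eqP: ny; rewrite -e enum_valK.
Qed.
Lemma Phi_PhiT n : Phi n *m (Phi n)^T = 1%:M.
Proof.
apply/matrixP=> x y; have [i ->] := rank_wd x; have [j ->] := rank_wd y.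
rewrite !mxE (bigD1 i) //= big1 ?addr0 => [|l nl].
  by rewrite !mxE !enum_rankK eqxx mul1r (inj_eq enum_rank_inj) eq_sym.
by rewrite !mxE !enum_rankK (inj_eq (@wd_inj n)) eq_sym (negPf nl) mul0r.
Qed.
Lemma PhiT_hom n : @SL2hom k (tensV k n) (W n) (Phi n)^T.
Proof. exact: (hom_inv (@Phi_hom n) (PhiT_Phi n) (Phi_PhiT n)). Qed.

Lemma cup0_entry n (c1 c2 : 'I_2) (a : 'I_(d n)) (i : 'I_(d n.+2)) l : wd i = wcons c1 (wcons c2 (wd a)) ->
  cup k 0 n i l = ((c1 == 0)%:R - (c2 == 0)%:R) * (a == l)%:R.
Proof.
move=> e; have {}e : wcons c1 (wcons c2 (wd a)) = wd i by [].
move: e; elim/dsplit: i => b; elim/dsplit: b => b'; rewrite ?wd_l ?wd_r ?wd_l ?wd_r => /eqP;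
  rewrite !wcons_eq => /and3P[/eqP -> /eqP -> /eqP/wd_inj ->] /=.
- by rewrite !col_mxEu mxE subrr mul0r.
- by rewrite col_mxEu col_mxEd mxE subr0 mul1r.
- by rewrite col_mxEd col_mxEu !mxE sub0r mulN1r.
by rewrite !col_mxEd mxE subrr mul0r.
Qed.

Lemma tg_entry n (a : 'I_n.-1) (i j : 'I_(d n)) :
  tg k n a i j = (wd i == wd j)%:R - (wd i == swap_word a (wd j))%:R.
Proof.
elim: n a i j => [|n IH] a i j; first by case: a.
case: a => [[|a] ha].
  case: n {IH} ha i j => // n ha i j.
  have [c1 [c2 [i' ei]]] : exists c1 c2 (a : 'I_(d n)), wd i = wcons c1 (wcons c2 (wd a)).
    by elim/dsplit: i => b; elim/dsplit: b => b'; rewrite ?wd_l ?wd_r ?wd_l ?wd_r; do 3 eexists.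
  have [e1 [e2 [j' ej]]] : exists c1 c2 (a : 'I_(d n)), wd j = wcons c1 (wcons c2 (wd a)).
    by elim/dsplit: j => b; elim/dsplit: b => b'; rewrite ?wd_l ?wd_r ?wd_l ?wd_r; do 3 eexists.
  rewrite [tg _ _ _]/(cup k 0 n *m (cup k 0 n)^T) mxE (bigD1 i') // big1 ?addr0 => [|l /andP[_ nl]].
    rewrite (cup0_entry _ ei) mxE (cup0_entry _ ej) ei ej swap_wcons0 // !wcons_eq.
    rewrite eqxx mulr1 (inj_eq (@wd_inj n)) [j' == i']eq_sym.
    rewrite [LHS]/= addr0; case: (i' == j'); last by rewrite !andbF subrr !mulr0.
    rewrite !andbT mulr1.
    by case: (ord2P c1) => ->; case: (ord2P c2) => ->; case: (ord2P e1) => ->; case: (ord2P e2) => ->;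
      rewrite /= ?eqxx /=; ring.
  by rewrite (cup0_entry _ ei) [i' == l]eq_sym (negPf nl) mulr0 mul0r.
have ha' : (a < n.-1)%N by move: ha => /=; case: n {IH i j}.
have := IH (Ordinal ha'); set a' := Ordinal ha' => {}IH.
have sw c (w : word n) : swap_word (Ordinal ha) (wcons c w) = wcons c (swap_word a' w) by exact: swap_wcons.
rewrite -[nat_of_ord (Ordinal ha)]/(a'.+1) -tg_dg2; last by rewrite -ltn_predRL.
elim/dsplit: i => b; elim/dsplit: j => c; rewrite ?wd_l ?wd_r sw !wcons_eq /= /dg2.
- by rewrite block_mxEul IH.
- by rewrite block_mxEur mxE subrr.
- by rewrite block_mxEdl mxE subrr.
by rewrite block_mxEdr IH.
Qed.

Lemma tl_op_Phi n (a : 'I_n.-1) : tl_op k a *m Phi n = Phi n *m tg k n a.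
Proof.
apply: (@ext_inj k {poly k}); rewrite !extM; apply/matrixP => x j; have [i ->] := rank_wd x.
rewrite Phi_mul mul_Phi !mxE !enum_rankK tg_entry (inj_eq enum_rank_inj).
by [].
Qed.
End Phi.

(** * Cell modules as spaces of highest weight vectors *)

Section HeadDim.
Variables (k : fieldType) (A : algType k) (M : fdmod A) (R : {vspace M}).
Hypotheses (sR : submodule R) (Rn : R <> fullv)
  (gen : forall x, x \notin R -> forall y, exists a : A, fdact a x = y).

Lemma sub_generated (U : {vspace M}) : submodule U -> U = fullv \/ (U <= R)%VS.
Proof.
move=> sU; case: (pselect (exists2 x, x \in U & x \notin R)) => [[x xU xR]|h].
  left; apply/eqP; rewrite eqEsubv subvf; apply/subvP => y _.
  by have [a <-] := gen xR y; apply: sU.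
right; apply/subvP => x xU; apply/negPn/negP => xR; apply: h; by exists x.
Qed.

Lemma gen_maximal : maximal_submodule R.
Proof.
split=> // U sU RU; case: (sub_generated sU) => [->|UR]; first by right.
by left; apply/eqP; rewrite eqEsubv UR.
Qed.

(** If every vector outside the submodule R generates the module, then R contains
    all proper submodules, so R is the radical. *)
Lemma head_dim : fddim (Defs.head M) = (\dim (fullv : {vspace M}) - \dim R)%N.
Proof.
have radE : radical M = R.
  apply/vspaceP => x; apply/idP/idP => [/mem_radical h|xR]; first exact: h gen_maximal.
  apply/mem_radical => U [sU Un maxU].
  case: (sub_generated sU) => // UR; case: (maxU R sR UR) => [<- //|e]; by case: Rn.
transitivity (\dim (R^C)%VS); last by rewrite dimv_compl dimvf.
by rewrite -radE /fddim dimvf.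
Qed.
End HeadDim.

Section WeylHoms.
Variable k : fieldType.
Notation W := (W k).
Notation d n := (sldim (W n)).

Lemma weyl_in_hwv m : weyl_in k m *m hwv k m.+1 = col_mx (hwv k m) 0.
Proof.
rewrite mul_col_mx mulNmx; congr col_mx; apply/matrixP=> i j; rewrite [j]ord1.
  rewrite shl_mulv /hwv /wv !mxE eqxx !andbT -!val_eqE /= /bump add1n eqSS //.
rewrite mxNE idl_mulv /hwv /wv !mxE eqxx !andbT -!val_eqE /= ltn_eqF ?oppr0 //.
Qed.

Fixpoint iota_weyl m : 'M[k]_(d m, sldim (Weyl k m)) :=
  match m return 'M[k]_(d m, sldim (Weyl k m)) with
  | 0 => 1%:M
  | m'.+1 => dg2 (iota_weyl m') *m weyl_in k m'
  end.
Lemma iota_weyl_hom m : @SL2hom k (Weyl k m) (W m) (iota_weyl m).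
Proof.
elim: m => [|m IH]; last exact: (SL2hom_comp (VM_hom IH) (@weyl_in_hom k m)).
move=> A g dg; rewrite ext1 mul1mx mulmx1; apply/matrixP=> i j.
by rewrite [i]ord1 [j]ord1 weylE /wrow !expr0 mulr1 coef1 /= mxE eqxx.
Qed.
Lemma iota_weyl_hwv m : iota_weyl m *m hwv k m = topvec k m.
Proof.
elim: m => [|m IH] /=.
  by rewrite mul1mx; apply/matrixP=> i j; rewrite [i]ord1 [j]ord1 !mxE.
by rewrite -mulmxA weyl_in_hwv dg2_col IH mulmx0.
Qed.

(** Delta(m) is universal among modules generated by a highest weight vector of weight
    m.  For W n a homomorphism is obtained from Delta(m) -> W m followed by a
    half-diagram, and [HW_span] supplies all highest weight vectors. *)
Lemma weyl_hom_ex n (m : nat) v : @HW k (W n) m v ->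
  exists2 X, @SL2hom k (Weyl k m) (W n) X & X *m hwv k m = v.
Proof.
move=> hv'; apply: (HW_span hv' (Q := fun v => exists2 X, @SL2hom k (Weyl k m) (W n) X & X *m hwv k m = v)).
  split; first by exists 0; [exact: (SL2hom_subspace _ _).1 | rewrite mul0mx].
  move=> c x y [X hX <-] [Y hY <-]; exists (c *: X + Y); first exact: (SL2hom_subspace _ _).2.
  by rewrite mulmxDl scalemxAl.
move=> x hx; exists (x *m iota_weyl m); last by rewrite -mulmxA iota_weyl_hwv.
exact: SL2hom_comp (cupc_hom hx) (@iota_weyl_hom m).
Qed.

(** The highest weight vector generates the Weyl module under the divided powers
    of F. *)
Lemma weyl_hom_eq0 N m X : @SL2hom k (Weyl k m) N X -> X *m hwv k m = 0 -> X = 0.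
Proof.
move=> hX X0; apply/matrixP => a l; rewrite [RHS]mxE.
have e : Fc (Weyl k m) (m - l) *m hwv k m = (-1) ^+ (m - l) *: delta_mx l 0.
  apply/matrixP => i j; rewrite [j]ord1 weyl_F_hwv mxZE mxE eqxx andbT.
  have E x y : (x < m.+1)%N -> (y < m.+1)%N -> (m - y == m - x)%N = (x == y) by lia.
  rewrite (E _ _ (ltn_ord i) (ltn_ord l)) val_eqE; case: eqP => [->|_] //; by rewrite !mulr0.
have : X *m (Fc (Weyl k m) (m - l) *m hwv k m) = 0.
  by rewrite mulmxA (Fc_hom _ hX) -mulmxA X0 mulmx0.
rewrite e -scalemxAr -colE => /matrixP/(_ a 0); rewrite mxZE !mxE => /eqP.
by rewrite mulf_eq0 signr_eq0 => /eqP.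
Qed.
End WeylHoms.

Section Cell.
Variables (k : fieldType) (n m : nat).
Notation W := (W k).
Notation d n := (sldim (W n)).
Notation C := (cell_module k n m).
Notation TLn := (TL n (2%:R : k)).

(** The action of the Temperley-Lieb algebra transported to W n. *)
Definition opW (a : TLn) : 'M[k]_(d n) := (Phi k n)^T *m tl_tens a *m Phi k n.
Lemma opW1 : opW 1 = 1%:M.
Proof. by rewrite /opW /tl_tens (tl_rep1 (@tl_op_relations k n)) mulmx1 PhiT_Phi. Qed.
Lemma opWM a b : opW (a * b) = opW a *m opW b.
Proof.
rewrite /opW /tl_tens (tl_repM (@tl_op_relations k n)) -!mulmxA; congr (_ *m (_ *m _)).
by rewrite [Phi k n *m _]mulmxA Phi_PhiT mul1mx.
Qed.
Lemma opWP c a b : opW (c *: a + b) = c *: opW a + opW b.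
Proof. by rewrite /opW /tl_tens (tl_repP (@tl_op_relations k n)) mulmxDr mulmxDl -scalemxAr -scalemxAl. Qed.
Lemma opW_gen i : opW (tl_gen 2%:R i) = tg k n i.
Proof.
by rewrite /opW /tl_tens (tl_rep_gen (@tl_op_relations k n)) -mulmxA tl_op_Phi mulmxA PhiT_Phi mul1mx.
Qed.
Lemma alg_opW b : @alg k n b -> exists a, opW a = b.
Proof.
elim=> [|i le|{}b c _ [a <-] _ [a' <-]|c {}b _ [a <-]].
- by exists 1; rewrite opW1.
- have hi : (i < n.-1)%N by rewrite ltn_predRL.
  by exists (tl_gen 2%:R (Ordinal hi)); rewrite opW_gen.
- by exists (a * a'); rewrite opWM.
exists (c *: a + 0); rewrite opWP -[opW 0](_ : 0 = _) ?addr0 //.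
have := opWP 0 1 0; rewrite !scale0r !add0r => e.
by have := opWP (-1) 0 0; rewrite scaler0 addr0 scaleN1r => /eqP; rewrite addrC subrr => /eqP ->.
Qed.

Lemma opW_stable (R : 'cV[k]_(d n) -> Prop) : subspace_pred R ->
  (forall i v, (i.+1 < n)%N -> R v -> R (tg k n i *m v)) -> forall a v, R v -> R (opW a *m v).
Proof.
move=> [R0 RL] st a v; rewrite /opW /tl_tens /tl_rep; elim: (repr a) v => /= [i|c|x hx y hy|x hx y hy] v Rv.
- rewrite -[_ *m tl_op k i *m _]mulmxA tl_op_Phi mulmxA PhiT_Phi mul1mx; apply: st => //.
  by rewrite -ltn_predRL.
- rewrite mul_mx_scalar -scalemxAl PhiT_Phi -scalemxAl mul1mx -[X in R X]addr0; exact: RL.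
- by rewrite mulmxDr mulmxDl mulmxDl -[X in R (X + _)]scale1r; apply: RL; [apply: hx | apply: hy].
have -> : (Phi k n)^T *m (tleval (@tl_op k n) x *m tleval (@tl_op k n) y) *m Phi k n *m v =
  (Phi k n)^T *m tleval (@tl_op k n) x *m Phi k n *m ((Phi k n)^T *m tleval (@tl_op k n) y *m Phi k n *m v).
  by rewrite -!mulmxA; congr (_ *m (_ *m _)); rewrite [RHS]mulmxA Phi_PhiT mul1mx.
by apply: hx; apply: hy.
Qed.

(** The image of the highest weight vector under a homomorphism, which identifies the
    cell module with a space of highest weight vectors. *)
Definition ev (X : C) : 'cV[k]_(d n) := (Phi k n)^T *m (vsval X *m hwv k m).
Lemma ev_linear : linear ev.
Proof.
move=> c X Y; rewrite /ev -[vsval (c *: X + Y)]/(c *: vsval X + vsval Y).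
by rewrite mulmxDl mulmxDr -scalemxAl -scalemxAr.
Qed.
HB.instance Definition _ := GRing.isLinear.Build k C 'cV[k]_(d n) _ ev ev_linear.
Lemma vsval_hom (X : C) : @SL2hom k (Weyl k m) (tensV k n) (vsval X).
Proof. by apply/mem_Hom_SL2; apply: subvsP. Qed.
Lemma ev_HW X : HW m (ev X).
Proof. by rewrite /ev; apply: (HW_hom (@PhiT_hom k n)); apply: (HW_hom (vsval_hom X)); exact: HW_hwv. Qed.
Lemma ev_inj X : ev X = 0 -> X = 0.
Proof.
move=> h; apply: val_inj; rewrite /= ; apply: (weyl_hom_eq0 (vsval_hom X)).
by rewrite -[LHS]mul1mx -Phi_PhiT -mulmxA -/(ev X) h mulmx0.
Qed.
Lemma ev_surj v : HW m v -> exists X, ev X = v.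
Proof.
move=> /weyl_hom_ex[X hX <-].
have hY : Phi k n *m X \in Hom_SL2 (Weyl k m) (tensV k n).
  by apply/mem_Hom_SL2; exact: SL2hom_comp (@Phi_hom k n) hX.
exists (Subvs hY); rewrite /ev /= mulmxA mulmxA PhiT_Phi mul1mx //.
Qed.
Lemma ev_act a X : ev (fdact a X) = opW a *m ev X.
Proof.
rewrite /ev /= cell_actE /opW -!mulmxA; congr (_ *m (_ *m _)).
by rewrite [RHS]mulmxA Phi_PhiT mul1mx.
Qed.

Lemma cell_head (R : 'cV[k]_(d n) -> Prop) : subspace_pred R -> (forall v, R v -> HW m v) ->
  (forall i v, (i.+1 < n)%N -> R v -> R (tg k n i *m v)) ->
  (forall v w, HW m v -> ~ R v -> HW m w -> exists a, w = opW a *m v) ->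
  (exists2 v, HW m v & ~ R v) ->
  fddim (simple_module k n m) = (\dim (vspace_of (@HW k (W n) m)) - \dim (vspace_of R))%N.
Proof.
move=> sR RH st gen [v0 hv0 nv0].
pose f : 'Hom(C, 'cV[k]_(d n)) := linfun ev.
have fE X : f X = ev X by rewrite lfunE.
have memR := mem_vspace_of sR; have memH := mem_vspace_of (@HW_subspace k (W n) m).
have ker0 : lker f == 0%VS.
  by apply/lker0P => X Y; rewrite !fE => e; apply/eqP; rewrite -subr_eq0; apply/eqP/ev_inj; rewrite linearB /= e subrr.
have imf : (f @: fullv)%VS = vspace_of (@HW k (W n) m).
  apply/vspaceP => v; apply/idP/idP => [/memv_imgP[X _ ->]|/memH/ev_surj[X <-]].
    by apply/memH; rewrite fE; apply: ev_HW.
  by rewrite -fE memv_img ?memvf.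
pose RC : {vspace C} := (f @^-1: vspace_of R)%VS.
have memRC X : X \in RC <-> R (ev X) by rewrite -memv_preim fE; exact: memR.
have imR : (f @: RC)%VS = vspace_of R.
  apply/vspaceP => v; apply/idP/idP => [/memv_imgP[X /memRC hX ->]|/memR hR].
    by apply/memR; rewrite fE.
  have [X e] := ev_surj (RH _ hR); rewrite -e -fE; apply: memv_img; by apply/memRC; rewrite e.
rewrite (@head_dim k _ C RC).
- by rewrite -imf -imR !limg_dim_eq // (eqP ker0) capv0.
- by move=> a X /memRC hX; apply/memRC; rewrite ev_act; apply: opW_stable.
- move=> e; have [X eX] := ev_surj hv0; apply: nv0; rewrite -eX; apply/memRC; by rewrite e memvf.
move=> X hX Y; have [] := gen (ev X) (ev Y) (ev_HW X) _ (ev_HW Y).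
  by move/memRC => h; rewrite h in hX.
move=> a e; exists a; apply/eqP; rewrite -subr_eq0; apply/eqP/ev_inj.
by rewrite linearB /= ev_act -e subrr.
Qed.
End Cell.

(** * The form on highest weight vectors and its recursion *)

Section Ops.
Variable k : fieldType.
Notation W := (W k).
Notation d n := (sldim (W n)).

Lemma W_T n (A : comAlgType k) (g : 'M[A]_2) : (slact (W n) g)^T = slact (W n) g^T.
Proof.
elim: n => [|n IH] /=; first by rewrite trmx1.
by rewrite /vm_act tr_block_mx !linearZ /= IH !mxE.
Qed.
Lemma W_homT n m (X : 'M_(d m, d n)) : @SL2hom k (W n) (W m) X -> @SL2hom k (W m) (W n) X^T.
Proof.
move=> h A g dg; apply: trmx_inj; rewrite !trmx_mul !extT !trmxK !W_T.
by rewrite h // det_tr.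
Qed.
Lemma tr_up (A : comNzRingType) (x : A) : (up x)^T = lo x.
Proof. by apply: mx2P; rewrite !mxE. Qed.
Lemma Ec_T n j : (Ec (W n) j)^T = Fc (W n) j.
Proof.
rewrite /Fc -tr_up -W_T; apply/matrixP => a b; rewrite !mxE //.
Qed.
Lemma Fc_T n j : (Fc (W n) j)^T = Ec (W n) j.
Proof. by rewrite -Ec_T trmxK. Qed.

(** The operators E, F and H on W n, with H given by its block form, which is the
    Leibniz rule. *)
Definition Eo n := Ec (W n) 1.
Definition Fo n := Fc (W n) 1.
Fixpoint Ho n : 'M[k]_(d n) :=
  match n return 'M[k]_(d n) with
  | 0 => 0
  | n'.+1 => block_mx (Ho n' + 1%:M) 0 0 (Ho n' - 1%:M)
  end.
Lemma Eo_T n : (Eo n)^T = Fo n. Proof. exact: Ec_T. Qed.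
Lemma Fo_T n : (Fo n)^T = Eo n. Proof. exact: Fc_T. Qed.
Lemma Ho_T n : (Ho n)^T = Ho n.
Proof.
elim: n => [|n IH] /=; first by rewrite trmx0.
by rewrite tr_block_mx !trmx0 linearD linearB /= IH trmx1.
Qed.

Lemma mcoef_block m1 m2 n1 n2 i (A : 'M[{poly k}]_(m1, n1)) B C (D : 'M_(m2, n2)) :
  mcoef i (block_mx A B C D) = block_mx (mcoef i A) (mcoef i B) (mcoef i C) (mcoef i D).
Proof. exact: map_block_mx. Qed.
Lemma mcoef1X m n (P : 'M[{poly k}]_(m, n)) : mcoef 1 ('X *: P) = mcoef 0 P.
Proof. by apply/matrixP => a b; rewrite !mxE /= mulrC coefMX. Qed.
Lemma mcoef_0 m n i : mcoef i (0 : 'M[{poly k}]_(m, n)) = 0.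
Proof. by apply/matrixP => a b; rewrite !mxE /= coef0. Qed.

Lemma Eo_0 : Eo 0 = 0.
Proof. by rewrite /Eo /Ec /= -(ext1 {poly k}) mcoef_ext scale0r. Qed.
Lemma Fo_0 : Fo 0 = 0.
Proof. by rewrite /Fo /Fc /= -(ext1 {poly k}) mcoef_ext scale0r. Qed.
Lemma Eo_S n : Eo n.+1 = block_mx (Eo n) 1%:M 0 (Eo n).
Proof.
rewrite /Eo /Ec /= /vm_act !mxE /= scale0r !scale1r mcoef_block mcoef1X mcoef_0.
by congr (block_mx _ _ _ _); exact: Ec0.
Qed.
Lemma Fo_S n : Fo n.+1 = block_mx (Fo n) 0 1%:M (Fo n).
Proof.
rewrite /Fo /Fc /= /vm_act !mxE /= scale0r !scale1r mcoef_block mcoef1X mcoef_0.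
by congr (block_mx _ _ _ _); exact: Fc0.
Qed.

Section Conj.
Variables (A : comAlgType k) (x : A).
Notation U n := (slact (W n) (up x)).
Notation e X := (ext A X).
Lemma U_S n : U n.+1 = block_mx (U n) (x *: U n) 0 (U n).
Proof. by rewrite /= /vm_act !mxE /= scale0r !scale1r. Qed.

Lemma U_E n : U n *m e (Eo n) = e (Eo n) *m U n.
Proof.
elim: n => [|n IH]; first by rewrite Eo_0 ext0 mulmx0 mul0mx.
rewrite U_S Eo_S !(ext_block, ext0, ext1) !mulmx_block !mul0mx !mulmx0 !addr0 !add0r mulmx1 mul1mx.
by rewrite -scalemxAl -scalemxAr IH addrC.
Qed.
(** The adjoint action of the upper unipotent subgroup on the Lie algebra; together
    with [U_E] and [U_F] it yields the commutation relations by taking coefficients. *)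
Lemma U_H n : U n *m e (Ho n) = (e (Ho n) - (2%:R * x) *: e (Eo n)) *m U n.
Proof.
elim: n => [|n IH]; first by rewrite Eo_0 /= ext0 mulmx0 scaler0 subr0 mul0mx.
rewrite U_S Eo_S [Ho n.+1]/= !(ext_block, ext0) extD extB !ext1 scale_block_mx opp_block_mx add_block_mx.
rewrite !mulmx_block !(mul0mx, mulmx0, addr0, add0r, scaler0, oppr0).
rewrite -?scalemxAl -?scalemxAr ?mulmxDr ?mulmxN ?mulmx1 IH.
rewrite ?(mulmxDl, mulNmx, mul1mx) -?scalemxAl ?mul1mx.
move: (U n) (e (Ho n) *m U n) (e (Eo n) *m U n) => u hu eu.
by congr (block_mx _ _ _ _); apply/matrixP => a b; rewrite !mxE; ring.
Qed.
Lemma U_F n : U n *m e (Fo n) = (e (Fo n) + x *: e (Ho n) - x ^+ 2 *: e (Eo n)) *m U n.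
Proof.
elim: n => [|n IH].
  by rewrite Eo_0 Fo_0 /= ext0 mulmx0 !scaler0 subr0 addr0 mul0mx.
rewrite U_S Eo_S Fo_S [Ho n.+1]/= !(ext_block, ext0) extD extB !ext1 !scale_block_mx opp_block_mx !add_block_mx.
rewrite !mulmx_block !(mul0mx, mulmx0, addr0, add0r, scaler0, oppr0).
rewrite -?scalemxAl -?scalemxAr ?mulmxDr ?mulmxN ?mulmx1 IH.
rewrite ?(mulmxDl, mulNmx, mul1mx) -?scalemxAl ?(mulmxDl, mulNmx, mul1mx).
move: (U n) (e (Fo n) *m U n) (e (Ho n) *m U n) (e (Eo n) *m U n) => u fu hu eu.
by congr (block_mx _ _ _ _); apply/matrixP => a b; rewrite !mxE; ring.
Qed.
End Conj.

Lemma EF_comm n : Eo n *m Fo n = Fo n *m Eo n + Ho n.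
Proof.
have := congr1 (mcoef 1) (U_F ('X : {poly k}) n); rewrite mcoef_extr -/(Eo n) => ->.
have -> : (ext {poly k} (Fo n) + 'X *: ext {poly k} (Ho n) - 'X^2 *: ext {poly k} (Eo n)) *m slact (W n) (up 'X) =
  ext _ (Fo n) *m slact (W n) (up 'X) + 'X *: (ext _ (Ho n) *m slact (W n) (up 'X) -
   'X *: (ext _ (Eo n) *m slact (W n) (up 'X))).
  by rewrite mulmxBl mulmxDl -!scalemxAl scalerBr scalerA -expr2 addrA.
rewrite mcoefD mcoef_extl mcoef1X mcoefB mcoef_extl -/(Eo n) -/(Ec (W n) 0) Ec0 mulmx1.
rewrite [mcoef 0 ('X *: _)](_ : _ = 0) ?subr0 //.
by apply/matrixP => a b; rewrite !mxE /= mulrC coefMX.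
Qed.

Lemma HE_comm n : Ho n *m Eo n = Eo n *m Ho n + 2%:R *: Eo n.
Proof.
elim: n => [|n IH]; first by rewrite Eo_0 /= mul0mx scaler0 addr0.
rewrite Eo_S [Ho n.+1]/= scale_block_mx !mulmx_block !(mul0mx, mulmx0, addr0, add0r, scaler0) add_block_mx !(addr0, add0r).
rewrite ?(mulmxDl, mulmxDr, mulNmx, mulmxN, mulmx1, mul1mx) IH.
move: (Eo n *m Ho n) (Eo n) (Ho n) => eh e h.
by congr (block_mx _ _ _ _); apply/matrixP => a b; rewrite !mxE; ring.
Qed.

Lemma Ho_weight n r v : @weight_vector k (W n) r v -> Ho n *m v = r%:~R *: v.
Proof.
elim: n r v => [|n IH] r v.
  move=> w; rewrite /= mul0mx; have [->|r0] := eqVneq r 0; first by rewrite scale0r.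
  by rewrite (weight_uniq w (weight_triv v) (elimN eqP r0)) scaler0.
rewrite -[v]vsubmxK => /weight_VM[/IH h0 /IH h1].
rewrite [Ho _]/= mul_block_col !mul0mx addr0 add0r mulmxDl mulmxBl !mul1mx h0 h1 scale_col_mx.
rewrite rmorphB rmorphD /= scalerBl scalerDl !scale1r subrK addrK //.
Qed.

(** The bilinear form for which the standard basis is orthonormal; E and F are adjoint
    to each other, and the torus and the cups with their caps are compatible with it. *)
Definition dotp n (u v : 'cV[k]_(d n)) : k := (u^T *m v) 0 0.
Lemma dotpC n u v : @dotp n u v = dotp v u.
Proof. by transitivity ((v^T *m u)^T 0 0); [rewrite trmx_mul trmxK | rewrite [LHS]mxE]. Qed.
Lemma dotpDl n c u u' v : @dotp n (c *: u + u') v = c * dotp u v + dotp u' v.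
Proof. by rewrite /dotp linearP mulmxDl -scalemxAl mxDE mxZE. Qed.
Lemma dotpDr n c u v v' : @dotp n u (c *: v + v') = c * dotp u v + dotp u v'.
Proof. by rewrite dotpC dotpDl !(dotpC u). Qed.
Lemma dotp0l n v : @dotp n 0 v = 0.
Proof. by rewrite /dotp trmx0 mul0mx mxE. Qed.
Lemma dotp0r n v : @dotp n v 0 = 0.
Proof. by rewrite dotpC dotp0l. Qed.
Lemma dotpZl n (c : k) (u v : 'cV[k]_(d n)) : dotp (c *: u) v = c * dotp u v.
Proof. by rewrite -[c *: u]addr0 dotpDl dotp0l addr0. Qed.
Lemma dotpZr n (c : k) (u v : 'cV[k]_(d n)) : dotp u (c *: v) = c * dotp u v.
Proof. by rewrite dotpC dotpZl dotpC. Qed.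
Lemma dotpMl n m (X : 'M_(d n, d m)) u v : dotp (X *m u) v = dotp u (X^T *m v).
Proof. by rewrite /dotp trmx_mul mulmxA. Qed.
Lemma dotp_col n (u0 u1 v0 v1 : 'cV_(d n)) :
  @dotp n.+1 (col_mx u0 u1) (col_mx v0 v1) = dotp u0 v0 + dotp u1 v1.
Proof. by rewrite /dotp tr_col_mx mul_row_col mxDE. Qed.
Lemma dotp_delta n l v : @dotp n (delta_mx l 0) v = v l 0.
Proof. by rewrite dotpC /dotp -colE !mxE. Qed.

(** The radical of the form on the highest weight vectors of weight r. *)
Definition Rad n r (v : 'cV[k]_(d n)) : Prop := HW r v /\ forall u, HW r u -> dotp u v = 0.
Lemma Rad_subspace n r : subspace_pred (@Rad n r).
Proof.
have [h0 hl] := @HW_subspace k (W n) r; split=> [|c x y [hx rx] [hy ry]].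
  by split=> // u _; rewrite dotp0r.
by split; [apply: hl | move=> u hu; rewrite dotpDr rx // ry // mulr0 addr0].
Qed.
Definition hwdim n r := \dim (vspace_of (@HW k (W n) r)).
Definition raddim n r := \dim (vspace_of (@Rad n r)).
(** The rank of the form on the highest weight vectors of weight r. *)
Definition Ddim n r := (hwdim n r - raddim n r)%N.

Lemma vspace_of_le (V : vectType k) (P Q : V -> Prop) : subspace_pred P -> subspace_pred Q ->
  (forall x, P x -> Q x) -> (vspace_of P <= vspace_of Q)%VS.
Proof. by move=> sP sQ h; apply/subvP => x /(mem_vspace_of sP)/h/(mem_vspace_of sQ). Qed.
Lemma vspace_of_eq (V : vectType k) (P Q : V -> Prop) : subspace_pred P -> subspace_pred Q ->
  (forall x, P x <-> Q x) -> vspace_of P = vspace_of Q.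
Proof.
move=> sP sQ h; apply/eqP; rewrite eqEsubv; apply/andP; split; apply: vspace_of_le => // x; by case: (h x).
Qed.
Lemma raddim_le n r : (raddim n r <= hwdim n r)%N.
Proof.
by apply: dimvS; apply: vspace_of_le; [exact: Rad_subspace | exact: HW_subspace | move=> x []].
Qed.

(** The dimension of a space of column vectors is the sum of the dimensions of the
    space of its lower components and of its vectors with zero lower component. *)
Lemma dim_slices a b (P : 'cV[k]_(a + b) -> Prop) (Q0 : 'cV[k]_a -> Prop) (Q1 : 'cV[k]_b -> Prop) :
  subspace_pred P -> subspace_pred Q0 -> subspace_pred Q1 ->
  (forall v, P (col_mx v 0) <-> Q0 v) -> (forall v, P v -> Q1 (dsubmx v)) ->
  (forall v1, Q1 v1 -> exists v0, P (col_mx v0 v1)) ->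
  \dim (vspace_of P) = (\dim (vspace_of Q0) + \dim (vspace_of Q1))%N.
Proof.
move=> sP s0 s1 h0 h1 hs.
have mP := mem_vspace_of sP; have m0 := mem_vspace_of s0; have m1 := mem_vspace_of s1.
pose f : 'Hom('cV[k]_(a + b), 'cV[k]_b) := linfun dsubmx.
have fE v : f v = dsubmx v by rewrite lfunE.
pose gf (v : 'cV[k]_a) : 'cV[k]_(a + b) := col_mx v 0.
have gl : linear gf by move=> c u v; rewrite /gf scale_col_mx add_col_mx scaler0 addr0.
pose glin := GRing.isLinear.Build k 'cV[k]_a 'cV[k]_(a + b) _ gf gl.
pose gL : {linear 'cV[k]_a -> 'cV[k]_(a + b)} := HB.pack gf glin.
pose g : 'Hom('cV[k]_a, 'cV[k]_(a + b)) := linfun gL.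
have gE v : g v = col_mx v 0 by rewrite lfunE.
rewrite -(limg_ker_dim f); congr (_ + _)%N.
  have -> : (vspace_of P :&: lker f)%VS = (g @: vspace_of Q0)%VS.
    apply/vspaceP => v; apply/idP/idP.
      rewrite memv_cap memv_ker fE => /andP[/mP Pv /eqP e].
      have ev : v = col_mx (usubmx v) 0 by rewrite -{1}[v]vsubmxK e.
      by rewrite ev -gE; apply: memv_img; apply/m0/h0; rewrite -ev.
    move=> /memv_imgP[u /m0/h0 Pu ->]; rewrite gE memv_cap memv_ker fE col_mxKd eqxx andbT.
    exact/mP.
  rewrite limg_dim_eq //; have -> : lker g = 0%VS; last by rewrite capv0.
  apply/eqP; rewrite -subv0; apply/subvP => u; rewrite memv_ker gE => /eqP e.
  by rewrite memv0; apply/eqP; have := congr1 usubmx e; rewrite col_mxKu linear0.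
congr (\dim _); apply/vspaceP => v; apply/idP/idP.
  by move=> /memv_imgP[u /mP Pu ->]; rewrite fE; apply/m1/h1.
move=> /m1/hs[v0 /mP h]; have -> : v = f (col_mx v0 v) by rewrite fE col_mxKd.
exact: memv_img.
Qed.

Lemma upfix_E n (v : 'cV[k]_(d n)) : upfix v -> Eo n *m v = 0.
Proof. by move=> /upfixE; apply. Qed.

Definition hlift n (c : k) (v : 'cV[k]_(d n)) : 'cV[k]_(d n.+1) := col_mx (- c *: (Fo n *m v)) v.

(** The vector e_1 (x) v - c e_0 (x) F v is killed by E because E F v = (r + 1) v and
    c (r + 1) = 1; the full unipotent subgroup is handled by [U_F]. *)
Lemma hlift_HW n r c v : c * (r + 1)%:~R = 1 -> @HW k (W n) (r + 1) v -> @HW k (W n.+1) r (hlift c v).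
Proof.
move=> ec [w u]; split.
  apply/weight_VM; split=> //; apply: weightZ.
  by have := weight_F 1 w; rewrite (_ : _ - _ = r - 1) //; lia.
have e : slact (W n) (up ('X : {poly k})) *m ext _ (Fo n *m v) =
   ext _ (Fo n *m v) + ('X * (r + 1)%:~R%:P) *: ext {poly k} v.
  rewrite extM mulmxA U_F -mulmxA u mulmxBl mulmxDl -!scalemxAl -!extM (upfix_E u) (Ho_weight w).
  by rewrite ext0 scaler0 subr0 extZ scalerA alg_polyC.
rewrite /upfix U_S /hlift ext_col extZ mul_block_col mul0mx add0r u -scalemxAr -scalemxAl e u.
congr col_mx; rewrite scalerDr -addrA -[RHS]addr0; congr (_ + _).
rewrite scalerA -scalerDl alg_polyC polyCN mulNr mulrCA -polyCM ec polyC1 mulr1 addNr scale0r //.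
Qed.

Section Recursion.
Variables (n : nat) (r : int) (c : k).
Hypothesis ec : c * (r + 1)%:~R = 1.

Lemma dot_lift_col0 v z : @HW k (W n) (r - 1) z -> @dotp n.+1 (hlift c v) (col_mx z 0) = 0.
Proof.
move=> [_ u]; rewrite dotp_col dotp0r addr0 dotpZl.
by rewrite dotpMl Fo_T (upfix_E u) dotp0r mulr0.
Qed.
(** From (F u, F v) = (u, E F v) = (r + 1) (u, v): the form on lifts is multiplied by
    1 + c = (r + 2) / (r + 1). *)
Lemma dot_lift_lift u v : @HW k (W n) (r + 1) u -> @HW k (W n) (r + 1) v ->
  @dotp n.+1 (hlift c u) (hlift c v) = c * (r + 2%:Z)%:~R * dotp u v.
Proof.
move=> hu [wv uv]; rewrite dotp_col dotpZl dotpZr dotpMl Fo_T mulmxA EF_comm mulmxDl -mulmxA.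
rewrite (upfix_E uv) mulmx0 add0r (Ho_weight wv) dotpZr.
have -> : (r + 2%:Z)%:~R = (r + 1)%:~R + 1 :> k by rewrite (_ : r + 2%:Z = r + 1 + 1) ?rmorphD //=; ring.
rewrite mulrDr ec mulr1 mulrDl mul1r addrC; congr (_ + _).
rewrite !mulrA mulrNN; congr (_ * _); by rewrite -mulrA ec mulr1.
Qed.
Lemma HW_decomp v : @HW k (W n.+1) r v ->
  exists z, [/\ v = hlift c (dsubmx (v : 'cV_(d n + d n))) + col_mx z 0, HW (r - 1) z &
    HW (r + 1) (dsubmx (v : 'cV_(d n + d n)))].
Proof.
move=> h; have h1 : HW (r + 1) (dsubmx (v : 'cV_(d n + d n))) by apply: (@HW_col1 k (W n) r (usubmx (v : 'cV_(d n + d n)))); rewrite vsubmxK.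
exists (usubmx (v : 'cV_(d n + d n)) + c *: (Fo n *m dsubmx (v : 'cV_(d n + d n)))).
have e : v = hlift c (dsubmx (v : 'cV_(d n + d n))) +
   col_mx (usubmx (v : 'cV_(d n + d n)) + c *: (Fo n *m dsubmx (v : 'cV_(d n + d n)))) 0.
  by rewrite /hlift add_col_mx addr0 addrC scaleNr addrK vsubmxK.
split=> //; apply/(@HW_col0 k (W n)).
have -> : col_mx (usubmx (v : 'cV_(d n + d n)) + c *: (Fo n *m dsubmx (v : 'cV_(d n + d n)))) 0 =
  - (1) *: hlift c (dsubmx (v : 'cV_(d n + d n))) + v.
  by rewrite scaleN1r; apply: (canRL (addKr _)); rewrite -e.
by apply: (HW_subspace _ _).2 => //; apply: hlift_HW.
Qed.

Lemma HW_split v : @HW k (W n.+1) r v ->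
  exists z v1, [/\ v = hlift c v1 + col_mx z 0, HW (r - 1) z & HW (r + 1) v1].
Proof. by move=> /HW_decomp[z h]; exists z, (dsubmx (v : 'cV_(d n + d n))). Qed.

(** By [HW_split] the highest weight vectors of W (n + 1) are the orthogonal sum of those
    of W n of weight r - 1 and of the lifts of those of weight r + 1, on which the
    form is a multiple of that of W n, by zero if and only if r + 2 = 0 in k. *)
Lemma Ddim_rec : Ddim n.+1 r = (Ddim n (r - 1)%R + ((r + 2%:Z)%:~R != 0%R :> k) * Ddim n (r + 1)%R)%N.
Proof.
have hd : hwdim n.+1 r = (hwdim n (r - 1) + hwdim n (r + 1))%N.
  apply: dim_slices; try exact: HW_subspace.
  - by move=> v; exact: HW_col0.
  - by move=> v hv; have [z []] := HW_decomp hv.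
  by move=> v1 h1; exists (- c *: (Fo n *m v1)); exact: (hlift_HW ec h1).
(* the condition on the e_1 component of a vector of the radical *)
pose Q v := if (r + 2%:Z)%:~R == 0 :> k then @HW k (W n) (r + 1) v else Rad (r + 1) v.
have sQ : subspace_pred Q by rewrite /Q; case: eqP => _; [exact: HW_subspace | exact: Rad_subspace].
have rd : raddim n.+1 r = (raddim n (r - 1) + \dim (vspace_of Q))%N.
  apply: dim_slices => //; try exact: Rad_subspace.
  - move=> v; split=> [[/(@HW_col0 k (W n)) h rv]|[h rv]]; split=> //.
    + move=> u hu; have := rv (col_mx u 0); rewrite dotp_col dotp0l addr0; apply.
      exact/(@HW_col0 k (W n)).
    + exact/(@HW_col0 k (W n)).
    move=> u hu; have [z [-> hz h1]] := HW_decomp hu.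
    by rewrite -[hlift c _]scale1r dotpDl dot_lift_col0 // mulr0 add0r dotp_col dotp0l addr0 rv.
  - move=> v [hv rv]; have [z [ev hz h1]] := HW_decomp hv.
    rewrite /Q; move: ev h1; move: (dsubmx _) => v1 ev h1; case: eqP => // ne; split=> // u hu.
    have := rv _ (hlift_HW ec hu); rewrite ev -[hlift c v1]scale1r dotpDr mul1r dot_lift_col0 // addr0.
    rewrite dot_lift_lift // => /eqP; rewrite mulf_eq0 => /orP[/eqP h0|/eqP //].
    case: ne; have : c * (r + 2%:Z)%:~R * (r + 1)%:~R = 0 :> k by rewrite h0 mul0r.
    by rewrite mulrAC ec mul1r.
  move=> v1 hv1; have h1 : HW (r + 1) v1 by move: hv1; rewrite /Q; case: eqP => // _ [].
  exists (- c *: (Fo n *m v1)); rewrite -/(hlift c v1); split; first exact: (hlift_HW ec h1).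
  move=> u hu; have [z [u1 [-> hz hu1]]] := HW_split hu.
  rewrite -[hlift c u1]scale1r dotpDl mul1r dot_lift_lift // [X in _ + X]dotpC dot_lift_col0 // addr0.
  move: hv1; rewrite /Q; case: eqP => [-> _|_ [_ ->]] //; by rewrite mulr0 ?mul0r.
rewrite /Ddim hd rd /Q.
have l0 := raddim_le n (r - 1); have l1 := raddim_le n (r + 1).
case: eqP => _ /=.
  by rewrite -/(hwdim n (r + 1)); lia.
by rewrite -/(raddim n (r + 1)); lia.
Qed.
End Recursion.
End Ops.

(** * Dimensions of the heads of the cell modules *)

Section CellHeads.
Variable k : fieldType.
Notation W := (W k).
Notation d n := (sldim (W n)).

Lemma dotpBl n (u v w : 'cV[k]_(d n)) : dotp (u - v) w = dotp u w - dotp v w.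
Proof. by rewrite addrC -scaleN1r dotpDl mulN1r addrC. Qed.
Lemma dotpBr n (u v w : 'cV[k]_(d n)) : dotp w (u - v) = dotp w u - dotp w v.
Proof. by rewrite dotpC dotpBl !(dotpC w). Qed.
Lemma dotpNl n (u w : 'cV[k]_(d n)) : dotp (- u) w = - dotp u w.
Proof. by rewrite -scaleN1r dotpZl mulN1r. Qed.
Lemma dotpNr n (u w : 'cV[k]_(d n)) : dotp w (- u) = - dotp w u.
Proof. by rewrite dotpC dotpNl dotpC. Qed.

(** The only half-diagram without cups is the identity. *)
Lemma HW_top m (v : 'cV[k]_(d m)) : HW m v -> exists c, v = c *: topvec k m.
Proof.
move=> h; have := HW_span h; move=> /(_ (fun v => exists c, v = c *: topvec k m)); apply.
  split=> [|c x y [a ->] [b ->]]; first by exists 0; rewrite scale0r.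
  by exists (c * a + b); rewrite scalerDl scalerA.
move=> {v h} x hx; exists 1; rewrite scale1r; case: (cupc_inv hx) => [[_ /is1_eq ->]|]; first by rewrite mul1mx.
case: m x hx => [|[|m]] // x hx [i [y [_ /cupc_le le _]]].
by move: le; lia.
Qed.

Lemma dotp_topvec m : dotp (topvec k m) (topvec k m) = 1.
Proof.
elim: m => [|m IH]; first by rewrite /dotp trmx1 mul1mx mxE.
by rewrite [topvec k m.+1]/= dotp_col IH dotp0l addr0.
Qed.

(** Two half-diagrams that compose to the identity up to a sign: cups at the first
    position against cups at the second, straightened by the zigzag relation.  The
    second position needs a through strand, that is m > 0. *)
Lemma cupc_pairing m j : ((0 < m) || (j == 0))%N ->
  exists x y, [/\ @cupc k m (m + 2 * j) x, @cupc k m (m + 2 * j) y &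
    exists2 s : k, s != 0 & y^T *m x = s%:M].
Proof.
elim: j => [|j IH] h.
  rewrite muln0 addn0; exists 1%:M, 1%:M; split; try exact: cupc_id.
  by exists 1; rewrite ?oner_eq0 // trmx1 mulmx1.
have [|x [y [hx hy [s s0 e]]]] := IH; first by move: h; lia.
have -> : (m + 2 * j.+1 = (m + 2 * j).+2)%N by lia.
exists (cup k 0 (m + 2 * j) *m x), (cup k 1 (m + 2 * j) *m y); split.
- by apply: cupc_cup.
- by apply: cupc_cup => //; move: h; lia.
exists (- s); first by rewrite oppr_eq0.
rewrite trmx_mul -mulmxA [X in _ *m X]mulmxA cap_cup_adj; last by move: h; lia.
by rewrite mulNmx mul1mx mulmxN e; apply/matrixP => a b; rewrite !mxE mulNrn.
Qed.

Lemma HW_pairing n m : m \in Lambda n -> ((0 < m) || (n == 0))%N ->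
  exists2 v, @HW k (W n) m v & ~ Rad m v.
Proof.
rewrite inE => /andP[le /eqP par] h.
have e : n = (m + 2 * ((n - m)./2))%N by move: le par; lia.
have h' : ((0 < m) || ((n - m)./2 == 0))%N by move: h; case: (0 < m)%N => //= /eqP ->.
have [x [y [hx hy [s s0 e1]]]] := cupc_pairing h'.
rewrite -e in x y hx hy e1; exists (x *m topvec k m).
  by apply: HW_hom (HW_topvec k m); exact: cupc_hom.
move=> [_ /(_ (y *m topvec k m))]; rewrite dotpMl mulmxA e1 mul_scalar_mx dotpZr dotp_topvec mulr1.
by move=> h1; move/eqP: s0; apply; apply: h1; apply: HW_hom (HW_topvec k m); exact: cupc_hom.
Qed.

Lemma tg_hom n i : (i.+1 < n)%N -> @SL2hom k (W n) (W n) (tg k n i).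
Proof.
case: n => [|[|n]] // le; have hc := @cup_hom k i n le.
exact: (SL2hom_comp hc (W_homT hc)).
Qed.

Lemma Rad_tg n r i v : (i.+1 < n)%N -> @Rad k n r v -> Rad r (tg k n i *m v).
Proof.
move=> le [h rv]; have ht := tg_hom le; split; first exact: HW_hom ht h.
move=> u hu; rewrite dotpC dotpMl tgT dotpC.
apply: rv; exact: HW_hom ht hu.
Qed.

(** Some half-diagram x satisfies (x e_0^m, v) <> 0, so x^T v is a nonzero multiple
    of e_0^m; then y x^T v is a multiple of y e_0^m for every half-diagram y. *)
Lemma alg_generates n m v w : @HW k (W n) (m : nat) v -> ~ Rad m v -> @HW k (W n) m w ->
  forall Q : 'cV[k]_(d n) -> Prop, subspace_pred Q -> (forall b, alg b -> Q (b *m v)) -> Q w.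
Proof.
move=> hv nr hw Q sQ hQ.
have [x hx nx] : exists2 x, @cupc k m n x & dotp (x *m topvec k m) v <> 0.
  apply: contrapT => ne; apply: nr; split=> // u hu; have := HW_span hu; move=> /(_ (fun u => dotp u v = 0)); apply.
    by split=> [|c a b]; rewrite ?dotp0l // dotpDl => -> ->; rewrite mulr0 addr0.
  by move=> x hx; apply: contrapT => ne'; apply: ne; exists x.
have [c ec] : exists c, x^T *m v = c *: topvec k m.
  by apply: HW_top; apply: HW_hom hv; apply: W_homT; exact: cupc_hom.
have c0 : c != 0.
  by apply/eqP => c0; apply: nx; rewrite dotpMl ec c0 scale0r dotp0r.
have := HW_span hw; move=> /(_ Q); apply=> // y hy.
have -> : y *m topvec k m = (c^-1 *: (y *m x^T)) *m v.
  by rewrite -scalemxAl -mulmxA ec -scalemxAr scalerA mulVf // scale1r.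
by apply: hQ; apply: alg_scale; apply: cupc_alg.
Qed.

Lemma fddim_Rad n m : m \in Lambda n -> ((0 < m) || (n == 0))%N ->
  fddim (simple_module k n m) = Ddim k n m.
Proof.
move=> L h; apply: cell_head.
- exact: Rad_subspace.
- by move=> v [].
- by move=> i v; exact: Rad_tg.
- move=> v w hv nr hw; have := alg_generates hv nr hw; move=> /(_ (fun w => exists a, w = opW a *m v)); apply.
    split=> [|c x y [a ->] [b ->]]; first by exists (- (1) *: 1 + 1); rewrite opWP scaleN1r addNr mul0mx.
    by exists (c *: a + b); rewrite opWP mulmxDl scalemxAl.
  by move=> b /alg_opW[a <-]; exists a.
exact: HW_pairing.
Qed.

(** A highest weight vector of weight 0 is invariant, because all half-diagrams with no
    through strand are. *)
Lemma HW0_F n (v : 'cV[k]_(d n)) : @HW k (W n) 0 v -> Fo k n *m v = 0.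
Proof.
move=> h; have := @HW_span k n 0 v h; move=> /(_ (fun v => Fo k n *m v = 0)); apply.
  by split=> [|c a b]; rewrite ?mulmx0 // mulmxDr -scalemxAr => -> ->; rewrite scaler0 addr0.
move=> x hx; rewrite mulmxA; have := @Fc_hom k _ _ _ 1%N (cupc_hom hx).
by rewrite -/(Fo k n) -/(Fo k 0) Fo_0 mulmx0 => <-; rewrite mul0mx.
Qed.

Lemma HW0_dsub n (v : 'cV[k]_(d n + d n)) : @HW k (W n.+1) 0 v -> HW 1 (dsubmx v : 'cV_(d n)).
Proof. by move=> h; apply: (@HW_col1 k (W n) 0 (usubmx v)); rewrite vsubmxK. Qed.

Lemma HW0_inj n (v : 'cV[k]_(d n + d n)) : @HW k (W n.+1) 0 v -> dsubmx v = 0 -> v = 0.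
Proof.
move=> h e; have ev : v = col_mx (usubmx v) 0 by rewrite -{1}[v]vsubmxK e.
move: h; rewrite ev => /(@HW_col0 k (W n)) /HW_neg -> //; by rewrite col_mx0.
Qed.

(** For m = 0 the form on highest weight vectors is twice the form on their e_1
    components, hence zero if p = 2; the latter form is used instead.  The e_1
    component determines the vector because no highest weight is negative. *)
Definition Rad0 n (v : 'cV[k]_(d n + d n)) := @HW k (W n.+1) 0 v /\ Rad 1 (dsubmx v : 'cV_(d n)).

Lemma Rad0_subspace n : subspace_pred (@Rad0 n).
Proof.
have [h0 hl] := @HW_subspace k (W n.+1) 0; have [r0 rl] := @Rad_subspace k n 1.
split=> [|c x y [hx rx] [hy ry]]; first by split=> //; rewrite linear0.
by split; [apply: hl | rewrite linearP; apply: rl].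
Qed.

(** From E v = F v = 0 one gets C = - E A - B and A + F B = 0, which makes the pairing
    of B with C symmetric, as E and F are adjoint. *)
Lemma HW0_pairing n (A B C D A' B' C' D' : 'cV[k]_(d n)) :
  @HW k (W n.+2) 0 (col_mx (col_mx A B) (col_mx C D)) ->
  @HW k (W n.+2) 0 (col_mx (col_mx A' B') (col_mx C' D')) -> dotp C B' = dotp B C'.
Proof.
have eqs (a b c e : 'cV[k]_(d n)) : @HW k (W n.+2) 0 (col_mx (col_mx a b) (col_mx c e)) ->
    c = - (Eo k n *m a) - b /\ Fo k n *m b = - a.
  move=> h; have eF := HW0_F h; have eE := upfix_E h.2; move: eE eF.
  rewrite !Eo_S !Fo_S !(mul_block_col, mul0mx, mul1mx, add0r, addr0, add_col_mx).
  rewrite -!col_mx0 => /eq_col_mx[/eq_col_mx[e1 _] _] /eq_col_mx[/eq_col_mx[_ e2] _].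
  split; last by apply/eqP; rewrite -addr_eq0 addrC e2.
  by apply/eqP; rewrite -opprD -addr_eq0 addrC e1.
have symE u v : dotp (Eo k n *m u) v = dotp u (Fo k n *m v) by rewrite dotpMl Eo_T.
move=> /eqs[-> eA] /eqs[-> eA']; rewrite dotpBl dotpBr !dotpNl !dotpNr symE eA'.
have -> : dotp B (Eo k n *m A') = dotp A' (Fo k n *m B) by rewrite dotpC symE.
by rewrite eA !dotpNr (dotpC A').
Qed.

Lemma tg0_dsub n (v : 'cV[k]_(d n.+1 + d n.+1)) A B C D : v = col_mx (col_mx A B) (col_mx C D) ->
  dsubmx (tg k n.+2 0 *m v) = col_mx (C - B) 0.
Proof.
move=> ->; rewrite /tg -mulmxA /cup !tr_col_mx !mul_row_col linearN /= !trmx0 !trmx1.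
rewrite !mul0mx mul1mx mulNmx mul1mx add0r addr0 !mul_col_mx col_mxKd.
by rewrite mulNmx mul0mx mul1mx opprB.
Qed.

(** The first generator is self-adjoint for the form on the e_1 components; the other
    generators act on these components directly. *)
Lemma HW0_tg0 n (v w : 'cV[k]_(d n.+1 + d n.+1)) : @HW k (W n.+2) 0 v -> @HW k (W n.+2) 0 w ->
  @dotp k n.+1 (dsubmx w) (dsubmx (tg k n.+2 0 *m v)) = @dotp k n.+1 (dsubmx (tg k n.+2 0 *m w)) (dsubmx v).
Proof.
have split4 (x : 'cV[k]_(d n.+1 + d n.+1)) : exists A B C D : 'cV_(d n), x = col_mx (col_mx A B) (col_mx C D).
  rewrite -[x]vsubmxK; move: (usubmx x) (dsubmx x) => x0 x1.
  exists (usubmx (x0 : 'cV_(d n + d n))), (dsubmx (x0 : 'cV_(d n + d n))).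
  exists (usubmx (x1 : 'cV_(d n + d n))), (dsubmx (x1 : 'cV_(d n + d n))).
  by rewrite !vsubmxK.
have [A [B [C [D ev]]]] := split4 v; have [A' [B' [C' [D' ew]]]] := split4 w.
rewrite (tg0_dsub ev) (tg0_dsub ew) ev ew !col_mxKd => hv hw.
rewrite !dotp_col dotp0l dotp0r !addr0 dotpBl dotpBr.
by rewrite (HW0_pairing hw hv).
Qed.

Lemma fddim_zero n : ~~ odd n -> fddim (simple_module k n.+2 0) = Ddim k n.+1 1.
Proof.
move=> en; have c1 : 1 * (0 + 1)%:~R = 1 :> k by rewrite add0r mul1r.
have hlin : subspace_pred (@HW k (W n.+2) 0) by exact: HW_subspace.
have lift1 (v1 : 'cV_(d n.+1)) : HW 1 v1 -> @HW k (W n.+2) 0 (hlift 1 v1).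
  by move=> h; apply: hlift_HW; rewrite ?add0r.
rewrite (@cell_head k n.+2 0 (@Rad0 n.+1)) /Ddim.
-
  (* no highest weight is negative, so passing to the e_1 component is injective *)
  have dim0 (P : 'cV_(d n.+1 + d n.+1) -> Prop) Q1 : subspace_pred P -> subspace_pred Q1 ->
    (forall v, P v -> @HW k (W n.+2) 0 v) -> (forall v, P v -> Q1 (dsubmx v)) ->
    (forall v1, Q1 v1 -> exists v0, P (col_mx v0 v1)) -> \dim (vspace_of P) = \dim (vspace_of Q1).
    move=> sP sQ h1 h2 h3; rewrite (dim_slices (Q0 := fun v => v = 0) sP _ sQ _ h2 h3).
    + have -> : vspace_of (fun v : 'cV[k]_(d n.+1) => v = 0) = 0%VS; last by rewrite dimv0.
      have s0 : subspace_pred (fun v : 'cV[k]_(d n.+1) => v = 0).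
        by split=> // c x y -> ->; rewrite scaler0 addr0.
      apply/vspaceP => v; apply/idP/idP; rewrite memv0 => h; last by apply/(mem_vspace_of s0)/eqP.
      exact/eqP/(mem_vspace_of s0).
    + by split=> // c x y -> ->; rewrite scaler0 addr0.
    move=> v; split=> [/h1/(@HW_col0 k (W n.+1))/HW_neg ->|->] //; rewrite col_mx0; exact: sP.1.
  congr (_ - _)%N; apply: dim0; try exact: HW_subspace; try exact: Rad_subspace; try exact: Rad0_subspace.
  + by [].
  + by move=> v; exact: HW0_dsub.
  + by move=> v1 /lift1 h; exists (- 1 *: (Fo k n.+1 *m v1)).
  + by move=> v [].
  + by move=> v [].
  move=> v1 r1; exists (- 1 *: (Fo k n.+1 *m v1)); split; first exact: lift1 r1.1.
  by rewrite col_mxKd.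
- exact: Rad0_subspace.
- by move=> v [].
- move=> [|i] v le [h r]; (split; first exact: HW_hom (tg_hom le) h).
    split; first by apply: (@HW0_dsub n.+1); exact: HW_hom (tg_hom le) h.
    move=> u /lift1 hu; have := HW0_tg0 h hu; rewrite col_mxKd => ->.
    rewrite dotpC dotpC; apply: r.2; apply: (@HW0_dsub n.+1); exact: HW_hom (tg_hom le) hu.
  rewrite -tg_dg2 // -[v]vsubmxK dg2_col col_mxKd; exact: Rad_tg.
- move=> v w hv nr hw; have nr1 : ~ @Rad k n.+1 1 (dsubmx v) by move=> h; apply: nr.
  have [a ea] : exists a, dsubmx w = dsubmx (opW a *m v).
    have := @alg_generates n.+1 1 _ _ (@HW0_dsub n.+1 v hv) nr1 (@HW0_dsub n.+1 w hw).
    move=> /(_ (fun w1 => exists a, w1 = dsubmx (opW a *m v))); apply.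
      split=> [|c x y [a ->] [b ->]]; first by exists (- (1) *: 1 + 1); rewrite opWP scaleN1r addNr mul0mx linear0.
      by exists (c *: a + b); rewrite opWP mulmxDl -scalemxAl linearP.
    move=> b /alg_dg2/alg_opW[a ea]; exists a.
    by rewrite ea -[v in RHS]vsubmxK dg2_col col_mxKd.
  exists a; apply/eqP; rewrite -subr_eq0; apply/eqP/(@HW0_inj n.+1); last by rewrite linearB /= ea subrr.
  rewrite -scaleN1r addrC; apply: hlin.2 => //.
  have := @opW_stable k n.+2 (@HW k (W n.+2) 0) hlin; apply=> // i u le; apply: HW_hom; exact: tg_hom.
have [||v hv nv] := @HW_pairing n.+1 1; first (by rewrite inE /= en); first by [].
exists (hlift 1 v); first exact: lift1.
by move=> [_]; rewrite col_mxKd.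
Qed.
End CellHeads.

(** * Frobenius twist tensored with the Steinberg module *)

Section TensorLemmas.
Lemma tens11 (R : comPzRingType) m n : (1%:M : 'M[R]_m) *t (1%:M : 'M[R]_n) = 1%:M.
Proof.
apply/matrixP=> i j; case: (mxtens_indexP i) => a b; case: (mxtens_indexP j) => c d.
rewrite tensmxE !mxE -natrM mulnb (inj_eq (can_inj (@mxtens_indexK m n))) xpair_eqE //.
Qed.
Lemma tensmxDl (R : comPzRingType) m n p q (A B : 'M[R]_(m, n)) (C : 'M[R]_(p, q)) :
  (A + B) *t C = A *t C + B *t C.
Proof. by apply/matrixP=> i j; rewrite !mxE mulrDl. Qed.
Lemma tensmxZl (R : comPzRingType) m n p q c (A : 'M[R]_(m, n)) (C : 'M[R]_(p, q)) :
  (c *: A) *t C = c *: (A *t C).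
Proof. by apply/matrixP=> i j; rewrite !mxE mulrA. Qed.
Lemma ext_tens (k : fieldType) (A : comAlgType k) m n p q (X : 'M[k]_(m, n)) (Y : 'M[k]_(p, q)) :
  ext A (X *t Y) = ext A X *t ext A Y.
Proof. exact: map_mxT. Qed.
End TensorLemmas.

Section Iso.
Variable k : fieldType.
Implicit Types M N Q : SL2mod k.

Lemma iso_of_entries M N (e : sldim M = sldim N) :
  (forall (A : comAlgType k) (g : 'M[A]_2) i j, slact M g i j = slact N g (cast_ord e i) (cast_ord e j)) ->
  SL2iso M N.
Proof.
move=> h; pose X : 'M[k]_(sldim N, sldim M) := \matrix_(i, j) (i == cast_ord e j)%:R.
have mulX (A : comAlgType k) n (B : 'M[A]_(_, n)) i j : (ext A X *m B) i j = B (cast_ord (esym e) i) j.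
  rewrite mxE (bigD1 (cast_ord (esym e) i)) //= big1 => [|l nl].
    by rewrite !mxE cast_ordKV eqxx rmorph1 mul1r addr0.
  rewrite !mxE; case: eqP => [el|_]; last by rewrite rmorph0 mul0r.
  by case/eqP: nl; rewrite el cast_ordK.
have Xmul (A : comAlgType k) n (B : 'M[A]_(n, _)) i j : (B *m ext A X) i j = B i (cast_ord e j).
  rewrite mxE (bigD1 (cast_ord e j)) //= big1 => [|l nl].
    by rewrite !mxE eqxx rmorph1 mulr1 addr0.
  rewrite !mxE; case: eqP => [el|_]; last by rewrite rmorph0 mulr0.
  by case/eqP: nl.
have XXt : X *m X^T = 1%:M.
  apply/matrixP=> i j; rewrite mxE (bigD1 (cast_ord (esym e) i)) //= big1 => [|l nl].
    by rewrite !mxE cast_ordKV eqxx mul1r addr0 eq_sym.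
  rewrite !mxE; case: eqP => [el|_]; last by rewrite mul0r.
  by case/eqP: nl; rewrite el cast_ordK.
have XtX : X^T *m X = 1%:M.
  apply/matrixP=> i j; rewrite mxE (bigD1 (cast_ord e i)) //= big1 => [|l nl].
    by rewrite !mxE eqxx mul1r addr0 (inj_eq (@cast_ord_inj _ _ e)).
  rewrite !mxE; case: eqP => [el|_]; last by rewrite mul0r.
  by case/eqP: nl.
have hX : @SL2hom k M N X.
  by move=> A g _; apply/matrixP=> i j; rewrite mulX Xmul h cast_ordKV.
by exists X, X^T; split=> //; apply: hom_inv XtX XXt.
Qed.

Lemma exact_iso M' M Q Q' i q X Y : @short_exact k M' M Q i q ->
  @SL2hom k Q Q' X -> X *m Y = 1%:M -> Y *m X = 1%:M -> short_exact i (X *m q : 'M_(sldim Q', sldim M)).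
Proof.
move=> [hi hq inj sur ex] hX XY YX; split=> //.
- exact: SL2hom_comp hX hq.
- move=> w; have [v ev] := sur (Y *m w); exists v; by rewrite -mulmxA -ev mulmxA XY mul1mx.
move=> v; rewrite -ex -mulmxA; split=> [h|->]; last by rewrite mulmx0.
by rewrite -[q *m v]mul1mx -YX -mulmxA h mulmx0.
Qed.

(** Linear splittings of a short exact sequence, in the form of identities that
    survive tensoring. *)
Lemma exact_retract M' M Q i q : @short_exact k M' M Q i q ->
  exists i' r, [/\ i' *m i = 1%:M, q *m r = 1%:M & 1%:M - r *m q = i *m (i' *m (1%:M - r *m q))].
Proof.
move=> ex; have [hi hq inj sur _] := ex; have [i' i'i ker] := exact_split ex.
have [r qr] : exists r, q *m r = 1%:M.
  have h j : exists v, q *m v = delta_mx j (0 : 'I_1) by have [v ev] := sur (delta_mx j 0); exists v.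
  pose c j := projT1 (cid (h j)); exists (\matrix_(a, j) c j a 0).
  apply/matrixP=> a j; have := projT2 (cid (h j)); rewrite -/(c j) => /matrixP/(_ a 0).
  rewrite !mxE eqxx andbT => <-; by apply: eq_bigr => l _; rewrite mxE.
exists i', r; split=> //; apply: ker; by rewrite mulmxBr mulmx1 mulmxA qr mul1mx subrr.
Qed.
End Iso.

Section Twist.
Variables (k : fieldType) (p : nat).
Hypothesis charkp : p \in [pchar k].
Implicit Types M N : SL2mod k.
Notation St := (Weyl k p.-1).

Lemma p_gt1 : (1 < p)%N. Proof. exact: prime_gt1 (pcharf_prime charkp). Qed.
Lemma p_pred : p.-1.+1 = p. Proof. by rewrite prednK // ltnW // p_gt1. Qed.
Lemma charA (A : comAlgType k) : p \in [pchar A]. Proof. by rewrite pchar_lalg. Qed.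

(** The Frobenius endomorphism of SL_2.  Twisting the group element instead of the
    entries of its action leaves matrices of homomorphisms unchanged, although
    Frobenius is not k-linear. *)
Definition fr (A : comAlgType k) (g : 'M[A]_2) : 'M[A]_2 := map_mx (pFrobenius_aut (charA A)) g.
Lemma fr1 (A : comAlgType k) : fr (1%:M : 'M[A]_2) = 1%:M. Proof. exact: map_mx1. Qed.
Lemma frM (A : comAlgType k) (g h : 'M[A]_2) : fr (g *m h) = fr g *m fr h.
Proof. exact: map_mxM. Qed.
Lemma det_fr (A : comAlgType k) (g : 'M[A]_2) : \det g = 1 -> \det (fr g) = 1.
Proof. by move=> dg; rewrite det_map_mx dg rmorph1. Qed.
Lemma fr_nat (A B : comAlgType k) (f : {lrmorphism A -> B}) (g : 'M[A]_2) : map_mx f (fr g) = fr (map_mx f g).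
Proof. by apply/matrixP=> i j; rewrite !mxE !pFrobenius_autE rmorphXn. Qed.
Lemma frE (A : comAlgType k) (g : 'M[A]_2) i j : fr g i j = g i j ^+ p.
Proof. by rewrite mxE pFrobenius_autE. Qed.

Section Def.
Variable M : SL2mod k.
(** The factor of the Steinberg module comes second, so that the index of a tensor is
    written in base p. *)
Definition tw_act (A : comAlgType k) (g : 'M[A]_2) : 'M[A]_(sldim M * sldim St) :=
  slact M (fr g) *t slact St g.
Lemma tw_act1 (A : comAlgType k) : tw_act (1%:M : 'M[A]_2) = 1%:M.
Proof. by rewrite /tw_act fr1 !slact1; exact: tens11. Qed.
Lemma tw_actM (A : comAlgType k) (g h : 'M[A]_2) : \det g = 1 -> \det h = 1 ->
  tw_act (g *m h) = tw_act g *m tw_act h.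
Proof. by move=> dg dh; rewrite /tw_act frM !slactM ?det_fr // tensmx_mul. Qed.
Lemma tw_act_nat (A B : comAlgType k) (f : {lrmorphism A -> B}) (g : 'M[A]_2) :
  \det g = 1 -> map_mx f (tw_act g) = tw_act (map_mx f g).
Proof.
move=> dg; rewrite /tw_act map_mxT !slact_nat ?det_fr // fr_nat //.
Qed.
Definition tw : SL2mod k := SL2Mod tw_act1 tw_actM tw_act_nat.
End Def.

Notation one := (1%:M : 'M[k]_(sldim St)).
Lemma tw_hom M N X : @SL2hom k M N X -> @SL2hom k (tw M) (tw N) (X *t one).
Proof.
move=> hX A g dg; rewrite /= /tw_act ext_tens !tensmx_mul hX ?det_fr //.
by rewrite ext1 mul1mx mulmx1.
Qed.

Lemma tw_exact M' M Q i q : @short_exact k M' M Q i q ->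
  @short_exact k (tw M') (tw M) (tw Q) (i *t one) (q *t one).
Proof.
move=> ex; have [hi hq _ _ _] := ex; have [i' [r [i'i qr e]]] := exact_retract ex.
split; try exact: tw_hom.
- move=> u v /(congr1 (mulmx (i' *t one))); rewrite !mulmxA !tensmx_mul i'i mulmx1.
  by rewrite tens11 !mul1mx.
- by move=> w; exists ((r *t one) *m w); rewrite mulmxA tensmx_mul qr mulmx1 tens11 mul1mx.
move=> v; split=> [h|[u ->]]; last by rewrite mulmxA tensmx_mul (exact_comp0 ex) tens0mx mul0mx.
exists ((i' *m (1%:M - r *m q)) *t one *m v); rewrite mulmxA tensmx_mul -e mulmx1.
have -> : (1%:M - r *m q) *t one = 1%:M - (r *t one) *m (q *t one).
  rewrite tensmx_mul mulmx1 -scaleN1r tensmxDl tensmxZl scaleN1r; congr (_ - _); exact: tens11.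
by rewrite mulmxBl mul1mx -mulmxA h mulmx0 subr0.
Qed.

(** In characteristic p the p-th power of a linear form is the Frobenius twist of the
    form evaluated at X^p. *)
Lemma wrow_tw (A : comAlgType k) q (g : 'M[A]_2) i1 i2 : (i1 <= q)%N -> (i2 <= p.-1)%N ->
  wrow (p * q + p.-1) g (i1 * p.-1.+1 + i2) = wrow p.-1 g i2 * (wrow q (fr g) i1 \Po 'X^p).
Proof.
move=> l1 l2; have cp : p \in [pchar {poly A}] by rewrite pchar_poly; exact: charA.
have linp (c a : A) : (c%:P + a *: 'X) ^+ p = (c ^+ p)%:P + a ^+ p *: 'X^p.
  rewrite -!(pFrobenius_autE cp) rmorphD /= !pFrobenius_autE -polyC_exp.
  by rewrite exprZn.
rewrite /wrow rmorphM /= !rmorphXn /= !(rmorphB, rmorphD, rmorphN) /= !comp_polyC.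
rewrite !linearZ /= !comp_polyX !frE !scalerN -!scaleNr.
have hN (x : A) : - (x ^+ p) = (- x) ^+ p.
  by rewrite -!(pFrobenius_autE (charA A)) rmorphN.
rewrite -!polyCN !hN -!linp -!exprM mulrACA -!exprD p_pred.
congr (_ ^+ _ * _ ^+ _); last by lia.
have := p_gt1; move: l1 l2; nia.
Qed.

(** As P has degree less than p, the coefficients of P(X) Q(X^p) are read off from base
    p digits. *)
Lemma coef_twist (A : comNzRingType) (P Q : {poly A}) j1 j2 : (size P <= p)%N -> (j2 < p)%N ->
  (P * (Q \Po 'X^p))`_(j1 * p + j2) = Q`_j1 * P`_j2.
Proof.
move=> sP l2; have p0 : (0 < p)%N by apply: ltnW p_gt1.
have lt : (j2 < (j1 * p + j2).+1)%N by lia.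
rewrite coefM (bigD1 (Ordinal lt)) //= big1 => [|l nl].
  by rewrite addnK addr0 coef_comp_poly_Xn // dvdn_mull // mulnK // mulrC.
rewrite coef_comp_poly_Xn //; case: ifP => [dv|]; last by rewrite mulr0.
case: (ltnP l p) => [lp|pl]; last by rewrite nth_default ?mul0r // (leq_trans sP).
case/eqP: nl; apply: val_inj => /=; move: dv => /dvdnP[c ec].
have ll := ltn_ord l; have : (j1 * p + j2 = c * p + l)%N by lia.
by move/eqP; rewrite eq_addl_mul // xpair_eqE => /andP[_ /eqP].
Qed.

(** The twist of Delta(q) is Delta(p q + p - 1): a product of q factors X^p and p - 1
    factors X, read off in base p. *)
Lemma tw_weyl q : SL2iso (tw (Weyl k q)) (Weyl k (p * q + p.-1)).
Proof.
have e : sldim (tw (Weyl k q)) = sldim (Weyl k (p * q + p.-1)) by rewrite /= p_pred; have := p_gt1; lia.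
apply: (iso_of_entries (e := e)) => A g i j.
case: (mxtens_indexP i) => i1 i2; case: (mxtens_indexP j) => j1 j2.
have l1 : (i1 <= q)%N by have := ltn_ord i1.
have l2 : (i2 <= p.-1)%N by have := ltn_ord i2.
rewrite /= /tw_act tensmxE weylE weylE weylE.
have := wrow_tw g l1 l2. rewrite /= => ->; rewrite -coef_twist ?[in (_ * p.-1.+1)%N]p_pred //.
- by apply: (leq_trans (size_wrow g l2)); rewrite p_pred.
by apply: (leq_trans (ltn_ord j2)); rewrite /= p_pred.
Qed.

Lemma weyl_filtration_tw M ws : weyl_filtration M ws ->
  weyl_filtration (tw M) [seq p * q + p.-1 | q <- ws]%N.
Proof.
elim=> [{}M e|M' {}M s {}ws i q ex _ IH]; first by apply: WeylNil; rewrite /= e.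
have [X [Y [hX hY XY YX]]] := tw_weyl s.
exact: (WeylCons (exact_iso (tw_exact ex) hX XY YX) IH).
Qed.
End Twist.

(** * The twist is fully faithful *)

(** The binomial formula for one coefficient; the truncated exponent n - l is harmless
    since the binomial coefficient vanishes for l > n. *)
Lemma coef_linX (A : comNzRingType) (a c : A) n l :
  ((a%:P + c *: 'X) ^+ n)`_l = a ^+ (n - l) * c ^+ l *+ 'C(n, l).
Proof.
rewrite exprDn coef_sum.
have term (i : 'I_n.+1) : (a%:P ^+ (n - i) * (c *: 'X) ^+ i *+ 'C(n, i))`_l =
    (l == i)%:R * (a ^+ (n - i) * c ^+ i *+ 'C(n, i)).
  by rewrite coefMn exprZn -polyC_exp -scalerAr coefZ coefCM coefXn mulrCA mulrA mulr_natr mulrnAC mulr_natl mulrnAC mulrC.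
under eq_bigr => i _ do rewrite term.
case: (ltnP l n.+1) => h; last first.
  rewrite bin_small // mulr0n big1 // => i _.
  by rewrite (_ : (l == i) = false) ?mul0r //; have := ltn_ord i; lia.
rewrite (bigD1 (Ordinal h)) //= eqxx mul1r big1 ?addr0 // => i ni.
rewrite (_ : (l == i) = false) ?mul0r //; apply/negbTE; rewrite eq_sym; exact: ni.
Qed.

Lemma big_tens (V : nmodType) m n (F : 'I_(m * n) -> V) :
  \sum_l F l = \sum_a \sum_i F (mxtens_index (a, i)).
Proof.
rewrite pair_big /= (reindex (@mxtens_index m n)) /=.
  by apply: eq_bigr => [[a i]].
by exists (@mxtens_unindex m n) => x _; rewrite ?mxtens_indexK ?mxtens_unindexK.
Qed.

(** The block of a matrix between tensor products at given indices of the first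
    factors. *)
Definition tblock (R : comNzRingType) m n q (Z : 'M[R]_(m * q, n * q)) a b : 'M[R]_q :=
  \matrix_(i, j) Z (mxtens_index (a, i)) (mxtens_index (b, j)).
Lemma tblock_mulr (R : comNzRingType) m n q (Z : 'M[R]_(m * q, n * q)) (B : 'M_q) a b :
  tblock (Z *m (1%:M *t B)) a b = tblock Z a b *m B.
Proof.
apply/matrixP=> i j; rewrite !mxE big_tens (bigD1 b) //= [X in _ + X]big1 ?addr0 => [|c nc].
  by apply: eq_bigr => l _; rewrite tensmxE !mxE eqxx mul1r.
by apply: big1 => l _; rewrite tensmxE mxE (negbTE nc) mul0r mulr0.
Qed.
Lemma tblock_mull (R : comNzRingType) m n q (Z : 'M[R]_(m * q, n * q)) (B : 'M_q) a b :
  tblock ((1%:M *t B) *m Z) a b = B *m tblock Z a b.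
Proof.
apply/matrixP=> i j; rewrite !mxE big_tens (bigD1 a) //= [X in _ + X]big1 ?addr0 => [|c nc].
  by apply: eq_bigr => l _; rewrite tensmxE !mxE eqxx mul1r.
by apply: big1 => l _; rewrite tensmxE mxE eq_sym (negbTE nc) mul0r mul0r.
Qed.
Lemma tblockP (R : comNzRingType) m n q (Z : 'M[R]_(m * q, n * q)) (Y : 'M[R]_(m, n)) :
  (forall a b, tblock Z a b = (Y a b)%:M) -> Z = Y *t 1%:M.
Proof.
move=> h; apply/matrixP=> i j; case: (mxtens_indexP i) => a i'; case: (mxtens_indexP j) => b j'.
by rewrite tensmxE; have /matrixP/(_ i' j') := h a b; rewrite !mxE => ->; rewrite mulr_natr.
Qed.

Section Full.
Variables (k : fieldType) (p : nat).
Hypothesis charkp : p \in [pchar k].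
Implicit Types M N : SL2mod k.
Notation St := (Weyl k p.-1).
Notation tw := (tw charkp).

Lemma St_E (i j : 'I_p.-1.+1) : Ec St 1 i j = - (j.+1 == i)%:R * i%:R.
Proof.
rewrite /Ec mxE weylE /wrow !mxE /= scale0r subr0 -[(1%:P)]/(1 : {poly {poly k}}) expr1n mul1r.
rewrite -polyCN coef_linX expr1n mulr1 /= coefMn.
case: (ltngtP j.+1 i) => h.
- rewrite exprNn -signr_odd; have -> : ((-1) ^+ odd (i - j) * 'X ^+ (i - j))`_1 = 0 :> k.
    by case: odd; rewrite ?expr0 ?expr1 ?mul1r ?mulN1r ?coefN coefXn; case: eqP; rewrite ?oppr0 //; lia.
  by rewrite mul0rn /= oppr0 mul0r.
- case: (ltngtP i j) => h'; [by rewrite bin_small // mulr0n oppr0 mul0r | by lia | ].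
  by rewrite (_ : (i - j = 0)%N) ?expr0 ?coef1 ?mul0rn ?oppr0 ?mul0r //; lia.
rewrite -h subSnn expr1 coefN coefX binSn /=. by rewrite mulN1r mulNrn.
Qed.

Lemma St_F (i j : 'I_p.-1.+1) : Fc St 1 i j = - (i.+1 == j)%:R * (p.-1 - i)%:R.
Proof.
rewrite /Fc mxE weylE /wrow !mxE /= oppr0 add0r scale1r -scaleNr coefMXn.
case: ltnP => h.
  have -> : (i.+1 == j :> nat) = false by lia.
  by rewrite /= coef0 oppr0 mul0r.
rewrite coef_linX expr1n mul1r exprNn -signr_odd coefMn.
case: (eqVneq i.+1 (j : nat)) => [e|ne].
  by rewrite -e subSnn expr1 expr1 mulN1r coefN coefX bin1 mulNrn mulN1r.
have -> : ((-1) ^+ odd (j - i) * 'X ^+ (j - i))`_1 = 0 :> k.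
  by case: odd; rewrite ?expr0 ?expr1 ?mul1r ?mulN1r ?coefN coefXn; case: eqP; rewrite ?oppr0 //; lia.
by rewrite mul0rn oppr0 mul0r.
Qed.

Lemma small_neq0 i : (0 < i < p)%N -> i%:R != 0 :> k.
Proof.
move=> /andP[i0 ip]; rewrite -(dvdn_pcharf charkp); apply/negP => /dvdn_leq; lia.
Qed.

(** The Steinberg module is absolutely simple already under E and F: all structure
    constants i and p - 1 - i that occur are nonzero modulo p, so that a commuting
    matrix is upper and lower triangular with constant diagonal. *)
Lemma St_scalar (B : 'M[k]_(p.-1.+1)) :
  B *m Ec St 1 = Ec St 1 *m B -> B *m Fc St 1 = Fc St 1 *m B -> B = (B 0 0)%:M.
Proof.
have pp := p_pred charkp; set m := p.-1 in B pp *.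
have SE (i j : 'I_m.+1) : Ec (Weyl k m) 1 i j = - (j.+1 == i :> nat)%:R * (i : nat)%:R by exact: St_E.
have SF (i j : 'I_m.+1) : Fc (Weyl k m) 1 i j = - (i.+1 == j :> nat)%:R * (m - i)%:R by exact: St_F.
move: (Ec _ _) (Fc _ _) SE SF => EE FF SE SF hE hF; pose b i j := B (inord i) (inord j).
have relE i j : (i <= m)%N -> (j < m)%N -> j.+1%:R * b i j.+1 = if i is i'.+1 then i%:R * b i' j else 0.
  move=> li lj; have /matrixP/(_ (inord i) (inord j)) := hE; rewrite !mxE.
  rewrite (bigD1 (inord j.+1)) //= big1 ?addr0 => [|l nl]; last first.
    rewrite SE (_ : (_ == _) = false) ?oppr0 ?mul0r ?mulr0 //; apply/negbTE; apply: contra nl => /eqP e.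
    by apply/eqP/val_inj; rewrite /= inordK -?e ?inordK //; lia.
  rewrite SE !inordK; try lia; rewrite eqxx mulN1r mulrN mulrC -/(b i j.+1) => e; apply: (can_inj opprK).
  rewrite e; case: i li {e} => [|i] li.
    rewrite big1 ?oppr0 // => l _; rewrite SE inordK //= oppr0 !mul0r //.
  rewrite (bigD1 (inord i)) //= big1 ?addr0 => [|l nl]; last first.
    rewrite SE (_ : (_ == _) = false) ?oppr0 ?mul0r ?mul0r //; apply/negbTE; apply: contra nl => /eqP e.
    by apply/eqP/val_inj; move: e; rewrite /= !inordK //; lia.
  by rewrite SE !inordK; try lia; rewrite eqxx mulN1r mulNr.
have relF i j : (i <= m)%N -> (j < m)%N -> (m - j)%:R * b i j = if (i < m)%N then (m - i)%:R * b i.+1 j.+1 else 0.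
  move=> li lj; have /matrixP/(_ (inord i) (inord j.+1)) := hF; rewrite !mxE.
  rewrite (bigD1 (inord j)) //= big1 ?addr0 => [|l nl]; last first.
    rewrite SF (_ : (_ == _) = false) ?oppr0 ?mul0r ?mulr0 //; apply/negbTE; apply: contra nl => /eqP e.
    by apply/eqP/val_inj; move: e; rewrite /= !inordK //; lia.
  rewrite SF !inordK; try lia; rewrite eqxx mulN1r mulrN mulrC -/(b i j) => e; apply: (can_inj opprK).
  rewrite e; case: ltnP => lt.
    rewrite (bigD1 (inord i.+1)) //= big1 ?addr0 => [|l nl]; last first.
      rewrite SF (_ : (_ == _) = false) ?oppr0 ?mul0r ?mul0r //; apply/negbTE; apply: contra nl => /eqP e'.
      by apply/eqP/val_inj; move: e'; rewrite /= !inordK //; lia.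
    by rewrite SF !inordK; try lia; rewrite eqxx mulN1r mulNr.
  rewrite big1 ?oppr0 // => l _; rewrite SF inordK // (_ : (_ == _) = false) ?oppr0 ?mul0r ?mul0r //.
  by have := ltn_ord l; lia.
have up0 i j : (i < j)%N -> (j <= m)%N -> b i j = 0.
  elim: i j => [|i IH] [|j] // ij jm.
    by have := relE 0%N j isT jm => /eqP; rewrite mulf_eq0 (negbTE (small_neq0 _)) => [/eqP //|]; lia.
  have := relE i.+1 j; rewrite IH //; last by lia.
  by rewrite mulr0 => /(_ _ jm) h; have /eqP := h ltac:(lia); rewrite mulf_eq0 (negbTE (small_neq0 _)) => [/eqP //|]; lia.
have lo0 i j : (j < i)%N -> (i <= m)%N -> b i j = 0.
  move=> ji im; move: {2}(m - i)%N (erefl (m - i)%N) => t; elim: t i j ji im => [|t IH] i j ji im et.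
    have := relF i j im ltac:(lia); rewrite (_ : (i < m)%N = false); last by lia.
    by move/eqP; rewrite mulf_eq0 (negbTE (small_neq0 _)) => [/eqP //|]; lia.
  have := relF i j im ltac:(lia); rewrite (_ : (i < m)%N); last by lia.
  rewrite (IH i.+1 j.+1); try lia; rewrite mulr0.
  by move/eqP; rewrite mulf_eq0 (negbTE (small_neq0 _)) => [/eqP //|]; lia.
have dg i : (i <= m)%N -> b i i = b 0 0.
  elim: i => // i IH im; rewrite -IH; last by lia.
  by have := relE i.+1 i im im; move/mulfI; apply; apply: small_neq0; lia.
apply/matrixP=> i j; rewrite mxE.
have bE (i' j' : 'I_m.+1) : B i' j' = b i' j' by rewrite /b !inord_val.
have li := ltn_ord i; have lj := ltn_ord j.
rewrite [LHS]bE [B 0 0]bE -val_eqE /=; case: (ltngtP i j) => h.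
- by rewrite up0.
- by rewrite lo0.
by rewrite -h dg.
Qed.

(** The twisted factor is a polynomial in X^p and contributes only its constant term
    to the coefficient of X. *)
Lemma mcoef_twist m n q r (P : 'M[{poly k}]_(m, n)) (R : 'M[{poly k}]_(q, r)) :
  mcoef 1 (map_mx (hev ('X^p : {poly k})) P *t R) = mcoef 0 P *t mcoef 1 R.
Proof.
apply/matrixP=> i j; rewrite !mxE /= coefM big_ord_recl big_ord1 /= subn0 subnn hevE.
have -> : \sum_(l < size (P (mxtens_unindex i).1 (mxtens_unindex j).1)) (P (mxtens_unindex i).1 (mxtens_unindex j).1)`_l *: 'X^p ^+ l =
  P (mxtens_unindex i).1 (mxtens_unindex j).1 \Po 'X^p by rewrite comp_polyE.
have p1 := p_gt1 charkp.
rewrite !coef_comp_poly_Xn; try lia.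
by rewrite dvdn0 div0n dvdn1 (_ : p == 1 = false) ?mul0r ?addr0 //; lia.
Qed.

Lemma fr_up (A : comAlgType k) (x : A) : fr charkp (up x) = up (x ^+ p).
Proof.
by rewrite /fr map_up.
Qed.
Lemma fr_lo (A : comAlgType k) (x : A) : fr charkp (lo x) = lo (x ^+ p).
Proof.
by rewrite /fr map_lo.
Qed.

Lemma slact_pow M (g : {poly k} -> 'M[{poly k}]_2) :
  (forall (x : {poly k}), \det (g x) = 1) -> (forall x, map_mx (hev ('X^p : {poly k})) (g x) = g (hev 'X^p x)) ->
  slact M (g 'X^p) = map_mx (hev 'X^p) (slact M (g 'X)).
Proof. by move=> dg mg; rewrite slact_nat // mg hevX. Qed.
Lemma slact_up_pow M : slact M (up ('X^p : {poly k})) = map_mx (hev 'X^p) (slact M (up 'X)).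
Proof. by apply: slact_pow => x; rewrite ?det_up ?map_up. Qed.
Lemma slact_lo_pow M : slact M (lo ('X^p : {poly k})) = map_mx (hev 'X^p) (slact M (lo 'X)).
Proof. by apply: slact_pow => x; rewrite ?det_lo ?map_lo. Qed.

Lemma tw_E M : Ec (tw M) 1 = 1%:M *t Ec St 1.
Proof. by rewrite /Ec /= /tw_act fr_up slact_up_pow mcoef_twist -/(Ec M 0) Ec0. Qed.
Lemma tw_F M : Fc (tw M) 1 = 1%:M *t Fc St 1.
Proof. by rewrite /Fc /= /tw_act fr_lo slact_lo_pow mcoef_twist -/(Fc M 0) Fc0. Qed.

Lemma hev_pow_inj : injective (hev ('X^p : {poly k})).
Proof.
have p1 := p_gt1 charkp.
move=> P Q /(congr1 (fun R : {poly k} => R)); rewrite !hevE => e; apply/polyP => i.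
have h (R : {poly k}) : (\sum_(l < size R) R`_l *: 'X^p ^+ l)`_(i * p) = R`_i.
  have -> : \sum_(l < size R) R`_l *: 'X^p ^+ l = R \Po 'X^p by rewrite comp_polyE.
  by rewrite coef_comp_poly_Xn ?dvdn_mull ?mulnK //; lia.
by rewrite -h e h.
Qed.

Lemma tens1_inj (R : comNzRingType) m n q (X : 'M[R]_(m, n)) (B C : 'M[R]_q.+1) :
  B *m C = 1%:M -> X *t B = 0 -> X = 0.
Proof.
move=> BC /(congr1 (mulmx^~ (1%:M *t C))); rewrite tensmx_mul BC mulmx1 mul0mx => /matrixP h.
apply/matrixP=> i j; have := h (mxtens_index (i, 0)) (mxtens_index (j, 0)).
by rewrite tensmxE !mxE eqxx mulr1.
Qed.

(** The operators E and F act on tw M through the Steinberg factor alone, so Z is of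
    the form Y (x) 1 by [St_scalar].  Cancelling the invertible Steinberg factor and
    then replacing X^p by X shows that Y is a homomorphism. *)
Lemma tw_full M N Z : @SL2hom k (tw M) (tw N) Z -> exists2 Y, @SL2hom k M N Y & Z = Y *t 1%:M.
Proof.
move=> hZ; pose Y := \matrix_(a, b) tblock Z a b 0 0.
have eZ : Z = Y *t 1%:M.
  apply: tblockP => a b; rewrite mxE; apply: St_scalar.
    by have := Ec_hom 1 hZ; rewrite !tw_E => /(congr1 (fun X => tblock X a b)); rewrite tblock_mulr tblock_mull.
  by have := Fc_hom 1 hZ; rewrite !tw_F => /(congr1 (fun X => tblock X a b)); rewrite tblock_mulr tblock_mull.
exists Y => //.
have hg (g gi : {poly k} -> 'M[{poly k}]_2) : (forall x, \det (g x) = 1) -> (forall x, \det (gi x) = 1) ->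
    g 'X *m gi 'X = 1%:M ->
    fr charkp (g 'X) = g 'X^p ->
    (forall M, slact M (g 'X^p) = map_mx (hev 'X^p) (slact M (g 'X))) ->
    ext {poly k} Y *m slact M (g 'X) = slact N (g 'X) *m ext {poly k} Y.
  move=> dg dgi gg efr epow; have := hZ {poly k} (g 'X) (dg _).
  rewrite eZ ext_tens ext1 /= /tw_act !tensmx_mul mulmx1 mul1mx efr !epow => e.
  apply: (lr_mx_inj hev_pow_inj); rewrite !map_mxM ext_map.
  apply/eqP; rewrite -subr_eq0; apply/eqP.
  apply: (@tens1_inj _ _ _ _ _ (slact St (g 'X)) (slact St (gi 'X))); first by have := @slactM k St _ _ _ (dg 'X) (dgi 'X); rewrite gg slact1 => <-.
  by rewrite -scaleN1r tensmxDl tensmxZl scaleN1r; apply/eqP; rewrite subr_eq0; apply/eqP.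
apply: SL2hom_generic; rewrite /homat.
  apply: (hg (fun x : {poly k} => up x) (fun x : {poly k} => up (- x))) => *; rewrite ?det_up //; [by rewrite -upD subrr up0 | exact: fr_up | exact: slact_up_pow].
apply: (hg (fun x : {poly k} => lo x) (fun x : {poly k} => lo (- x))) => *; rewrite ?det_lo //; [by rewrite -loD subrr lo0 | exact: fr_lo | exact: slact_lo_pow].
Qed.
End Full.

(** * Characters of modules with a Weyl filtration *)

Section Dim.
Variable k : fieldType.
Definition dimP n (P : 'cV[k]_n -> Prop) := \dim (vspace_of P).

Lemma dimP_exact m a b (i : 'M[k]_(m, a)) (q : 'M[k]_(b, m))
  (P' : 'cV[k]_a -> Prop) (P : 'cV[k]_m -> Prop) (Q : 'cV[k]_b -> Prop) :
  subspace_pred P' -> subspace_pred P -> subspace_pred Q ->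
  injective (fun v : 'cV[k]_a => i *m v) ->
  (forall u, P' u <-> P (i *m u)) -> (forall v, P v -> Q (q *m v)) ->
  (forall w, Q w -> exists2 v, P v & q *m v = w) ->
  (forall v : 'cV[k]_m, q *m v = 0 <-> exists u : 'cV[k]_a, v = i *m u) ->
  dimP P = (dimP P' + dimP Q)%N.
Proof.
move=> sP' sP sQ inj hi hq hl hex.
have mP' := mem_vspace_of sP'; have mP := mem_vspace_of sP; have mQ := mem_vspace_of sQ.
pose f : 'Hom('cV[k]_m, 'cV[k]_b) := linfun (mulmx q).
pose g : 'Hom('cV[k]_a, 'cV[k]_m) := linfun (mulmx i).
have fE v : f v = q *m v by rewrite lfunE.
have gE v : g v = i *m v by rewrite lfunE.
rewrite /dimP -(limg_ker_dim f); congr (_ + _)%N.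
  have -> : (vspace_of P :&: lker f)%VS = (g @: vspace_of P')%VS.
    apply/vspaceP => v; apply/idP/idP.
      rewrite memv_cap memv_ker fE => /andP[/mP Pv /eqP/hex[u eu]].
      by rewrite eu -gE; apply: memv_img; apply/mP'/hi; rewrite -eu.
    move=> /memv_imgP[u /mP'/hi Pu ->]; rewrite gE memv_cap memv_ker fE; apply/andP; split; first exact/mP.
    by apply/eqP/hex; exists u.
  rewrite limg_dim_eq //; have -> : lker g = 0%VS; last by rewrite capv0.
  apply/eqP; rewrite -subv0; apply/subvP => u; rewrite memv_ker gE => /eqP e.
  by rewrite memv0; apply/eqP/inj; rewrite /= e mulmx0.
congr (\dim _); apply/vspaceP => v; apply/idP/idP.
  by move=> /memv_imgP[u /mP Pu ->]; rewrite fE; apply/mQ/hq.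
by move=> /mQ/hl[v0 /mP h <-]; rewrite -fE; exact: memv_img.
Qed.

Lemma dimP_iso m n (P : 'cV[k]_m -> Prop) (Q : 'cV[k]_n -> Prop) (X : 'M[k]_(n, m)) (Y : 'M[k]_(m, n)) :
  subspace_pred P -> subspace_pred Q ->
  (forall v, P v -> Q (X *m v)) -> (forall w, Q w -> P (Y *m w)) ->
  (forall v, P v -> Y *m (X *m v) = v) -> (forall w, Q w -> X *m (Y *m w) = w) -> dimP P = dimP Q.
Proof.
move=> sP sQ PQ QP YX XY; have mP := mem_vspace_of sP; have mQ := mem_vspace_of sQ.
pose f : 'Hom('cV[k]_m, 'cV[k]_n) := linfun (mulmx X).
have fE v : f v = X *m v by rewrite lfunE.
rewrite /dimP; have <- : (f @: vspace_of P)%VS = vspace_of Q.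
  apply/vspaceP => v; apply/idP/idP => [/memv_imgP[u /mP Pu ->]|/mQ Qv].
    by rewrite fE; apply/mQ/PQ.
  by rewrite -[v]XY // -fE; apply: memv_img; apply/mP/QP.
rewrite limg_dim_eq //; apply/eqP; rewrite -subv0; apply/subvP => u.
rewrite memv_cap memv_ker fE memv0 => /andP[/mP Pu /eqP e].
by rewrite -[u]YX // e mulmx0.
Qed.

Lemma dimP0 n (P : 'cV[k]_n -> Prop) : subspace_pred P -> (forall v, P v -> v = 0) -> dimP P = 0%N.
Proof.
move=> sP h; apply/eqP; rewrite dimv_eq0 -subv0; apply/subvP => v /(mem_vspace_of sP)/h ->.
exact: mem0v.
Qed.
Lemma dimP_gt0 n (P : 'cV[k]_n -> Prop) : subspace_pred P -> (0 < dimP P)%N <-> exists2 v, P v & v <> 0.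
Proof.
move=> sP; split=> [h|[v Pv nv]].
  exists (vpick (vspace_of P)); first exact/(mem_vspace_of sP)/memv_pick.
  by apply/eqP; rewrite vpick0 -dimv_eq0 -lt0n.
rewrite lt0n dimv_eq0; apply/eqP => e; apply: nv.
by have /(mem_vspace_of sP) := Pv; rewrite e memv0 => /eqP.
Qed.
Lemma dimP_line n (P : 'cV[k]_n -> Prop) v : subspace_pred P -> P v -> v <> 0 ->
  (forall w, P w -> exists c, w = c *: v) <-> dimP P = 1%N.
Proof.
move=> sP Pv nv; have mP := mem_vspace_of sP.
have le : (<[v]> <= vspace_of P)%VS by rewrite -memvE; exact/mP.
have dv : \dim <[v]>%VS = 1%N by rewrite dim_vline; case: eqP.
split=> [h|h].
  rewrite -dv; congr (\dim _); apply/eqP; rewrite eqEsubv le andbT.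
  by apply/subvP => w /mP/h[c ->]; rewrite memvZ // memv_line.
move=> w /mP Pw; have /eqP e : <[v]>%VS == vspace_of P by rewrite eqEdim le dv -/(dimP P) h.
by rewrite -e in Pw; have /vlineP := Pw.
Qed.
Lemma dimP_le n (P Q : 'cV[k]_n -> Prop) : subspace_pred P -> subspace_pred Q ->
  (forall v, P v -> Q v) -> (dimP P <= dimP Q)%N.
Proof. by move=> sP sQ h; apply: dimvS; exact: vspace_of_le. Qed.
Lemma dimP_eq n (P Q : 'cV[k]_n -> Prop) : subspace_pred P -> subspace_pred Q ->
  (forall v, P v <-> Q v) -> dimP P = dimP Q.
Proof. by move=> sP sQ h; rewrite /dimP (vspace_of_eq sP sQ h). Qed.
End Dim.

Section Characters.
Variable k : fieldType.
Implicit Types M N : SL2mod k.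

Definition wdim M r := dimP (@weight_vector k M r).
Lemma wdim_gt0 M r : (0 < wdim M r)%N <-> is_weight M r.
Proof.
rewrite (dimP_gt0 (weight_subspace M r)); split=> [[v h n]|[v h n]]; by exists v.
Qed.
Lemma wdim_exact M' M Q i q r : @short_exact k M' M Q i q -> wdim M r = (wdim M' r + wdim Q r)%N.
Proof.
move=> [hi hq inj sur ex]; apply: (dimP_exact _ _ _ inj _ _ _ ex); try exact: weight_subspace.
- by move=> u; split; [exact: weight_hom | exact: weight_sub].
- by move=> v; exact: weight_hom.
by move=> w hw; apply: weight_lift.
Qed.
Lemma wdim_iso M N r : SL2iso M N -> wdim M r = wdim N r.
Proof.
move=> [X [Y [hX hY XY YX]]]; apply: (dimP_iso (X := X) (Y := Y)); try exact: weight_subspace.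
- by move=> v; exact: weight_hom.
- by move=> v; exact: weight_hom.
- by move=> v _; rewrite mulmxA YX mul1mx.
by move=> v _; rewrite mulmxA XY mul1mx.
Qed.

(** The multiplicity, 0 or 1, of the weight r in Delta(s). *)
Definition wtb (s : nat) (r : int) : bool := [exists i : 'I_s.+1, (2 * i)%N%:Z - s%:Z == r].
(** Multiplicities of weights of Delta(s) are constant along a parity class between
    -s and s, so their jumps detect s. *)
Lemma wtb_diff s (w : nat) : (wtb s w = (w == s) + wtb s (w%:Z + 2) :> nat)%N.
Proof.
rewrite /wtb; case: existsP => [[i /eqP ei]|ni]; case: existsP => [[j /eqP ej]|nj]; case: eqP => // e.
- by have := ltn_ord j; lia.
- case: nj; have lt : (i.+1 < s.+1)%N by have := ltn_ord i; lia.
  by exists (Ordinal lt); apply/eqP => /=; lia.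
- case: ni; exists ord_max; apply/eqP => /=; lia.
- case: ni; have lt : (j.-1 < s.+1)%N by have := ltn_ord j; lia.
  by exists (Ordinal lt); apply/eqP => /=; have := ltn_ord j; lia.
by case: ni; exists ord_max; apply/eqP => /=; lia.
Qed.
Lemma wtb_top s : wtb s s.
Proof. by apply/existsP; exists ord_max; apply/eqP => /=; lia. Qed.
Lemma wtb_le s r : wtb s r -> r <= s%:Z.
Proof. by move=> /existsP[i /eqP <-]; have := ltn_ord i; lia. Qed.

Lemma wdim_weyl s r : wdim (Weyl k s) r = wtb s r.
Proof.
have ev (v : 'cV[k]_(sldim (Weyl k s))) : v = \sum_(i < s.+1) v i 0 *: wv k i.
  by rewrite {1}[v]matrix_sum_delta; apply: eq_bigr => i _; rewrite big_ord1.
have co (v : 'cV[k]_(sldim (Weyl k s))) : weight_vector r v -> v = \sum_(i < s.+1 | (2 * i)%N%:Z - s%:Z == r) v i 0 *: wv k i.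
  move=> /wproj_id e; rewrite -[LHS]e {1}[v]ev mulmx_sumr [RHS]big_mkcond /=; apply: eq_bigr => i _.
  rewrite -scalemxAr; case: eqP => h; first by rewrite (wproj_id (M := Weyl k s)) // -h; exact: weight_wv.
  by rewrite (wproj_ne (weight_wv i)) ?scaler0 // => h'; apply: h.
rewrite /wtb; case: existsP => [[i /eqP ei]|ni]; last first.
  apply: dimP0; first exact: weight_subspace.
  move=> v /co ->; apply: big1 => i hi; by case: ni; exists i.
apply/(dimP_line (v := wv k i)); first exact: weight_subspace.
- by rewrite -ei; exact: weight_wv.
- by move=> /matrixP/(_ i 0); rewrite !mxE !eqxx => /eqP; rewrite oner_eq0.
move=> w /co ->; exists (w i 0); rewrite (bigD1 i) ?ei //= big1 ?addr0 // => j /andP[/eqP ej nj].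
by case/eqP: nj; apply: val_inj; move: ei ej => /=; lia.
Qed.

(** The character of a module with a Weyl filtration. *)
Lemma wdim_filtration M ws r : weyl_filtration M ws -> wdim M r = (\sum_(s <- ws) wtb s r)%N.
Proof.
elim=> [{}M e|M' {}M s {}ws i q ex _ IH].
  rewrite big_nil; apply: dimP0; first exact: weight_subspace.
  by move=> v _; apply/matrixP=> a; case: (cast_ord e a).
by rewrite big_cons (wdim_exact r ex) IH wdim_weyl addnC.
Qed.
(** The multiplicities of a Weyl filtration are the jumps of the character; in
    particular they do not depend on the filtration. *)
Lemma count_wdim M ws (w : nat) : weyl_filtration M ws ->
  wdim M w = (count_mem w ws + wdim M (w%:Z + 2))%N.
Proof.
move=> h; rewrite !(wdim_filtration _ h).
have -> : count_mem w ws = (\sum_(s <- ws) (w == s))%N.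
  by rewrite -sum1_count big_mkcond /=; apply: eq_bigr => s _; rewrite eq_sym; case: eqP.
by rewrite -big_split /=; apply: eq_bigr => s _; rewrite wtb_diff.
Qed.
Lemma filtration_weight M ws s : weyl_filtration M ws -> s \in ws -> is_weight M s.
Proof.
move=> h hs; apply/wdim_gt0; rewrite (wdim_filtration _ h) (big_rem s) //= wtb_top //.
Qed.
Lemma weight_filtration M ws r : weyl_filtration M ws -> is_weight M r -> exists2 s, s \in ws & wtb s r.
Proof.
move=> h /wdim_gt0; rewrite (wdim_filtration _ h) lt0n sum_nat_seq_eq0 => /allPn[s hs].
by rewrite /= eqb0 negbK => hb; exists s.
Qed.
End Characters.

(** * Fitting decompositions and indecomposable modules *)

Section Fitting.
Variable k : fieldType.

(** The factorisation char_poly Y = q X^m with q(0) <> 0 gives coprime polynomials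
    q and X^(m + 1), and e is the polynomial in Y that is 0 modulo X^(m + 1) and 1
    modulo q.  The predicate S stands for any subalgebra that contains Y. *)
Lemma fitting n (Y : 'M[k]_n) (S : 'M[k]_n -> Prop) :
  S 1%:M -> (forall c A B, S A -> S B -> S (c *: A + B)) -> (forall A B, S A -> S B -> S (A *m B)) -> S Y ->
  exists e Z N, [/\ S e, S Z, e = Z *m Y, e *m e = e & Y ^+ N *m (1%:M - e) = 0].
Proof.
case: n Y S => [|n] Y S S1 Sl Sm SY.
  exists 1%:M, 1%:M, 0%N; split=> //; apply/matrixP; by case.
have Sh P : S (horner_mx Y P).
  elim/poly_ind: P => [|P c IH].
    by rewrite rmorph0; have := Sl (-1) 1%:M 1%:M S1 S1; rewrite scaleN1r addNr.
  rewrite rmorphD rmorphM /= horner_mx_X horner_mx_C addrC -scalemx1; apply: Sl => //.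
  exact: Sm.
have [m [q nq epq]] := multiplicity_XsubC (char_poly Y) 0.
have {}nq : ~~ root q 0 by move: nq; rewrite monic_neq0 // char_poly_monic.
rewrite subr0 in epq.
have /Bezout_eq1_coprimepP[[u v] /= uv] : coprimep ('X^(m.+1)) q.
  by rewrite coprimep_expl // coprimep_sym coprimepX.
have ch : horner_mx Y (q * 'X^m) = 0 by rewrite -epq Cayley_Hamilton.
have e1 : 1%:M - horner_mx Y (u * 'X^(m.+1)) = horner_mx Y (v * q).
  by rewrite -[1%:M](rmorph1 (horner_mx Y)) -rmorphB -uv addrC addKr.
exists (horner_mx Y (u * 'X^(m.+1))), (horner_mx Y (u * 'X^m)), m.+1; split; try exact: Sh.
- by rewrite exprSr mulrA rmorphM /= horner_mx_X.
- apply/esym/eqP; rewrite -subr_eq0 -{1}[horner_mx Y _]mulmx1 -mulmxBr e1 -[_ *m _]/(horner_mx Y _ * horner_mx Y _) -rmorphM /=.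
  have -> : u * 'X^(m.+1) * (v * q) = u * 'X * v * (q * 'X^m) by rewrite exprS; ring.
  by rewrite rmorphM /= ch mulr0.
have -> : Y ^+ m.+1 = horner_mx Y 'X^(m.+1) by rewrite rmorphXn /= horner_mx_X.
rewrite e1 -[_ *m _]/(horner_mx Y _ * horner_mx Y _) -rmorphM /=.
have -> : 'X^(m.+1) * (v * q) = 'X * v * (q * 'X^m) by rewrite exprS; ring.
by rewrite rmorphM /= ch mulr0.
Qed.
End Fitting.

Section Indecomposable.
Variable k : fieldType.
Implicit Types M N : SL2mod k.

(** The two factors of an idempotent of full rank factorisation compose to the
    identity in the other order. *)
Lemma cancel_factor n r (J : 'M[k]_(n, r)) (L : 'M[k]_(r, n)) B D : B *m J = 1%:M -> L *m D = 1%:M ->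
  (J *m L) *m (J *m L) = J *m L -> L *m J = 1%:M.
Proof.
move=> BJ LD /(congr1 (fun X => B *m X *m D)) /=.
by rewrite !mulmxA BJ !mul1mx -!mulmxA LD !mulmx1.
Qed.
Lemma cross_factor n r1 r2 (J1 : 'M[k]_(n, r1)) (L1 : 'M[k]_(r1, n)) (J2 : 'M[k]_(n, r2)) (L2 : 'M[k]_(r2, n)) :
  L1 *m J1 = 1%:M -> L2 *m J2 = 1%:M -> (J1 *m L1) *m (J2 *m L2) = 0 -> L1 *m J2 = 0.
Proof.
move=> e1 e2 /(congr1 (fun X => L1 *m X *m J2)) /=.
by rewrite mulmx0 mul0mx !mulmxA e1 mul1mx -!mulmxA e2 mulmx1.
Qed.
Lemma stable_factor M r (J : 'M[k]_(sldim M, r)) (L : 'M[k]_(r, sldim M)) :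
  L *m J = 1%:M -> @SL2hom k M M (J *m L) -> stable_cols J L.
Proof.
move=> LJ he; split=> // A g dg; rewrite !mulmxA -extM he // -[RHS]mulmxA -extM.
by rewrite -mulmxA LJ mulmx1.
Qed.

Lemma idem_factor n (e : 'M[k]_n) : e *m e = e -> row_base e *m col_base e = 1%:M.
Proof.
move=> ee; have [B BC] : exists B, B *m col_base e = 1%:M by apply/row_fullP/col_base_full.
have [D RD] : exists D, row_base e *m D = 1%:M by apply/row_freeP/row_base_free.
by apply: (cancel_factor BC RD); rewrite mulmx_base.
Qed.

Lemma idem_stable M e : @SL2hom k M M e -> e *m e = e -> stable_cols (M := M) (col_base e) (row_base e).
Proof.
by move=> he ee; apply: stable_factor; [exact: idem_factor | rewrite mulmx_base].
Qed.

(** The images of e and 1 - e are submodules, and the module is their direct sum. *)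
Lemma indecomposable_idem M e : indecomposable M -> @SL2hom k M M e -> e *m e = e -> e = 0 \/ e = 1%:M.
Proof.
move=> [_ ind] he ee; pose f := 1%:M - e.
have hf : @SL2hom k M M f.
  by rewrite /f addrC -scaleN1r; apply: (SL2hom_subspace M M).2 => //; exact: SL2hom1.
have ef : e *m f = 0 by rewrite mulmxBr mulmx1 ee subrr.
have fe : f *m e = 0 by rewrite mulmxBl mul1mx ee subrr.
have ff : f *m f = f by rewrite {2}/f mulmxBr mulmx1 fe subr0.
have se := idem_stable he ee; have sf := idem_stable hf ff.
have cross a b : a *m b = 0 -> a *m a = a -> b *m b = b -> row_base a *m col_base b = 0 :> 'M[k]_(_, \rank (b : 'M_(sldim M))).
  by move=> ab aa bb; apply: (cross_factor (idem_factor aa) (idem_factor bb)); rewrite !mulmx_base.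
pose Y : 'M[k]_(sldim M, sldim (dsum (subrep se) (subrep sf))) := row_mx (col_base e) (col_base f).
pose X : 'M[k]_(sldim (dsum (subrep se) (subrep sf)), sldim M) := col_mx (row_base e) (row_base f).
have hY : @SL2hom k (dsum (subrep se) (subrep sf)) M Y.
  move=> A g dg; rewrite /Y ext_row /= /dsum_act mul_row_block !mulmx0 addr0 add0r mul_mx_row.
  by congr (row_mx _ _); rewrite subrep_hom.
have YX : Y *m X = 1%:M by rewrite mul_row_col !mulmx_base addrC subrK.
have XY : X *m Y = 1%:M.
  by rewrite mul_col_row !idem_factor // !cross // -scalar_mx_block.
have [|h|h] := ind (subrep se) (subrep sf); first by exists X, Y; split=> //; exact: hom_inv hY XY YX.
  by left; apply/eqP; rewrite -mxrank_eq0; apply/eqP.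
by right; apply/esym/eqP; rewrite -subr_eq0 -mxrank_eq0; apply/eqP.
Qed.

(** Fitting's lemma: the idempotent of [fitting] is 0 or 1. *)
Lemma indecomposable_local M Y : indecomposable M -> @SL2hom k M M Y ->
  (exists r, Y ^+ r = 0) \/ (exists Z, [/\ SL2hom Z, Z *m Y = 1%:M & Y *m Z = 1%:M]).
Proof.
move=> ind hY; have [||||e [Z [r [he hZ eZ ee eN]]]] := @fitting k _ Y (@SL2hom k M M).
- exact: SL2hom1.
- by move=> c A B; apply: (SL2hom_subspace M M).2.
- by move=> A B; apply: SL2hom_comp.
- by [].
have [e0|e1] := indecomposable_idem ind he ee; [left | right].
  by exists r; move: eN; rewrite e0 subr0 mulmx1.
by exists Z; rewrite -eZ; split=> //; apply: mulmx1C; rewrite -eZ.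
Qed.
End Indecomposable.

(** * Contravariant duality *)

(** A representative of the nontrivial Weyl group element; it conjugates g to the
    transposed inverse of g. *)
Definition om (A : comNzRingType) : 'M[A]_2 := mx2 0 1 (-1) 0.
Lemma omE (A : comNzRingType) : om A = up 1 *m lo (-1) *m up 1.
Proof. by rewrite !mx2M; congr mx2; ring. Qed.
Lemma om_adj (A : comNzRingType) (g : 'M[A]_2) : om A *m g = \adj g^T *m om A.
Proof. by rewrite adj2 [g in LHS]mx2_eta !mx2M !mxE; congr mx2; ring. Qed.
Lemma om_torus (k : fieldType) (A : comAlgType k) (t u : A) : om A *m torus t u = torus u t *m om A.
Proof. by rewrite !torusE !mx2M; congr mx2; ring. Qed.
Lemma adj_torus (k : fieldType) (A : comAlgType k) (t u : A) : \adj (torus t u) = torus u t.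
Proof. by rewrite adj2 !torusE; apply: mx2P; rewrite !mxE /= ?oppr0. Qed.
Lemma det_om (A : comNzRingType) : \det (om A) = 1.
Proof. by rewrite det_mx2; ring. Qed.

Section Contra.
Variable k : fieldType.
Implicit Types M N : SL2mod k.

(** The Weyl group element is defined over k and is a product of unipotent elements, so
    its action is given by a matrix over k. *)
Lemma om_mx M : exists Om Oi : 'M[k]_(sldim M), [/\ Om *m Oi = 1%:M, Oi *m Om = 1%:M &
  forall A : comAlgType k, slact M (om A) = ext A Om].
Proof.
have SU c (A : comAlgType k) : slact M (up c%:A) = ext A (\sum_(j < dK M) c ^+ j *: Ec M j).
  by rewrite slact_up ext_sum; apply: eq_bigr => j _; rewrite extZ -[(c ^+ j)%:A]/(in_alg A (c ^+ j)) rmorphXn.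
have SL c (A : comAlgType k) : slact M (lo c%:A) = ext A (\sum_(j < dK M) c ^+ j *: Fc M j).
  by rewrite slact_lo ext_sum; apply: eq_bigr => j _; rewrite extZ -[(c ^+ j)%:A]/(in_alg A (c ^+ j)) rmorphXn.
pose E c := \sum_(j < dK M) c ^+ j *: Ec M j; pose F c := \sum_(j < dK M) c ^+ j *: Fc M j.
have hE c : E c *m E (- c) = 1%:M.
  apply: (@ext_inj k {poly k}); rewrite extM -!SU -slactM ?det_up // -upD scaleNr subrr up0 slact1.
  by rewrite ext1.
have hF c : F c *m F (- c) = 1%:M.
  apply: (@ext_inj k {poly k}); rewrite extM -!SL -slactM ?det_lo // -loD scaleNr subrr lo0 slact1.
  by rewrite ext1.
have e1 : (E 1 *m F (-1) *m E 1) *m (E (-1) *m F 1 *m E (-1)) = 1%:M.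
  have hF' := hF (-1); rewrite opprK in hF'.
  by rewrite !mulmxA -[_ *m E 1 *m E (-1)]mulmxA hE mulmx1 -[_ *m F (-1) *m F 1]mulmxA hF' mulmx1 hE.
exists (E 1 *m F (-1) *m E 1), (E (-1) *m F 1 *m E (-1)); split=> //; first exact: mulmx1C.
move=> A; rewrite !extM /E /F -!SU -SL scale1r scaleN1r omE !slactM ?det_up ?det_lo //.
by rewrite det_mulmx det_up det_lo mulr1.
Qed.

(** The weight projections are also projections for the transposed action, because the
    action of the torus is the sum of its characters times the projections. *)
Lemma wproj_torus M r (A : comAlgType k) (t u : A) : t * u = 1 ->
  ext A (wproj M r) *m slact M (torus t u) = torus_char t u r *: ext A (wproj M r).
Proof.
move=> tu; have s1 : \sum_(s <- wrange M) wproj M s = 1%:M by have [_ _ _] := wproj_spec M.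
have st s : slact M (torus t u) *m ext A (wproj M s) = torus_char t u s *: ext A (wproj M s).
  have eqc (X Y : 'M[A]_(sldim M)) : (forall j, col j X = col j Y) -> X = Y.
    by move=> h; apply/matrixP=> i j; have := h j => /matrixP/(_ i 0); rewrite !mxE.
  apply: eqc => j; rewrite colM linearZ /= /ext -map_col colE; exact: (wprojW s (delta_mx j 0) tu).
have PP s : wproj M r *m wproj M s = (r == s)%:R *: wproj M s.
  apply: eq_mx_cols => v; rewrite -mulmxA -scalemxAl; case: eqP => [->|ne].
    by rewrite scale1r (wproj_id (wprojW s v)).
  by rewrite scale0r (wproj_ne (wprojW s v)) // => e; apply: ne.
rewrite -[slact M _]mulmx1 -(ext1 A) -s1 ext_sum mulmx_sumr mulmx_sumr.
rewrite -{2}[wproj M r]mulmx1 -s1 mulmx_sumr ext_sum scaler_sumr; apply: eq_bigr => s _.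
rewrite st -scalemxAr -extM PP; case: eqP => [->|_] //.
by rewrite scale0r ext0 !scaler0.
Qed.

Lemma dual_torus M Om Oi : Om *m Oi = 1%:M -> (forall A : comAlgType k, slact M (om A) = ext A Om) ->
  forall (A : comAlgType k) (t u : A), t * u = 1 ->
  slact (dual M) (torus t u) = (ext A Om *m slact M (torus t u) *m ext A Oi)^T.
Proof.
move=> OO hO A t u tu; rewrite /= /dual_act adj_torus; congr (_^T).
have ut : u * t = 1 by rewrite mulrC.
rewrite -hO -slactM ?det_om ?det_torus // om_torus slactM ?det_om ?det_torus //.
by rewrite hO -mulmxA -extM OO ext1 mulmx1.
Qed.

(** Weights of the dual are negatives of weights, and the weights are symmetric under
    the Weyl group element. *)
Lemma weight_dual M r : is_weight M r -> is_weight (dual M) r.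
Proof.
move=> [v nv wv]; have [Om [Oi [OO OO' hO]]] := om_mx M.
have [x nx] : exists x : 'cV_(sldim M), (wproj M r)^T *m x <> 0.
  apply: contrapT => ne; apply: nv; rewrite -(wproj_id wv).
  suff -> : wproj M r = 0 by rewrite mul0mx.
  apply: trmx_inj; apply: eq_mx_cols => x; rewrite trmx0 mul0mx; apply: contrapT => nx.
  by apply: ne; exists x.
exists (Oi^T *m ((wproj M r)^T *m x)).
  move=> /(congr1 (mulmx Om^T)); rewrite mulmx0 mulmxA -trmx_mul OO' trmx1 mul1mx; exact: nx.
move=> A t u tu; rewrite (dual_torus OO hO tu) !extM !extT !mulmxA -!trmx_mul.
have -> : ext A (wproj M r) *m (ext A Oi *m (ext A Om *m slact M (torus t u) *m ext A Oi)) =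
   torus_char t u r *: (ext A (wproj M r) *m ext A Oi).
  rewrite !mulmxA -[ext A (wproj M r) *m ext A Oi *m ext A Om]mulmxA -extM OO' ext1 mulmx1 wproj_torus //.
  by rewrite -scalemxAl.
by rewrite linearZ /= -scalemxAl.
Qed.

Lemma weight_dualV M r : is_weight (dual M) r -> is_weight M r.
Proof.
move=> /weight_dual [v nv wv]; exists v => // A t u tu.
have := wv A t u tu; rewrite /= /dual_act /= /dual_act trmxK.
by rewrite adj_torus adj_torus.
Qed.
End Contra.

Section ContraTwist.
Variables (k : fieldType) (p : nat).
Hypothesis charkp : p \in [pchar k].
Notation St := (Weyl k p.-1).
Notation tw := (tw charkp).

(** Both sides are the coefficients of X^j Y^i in the m-th power of a bilinear
    expression in X and Y, whose transposition exchanges the two variables. *)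
Lemma wrow_sym (A : comNzRingType) m (g : 'M[A]_2) i j :
  (wrow m g i)`_j *+ 'C(m, i) = (wrow m g^T j)`_i *+ 'C(m, j).
Proof.
pose L (h : 'M[A]_2) : {poly {poly A}} :=
  ((h 1 1)%:P - h 1 0 *: 'X)%:P + (- (h 0 1)%:P + h 0 0 *: 'X) *: 'X.
have co h a b : (L h ^+ m)`_a`_b = (wrow m h a)`_b *+ 'C(m, a) by rewrite coef_linX coefMn.
have sw : swapXY (L g) = L g^T.
  rewrite /L !mxE rmorphD /= swapXY_polyC -!mul_polyC rmorphM /= swapXY_polyC swapXY_X.
  rewrite !(rmorphD, rmorphB, rmorphN) /= !map_polyC /= !rmorphM /= !map_polyC /= map_polyX.
  by rewrite !mulrDl !mulNr addrACA mulrAC.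
by rewrite -co -coef_swapXY rmorphXn /= sw co.
Qed.

(** The binomial coefficients of p - 1 are signs modulo p, by Pascal's rule. *)
Lemma bin_pred i : (i < p)%N -> ('C(p.-1, i))%:R = (-1) ^+ i :> k.
Proof.
elim: i => [|i IH] li; first by rewrite bin0 expr0.
have := bin_lt_pcharf_0 charkp (k := i.+1); rewrite li => /(_ isT).
rewrite -{1}(p_pred charkp) binS natrD IH; last by lia.
by move=> /eqP; rewrite addr_eq0 exprS mulN1r => /eqP.
Qed.

Definition sgm : 'M[k]_(sldim St) := diag_mx (\row_(i < p.-1.+1) (-1) ^+ i).
Lemma sgm_sq : sgm *m sgm = 1%:M.
Proof.
rewrite /sgm mulmx_diag; apply/matrixP=> i j; rewrite !mxE -expr2 sqrr_sign //.
Qed.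
Lemma sign_swap (R : comNzRingType) (w w' u v : R) : u * u = 1 -> v * v = 1 -> w * u = w' * v -> u * w' = w * v.
Proof.
move=> uu vv e; have -> : w' = w * u * v by rewrite e -mulrA vv mulr1.
by rewrite -[RHS]mulr1 -uu; ring.
Qed.
(** The Steinberg module is isomorphic to its contravariant dual, by a diagonal matrix
    of signs. *)
Lemma St_sym (A : comAlgType k) (g : 'M[A]_2) : ext A sgm *m (slact St g^T)^T = slact St g *m ext A sgm.
Proof.
have es : ext A sgm = diag_mx (\row_(i < p.-1.+1) (-1) ^+ i).
  rewrite /ext /sgm map_diag_mx; congr diag_mx; apply/matrixP=> i j; rewrite !mxE.
  by rewrite rmorphXn rmorphN1.
have bA i : (i < p)%N -> ('C(p.-1, i))%:R = (-1) ^+ i :> A.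
  by move=> /bin_pred/(congr1 (in_alg A)); rewrite rmorph_nat rmorphXn rmorphN1.
apply/matrixP=> i j; rewrite es mul_diag_mx mul_mx_diag [LHS]mxE [RHS]mxE [(_^T) i j]mxE ![(\row__ _) _ _]mxE.
have lt (l : 'I_(sldim St)) : (l < p)%N by apply: (leq_trans (ltn_ord l)); rewrite /= (p_pred charkp).
have := wrow_sym p.-1 g i j; rewrite -[LHS]mulr_natr -[RHS]mulr_natr (bA _ (lt i)) (bA _ (lt j)).
rewrite -(weylE (m := p.-1) g i j) -(weylE (m := p.-1) g^T j i) => e.
have sq (l : nat) : (-1) ^+ l * (-1) ^+ l = 1 :> A by rewrite -exprD addnn -mul2n exprM sqrrN expr1n expr1n.
exact: (sign_swap (sq i) (sq j) e).
Qed.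

(** Since W n is its own contravariant dual, the transpose of a homomorphism from
    tw (dual T) is one to the contravariant dual of tw (dual T), which is
    isomorphic to tw T. *)
Lemma contra_hom n (T : SL2mod k) a : @SL2hom k (tw (dual T)) (W k n) a ->
  exists Th, (exists Ti, Ti *m Th = 1%:M) /\ @SL2hom k (W k n) (tw T) (Th *m a^T).
Proof.
move=> ha; have [Om [Oi [OO OO' hO]]] := om_mx T.
exists (Oi *t sgm); split.
  by exists (Om *t sgm); rewrite tensmx_mul OO sgm_sq; exact: tens11.
move=> A g dg; have dgt : \det g^T = 1 by rewrite det_tr.
have e1 : ext A a^T *m slact (W k n) g = (slact (tw (dual T)) g^T)^T *m ext A a^T.
  by rewrite extT -[slact (W k n) g]trmxK W_T -!trmx_mul ha.
rewrite extM -mulmxA e1 !mulmxA; congr (_ *m _).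
rewrite /= /tw_act trmx_tens ext_tens !tensmx_mul St_sym; congr (_ *t _).
rewrite /dual_act trmxK -/(fr charkp g^T).
have -> : fr charkp g^T = (fr charkp g)^T by apply/matrixP=> i j; rewrite !mxE.
have h : ext A Om *m slact T (fr charkp g) = slact T (\adj (fr charkp g)^T) *m ext A Om.
  have dfr : \det (fr charkp g) = 1 by exact: det_fr.
  rewrite -hO -!slactM ?det_om ?det_adj_SL2 ?det_tr //; by rewrite om_adj.
have h2 : slact T (\adj (fr charkp g)^T) = ext A Om *m slact T (fr charkp g) *m ext A Oi.
  by rewrite h -mulmxA -extM OO ext1 mulmx1.
by rewrite h2 !mulmxA -extM OO' ext1 mul1mx.
Qed.
End ContraTwist.

(** * Splitting off a twisted tilting module *)

(** Start from the homomorphism out of the Weyl factor of highest weight q and extend it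
    through the rest of the filtration by [acyclic_W]. *)
Lemma extend_hw (k : fieldType) n (M : SL2mod k) ws (q : nat) v : weyl_filtration M ws -> q \in ws ->
  @HW k (W k n) q v -> exists a w, [/\ @SL2hom k M (W k n) a, weight_vector q w & a *m w = v].
Proof.
move=> fil hq hv; elim: fil hq => [//|M' {}M s {}ws i qq ex _ IH].
have [hi hqq inj sur _] := ex.
rewrite inE => /orP[/eqP e|/IH[a [w [ha ww eaw]]]].
  subst s; have [X hX eX] := weyl_hom_ex hv.
  have [w ww ew] := weight_lift hqq (@weight_hwv k q) (sur (hwv k q)).
  by exists (X *m qq), w; split=> //; [exact: SL2hom_comp hX hqq | rewrite -mulmxA ew].
have [a' ha' ea'] := acyclic_W ex ha.
by exists a', (i *m w); split=> //; [exact: weight_hom | rewrite mulmxA ea'].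
Qed.

Section Tilting.
Variables (k : fieldType) (p : nat).
Hypothesis charkp : p \in [pchar k].
Variable T : nat -> SL2mod k.
Hypothesis T_tilting : forall r : nat, indecomposable_tilting (T r) r.
Variable c : nat -> nat -> nat.
Hypothesis c_mult : forall r s : nat, weyl_mult (T r) s (c r s).
Variable d : nat -> nat -> int.
Hypothesis d_inverse : inverse_lower c d.
Notation W := (W k).
Notation dd n := (sldim (W n)).
Notation tw := (tw charkp).
Definition wall (s : nat) : nat := (p * s + p.-1)%N.

Lemma wall_inj : injective wall.
Proof. by move=> s t /eqP; rewrite eqn_add2r eqn_pmul2l ?(ltnW (p_gt1 charkp)) // => /eqP. Qed.

(** The matrix c is invertible over the integers and lower triangular. *)
Lemma c_diag r : c r r = 1%N.
Proof.
have [d0 cd _] := d_inverse; have := cd r r; rewrite big_ord_recr /= eqxx big1 => [|j _]; last first.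
  by rewrite d0 ?mulr0.
rewrite add0r => e; have : (c r r)%:Z \is a GRing.unit by apply/unitrP; exists (d r r); rewrite mulrC e.
by rewrite unfold_in /= => /orP[/eqP[]//|/eqP].
Qed.

Lemma T_filtration r : exists ws, [/\ weyl_filtration (T r) ws, forall s, s \in ws -> (s <= r)%N &
  forall s, count_mem s ws = c r s].
Proof.
have [[[ws fws] _] _ [_ hw]] := T_tilting r; exists ws; split=> // s.
  by move=> /(filtration_weight fws)/hw.
have [ws' fws' ->] := c_mult r s.
by have := count_wdim s fws; rewrite (count_wdim s fws') => /addIn.
Qed.

Lemma c_lower r s : (r < s)%N -> c r s = 0%N.
Proof.
have [ws [_ le <-]] := T_filtration r => lt; apply/count_memPn/negP => /le; lia.
Qed.

(** The dual of T(r) has the same weights as T(r), so its filtration has a factor whose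
    highest weight is r. *)
Lemma T_dual_filtration r : exists2 ws, weyl_filtration (dual (T r)) ws & r \in ws.
Proof.
have [[_ [ws fws]] _ [hr hw]] := T_tilting r; exists ws => //.
have [s hs /wtb_le le] := weight_filtration fws (weight_dual hr).
have /weight_dualV/hw le' := filtration_weight fws hs.
by have -> : r = s by lia.
Qed.

Lemma tw_T_filtration s : exists ws, [/\ weyl_filtration (tw (T s)) ws,
  forall q, q \in ws -> (q <= wall s)%N & forall r, count_mem (wall r) ws = c s r].
Proof.
have [ws [fws le ct]] := T_filtration s; exists [seq wall q | q <- ws]; split.
- exact: weyl_filtration_tw.
- by move=> q /mapP[t /le lt ->]; rewrite leq_add2r leq_mul2l lt orbT.
by move=> r; rewrite count_map -ct; apply: eq_count => t /=; rewrite (inj_eq wall_inj).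
Qed.

Lemma wdim_tw_T s r : wdim (tw (T s)) (wall r) = (c s r + wdim (tw (T s)) ((wall r)%:Z + 2))%N.
Proof. by have [ws [fws _ ct]] := tw_T_filtration s; rewrite (count_wdim _ fws) ct. Qed.
Lemma weight_tw_T s q : is_weight (tw (T s)) q -> q <= (wall s)%:Z.
Proof.
have [ws [fws le _]] := tw_T_filtration s => /(weight_filtration fws)[t /le lt /wtb_le]; lia.
Qed.
Lemma wdim_tw_top s : wdim (tw (T s)) (wall s) = 1%N.
Proof.
rewrite wdim_tw_T c_diag; case: (posnP (wdim (tw (T s)) ((wall s)%:Z + 2))) => [-> //|].
by move=> /wdim_gt0/weight_tw_T; lia.
Qed.

Lemma tens_pow m q (Y : 'M[k]_m) N : (Y *t (1%:M : 'M[k]_q)) ^+ N = Y ^+ N *t 1%:M.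
Proof.
elim: N => [|N IH]; first by rewrite !expr0; exact/esym/tens11.
by rewrite !exprS IH -[LHS]/(_ *m _) tensmx_mul mulmx1.
Qed.

(** Endomorphisms of tw (T s) come from endomorphisms of T(s). *)
Lemma tw_T_local s phi : @SL2hom k (tw (T s)) (tw (T s)) phi ->
  (exists r, phi ^+ r = 0) \/ (exists psi, [/\ SL2hom psi, psi *m phi = 1%:M & phi *m psi = 1%:M]).
Proof.
move=> /tw_full[Y hY ->]; have [_ ind _] := T_tilting s.
have [[r er]|[Z [hZ ZY YZ]]] := indecomposable_local ind hY; [left | right].
  by exists r; rewrite tens_pow er tens0mx.
exists (Z *t 1%:M); split; first exact: tw_hom.
  by rewrite tensmx_mul ZY mulmx1; exact: tens11.
by rewrite tensmx_mul YZ mulmx1; exact: tens11.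
Qed.

(** The composite b e a maps the line of weight p (s + 1) - 1 to itself.  If b e a were
    nilpotent it would be zero on this line; then b v = 0, which contradicts
    (u, v) <> 0. *)
Lemma split_T n s e u v : @SL2hom k (W n) (W n) e -> @HW k (W n) (wall s) v -> e *m v = v ->
  @HW k (W n) (wall s) u -> dotp u v <> 0 ->
  exists a b psi w, [/\ @SL2hom k (tw (T s)) (W n) a, @SL2hom k (W n) (tw (T s)) b, @SL2hom k (tw (T s)) (tw (T s)) psi,
    psi *m (b *m e *m a) = 1%:M /\ (b *m e *m a) *m psi = 1%:M &
    @weight_vector k (tw (T s)) (wall s) w /\ a *m w = v].
Proof.
move=> he hv ev hu nuv.
have [ws [fws _ ct]] := tw_T_filtration s.
have sws : wall s \in ws by rewrite -has_pred1 has_count ct c_diag.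
have [a [w [ha ww eaw]]] := extend_hw fws sws hv.
have [ws' fws' sws'] := T_dual_filtration s.
have [a' [w' [ha' ww' eaw']]] := extend_hw (weyl_filtration_tw charkp fws') (map_f wall sws') hu.
have [Th [[Ti TiTh] hb]] := contra_hom ha'.
pose b := Th *m a'^T; pose phi := b *m e *m a.
have hphi : @SL2hom k (tw (T s)) (tw (T s)) phi.
  by rewrite /phi; apply: SL2hom_comp ha; apply: SL2hom_comp hb he.
have [[r er]|[psi [hpsi e1 e2]]] := tw_T_local hphi; last by exists a, b, psi, w.
case: nuv.
have [w0|/eqP nw] := eqVneq w 0; first by rewrite -eaw w0 mulmx0 dotp0r.
have [x ex] : exists x, phi *m w = x *: w.
  have := (dimP_line (weight_subspace (tw (T s)) (wall s)) ww nw).2 (wdim_tw_top s); apply.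
  exact: weight_hom ww.
(* a nilpotent endomorphism kills the line of top weight *)
have x0 : x = 0.
  have : phi ^+ r *m w = x ^+ r *: w.
    elim: (r) => [|r' IH]; first by rewrite !expr0 scale1r; exact: mul1mx.
    by rewrite exprSr -[_ * phi]/(_ *m phi) -mulmxA ex -scalemxAr IH scalerA exprS.
  rewrite er mul0mx => /esym/eqP; rewrite scaler_eq0 expf_eq0 => /orP[/andP[_ /eqP //]|/eqP //].
have av : a'^T *m v = 0.
  have : b *m v = 0 by move: ex; rewrite x0 scale0r /phi -!mulmxA eaw ev.
  by move=> /(congr1 (mulmx Ti)); rewrite mulmx0 /b -mulmxA mulmxA TiTh mul1mx.
by rewrite -eaw' /dotp trmx_mul -mulmxA av mulmx0 mxE.
Qed.
End Tilting.

(** * Dimensions of the images of idempotents *)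

Section FixDim.
Variable k : fieldType.
(** The vectors of P in the image of the idempotent e. *)
Definition fixP n (P : 'cV[k]_n -> Prop) (e : 'M[k]_n) (v : 'cV[k]_n) := P v /\ e *m v = v.
Definition fixd n (P : 'cV[k]_n -> Prop) (e : 'M[k]_n) := dimP (fixP P e).
Lemma fix_subspace n (P : 'cV[k]_n -> Prop) e : subspace_pred P -> subspace_pred (fixP P e).
Proof.
move=> [P0 Pl]; split=> [|a x y [Px ex] [Py ey]]; first by split; rewrite ?mulmx0.
by split; [exact: Pl | rewrite mulmxDr -scalemxAr ex ey].
Qed.
Lemma fixd_add n (P : 'cV[k]_n -> Prop) e1 e2 : subspace_pred P ->
  e1 *m e1 = e1 -> e2 *m e2 = e2 -> e1 *m e2 = 0 -> e2 *m e1 = 0 ->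
  (forall v, P v -> P (e1 *m v)) -> (forall v, P v -> P (e2 *m v)) ->
  fixd P (e1 + e2) = (fixd P e1 + fixd P e2)%N.
Proof.
move=> sP e11 e22 e12 e21 h1 h2.
have m0 := mem_vspace_of (fix_subspace (e1 + e2) sP).
have m1 := mem_vspace_of (fix_subspace e1 sP); have m2 := mem_vspace_of (fix_subspace e2 sP).
rewrite /fixd /dimP -dimv_disjoint_sum; last first.
  apply/eqP; rewrite -subv0; apply/subvP => v; rewrite memv_cap memv0 => /andP[/m1[_ v1] /m2[_ v2]].
  by rewrite -v1 -v2 mulmxA e12 mul0mx.
congr (\dim _); apply/vspaceP => v; apply/idP/idP.
  move=> /m0[Pv ev]; rewrite -ev mulmxDl; apply: memv_add.
    by apply/m1; split; [exact: h1 | rewrite mulmxA e11].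
  by apply/m2; split; [exact: h2 | rewrite mulmxA e22].
move=> /memv_addP[x /m1[Px ex] [y /m2[Py ey] ->]]; apply/m0; split.
  by rewrite -[x]scale1r; apply: sP.2.
rewrite mulmxDl !mulmxDr ex ey -{1}ey mulmxA e12 mul0mx addr0.
by rewrite -{2}ex mulmxA e21 mul0mx add0r.
Qed.
End FixDim.

Section Pairing.
Variable k : fieldType.
Notation W := (W k).
Notation dd n := (sldim (W n)).

(** The torus acts on W n by symmetric matrices, so distinct weight spaces are
    orthogonal. *)
Lemma wproj_sym n r : (wproj (W n) r)^T = wproj (W n) r.
Proof.
set P := wproj _ _; have PPT : P *m P^T = P^T.
  apply: eq_mx_cols => v; rewrite -mulmxA; apply: wproj_id => A t u tu.
  have := congr1 trmx (wproj_torus (W n) r tu); rewrite trmx_mul W_T linearZ /= -extT -/P => e.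
  have -> : torus t u = (torus t u)^T by rewrite torusE; apply: mx2P; rewrite !mxE.
  by rewrite extM mulmxA e -scalemxAl.
apply/esym; transitivity ((P *m P^T)^T); first by rewrite PPT trmxK.
by rewrite trmx_mul trmxK PPT.
Qed.

(** The form pairs the image of e perfectly with the image of its adjoint, weight by
    weight. *)
Lemma weight_pairing n e q x : @SL2hom k (W n) (W n) e -> e *m e = e ->
  weight_vector q x -> e *m x = x -> x <> 0 ->
  exists y, [/\ @weight_vector k (W n) q y, e^T *m y = y & dotp y x <> 0].
Proof.
move=> he ee wx ex nx.
have [l nl] : exists l, x l 0 <> 0.
  by apply: contrapT => h; apply: nx; apply/matrixP=> l j; rewrite [j]ord1 mxE; apply: contrapT => n0; apply: h; exists l.
exists (wproj (W n) q *m (e^T *m delta_mx l 0)); split; first exact: wprojW.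
  by rewrite -(wproj_hom _ _ (W_homT he)) [e^T *m (e^T *m _)]mulmxA -trmx_mul ee.
by rewrite dotpMl wproj_sym (wproj_id wx) dotpMl trmxK ex dotp_delta.
Qed.

Lemma weight_W_le n q x : @weight_vector k (W n) q x -> x <> 0 -> q <= n%:Z.
Proof.
elim: n q x => [|n IH] q x wx nx.
  case: (eqVneq q 0) => [-> //|/eqP ne]; case: nx; exact: (weight_uniq wx (weight_triv x)).
move: wx nx; rewrite -[x](@vsubmxK k (dd n) (dd n)); move: (usubmx _) (dsubmx _) => x0 x1.
move=> /(@weight_VM k (W n))[w0 w1] nx.
case: (eqVneq x0 0) => [e0|/eqP n0]; last by have := IH _ _ w0 n0; lia.
case: (eqVneq x1 0) => [e1|/eqP n1]; last by have := IH _ _ w1 n1; lia.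
by case: nx; rewrite e0 e1 col_mx0.
Qed.

Lemma top_weight n (e : 'M[k]_(dd n)) (x : 'cV[k]_(dd n)) : @SL2hom k (W n) (W n) e -> e *m x = x -> x <> 0 ->
  exists q v, [/\ v <> 0, e *m v = v, @weight_vector k (W n) q v &
    forall q' y, q < q' -> @weight_vector k (W n) q' y -> e *m y = y -> y = 0].
Proof.
move=> he ex nx.
pose Q (t : nat) := `[< exists v, [/\ v <> 0, e *m v = v & @weight_vector k (W n) (n%:Z - t%:Z) v] >].
have toQ q v : v <> 0 -> e *m v = v -> @weight_vector k (W n) q v -> Q (absz (n%:Z - q)).
  move=> nv ev wv; apply/asboolP; exists v; split=> //.
  by have le := weight_W_le wv nv; rewrite (_ : n%:Z - _ = q) //; lia.
have exQ : exists t, Q t.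
  have [r nr] : exists r, wproj (W n) r *m x <> 0.
    apply: contrapT => h; apply: nx; rewrite [x]wproj_sum; apply: big1 => r _.
    by apply: contrapT => h'; apply: h; exists r.
  exists (absz (n%:Z - r)); apply: (toQ r _ nr); last exact: wprojW.
  by rewrite -(wproj_hom _ _ he) ex.
case: (ex_minnP exQ) => t /asboolP[v [nv ev wv]] mt.
exists (n%:Z - t%:Z), v; split=> // q' y lt wy ey; apply: contrapT => ny.
by have := mt _ (toQ q' y ny ey wy); have := weight_W_le wy ny; lia.
Qed.

(** A vector of maximal weight in the image of e is a highest weight vector, and so is
    its partner in the image of the adjoint, which has the same weights. *)
Lemma top_pair n (e : 'M[k]_(dd n)) (x : 'cV[k]_(dd n)) : @SL2hom k (W n) (W n) e -> e *m e = e -> e *m x = x -> x <> 0 ->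
  exists (q : nat) v u, [/\ e *m v = v, @HW k (W n) q v, @HW k (W n) q u & dotp u v <> 0].
Proof.
move=> he ee ex nx; have [q [v [nv ev wv top]]] := top_weight he ex nx.
have hv : HW q v.
  split=> //; apply/upfixE => j j0; apply: (top (q + (2 * j)%N%:Z)); first by lia.
    exact: weight_E.
  by rewrite mulmxA (Ec_hom j he) -mulmxA ev.
have [y [wy ey nyv]] := weight_pairing he ee wv ev nv.
have hy : HW q y.
  split=> //; apply/upfixE => j j0; apply: contrapT => nz.
  have heT := W_homT he; have eeT : e^T *m e^T = e^T by rewrite -trmx_mul ee.
  have eEy : e^T *m (Ec (W n) j *m y) = Ec (W n) j *m y by rewrite mulmxA (Ec_hom j heT) -mulmxA ey.
  have [z [wz ez nz']] := weight_pairing heT eeT (weight_E j wy) eEy nz.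
  apply: nz'; rewrite trmxK in ez; rewrite (top _ _ _ wz ez) ?dotp0l //; by lia.
case: q hv hy {wv wy top} => q hv hy; last by case: nv; exact: HW_neg hv _.
by exists q, v, y.
Qed.

Lemma Rad_hom n r f v : @SL2hom k (W n) (W n) f -> Rad r v -> @Rad k n r (f *m v).
Proof.
move=> hf [hv rv]; split; first exact: HW_hom hf hv.
by move=> u hu; rewrite dotpC dotpMl dotpC; apply: rv; exact: HW_hom (W_homT hf) hu.
Qed.
End Pairing.

(** * Counting the summands *)

Section Decomposition.
Variables (k : fieldType) (p : nat).
Hypothesis charkp : p \in [pchar k].
Variable T : nat -> SL2mod k.
Hypothesis T_tilting : forall r : nat, indecomposable_tilting (T r) r.
Variable c : nat -> nat -> nat.
Hypothesis c_mult : forall r s : nat, weyl_mult (T r) s (c r s).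
Variable d : nat -> nat -> int.
Hypothesis d_inverse : inverse_lower c d.
Notation W := (W k).
Notation dd n := (sldim (W n)).
Notation tw := (tw charkp).
Notation wall := (wall p).

Definition wt n (q : int) := @weight_vector k (W n) q.
(** The rank of the form on the highest weight vectors of weight p (s + 1) - 1 in the
    image of e, as the difference of the dimensions of this space and its radical. *)
Definition headd n (e : 'M[k]_(dd n)) (s : nat) : int :=
  (fixd (@HW k (W n) (wall s)) e)%:Z - (fixd (@Rad k n (wall s)) e)%:Z.
(** The jump of the character of the image of e at the weight p (r + 1) - 1. *)
Definition chard n (e : 'M[k]_(dd n)) (r : nat) : int :=
  (fixd (@wt n (wall r)) e)%:Z - (fixd (@wt n ((wall r)%:Z + 2)) e)%:Z.

(** The idempotent e1 projects onto the summand tw (T s) of [split_T].  Its character is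
    that of tw (T s).  On the highest weight line the form has rank 1, as
    (u, v) <> 0.  For another wall t a nonzero value of the form would by [split_T]
    split tw (T t) off tw (T s), which is indecomposable, although their highest
    weights differ. *)
Lemma summand n s (e : 'M[k]_(dd n)) u v : @SL2hom k (W n) (W n) e -> e *m e = e ->
  @HW k (W n) (wall s) v -> e *m v = v -> @HW k (W n) (wall s) u -> dotp u v <> 0 ->
  exists e1, [/\ @SL2hom k (W n) (W n) e1, e1 *m e = e1, e *m e1 = e1 & e1 *m e1 = e1] /\
    [/\ e1 *m v = v, forall t, headd e1 t = (t == s)%:Z & forall r, chard e1 r = c s r].
Proof.
move=> he ee hv ev hu nuv.
have [a [b [psi [w [ha hb hpsi [e1l e1r] [ww eaw]]]]]] :=
  split_T charkp T_tilting c_mult d_inverse he hv ev hu nuv.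
pose al := e *m a; pose be := psi *m b *m e; pose e1 := al *m be.
have hal : @SL2hom k (tw (T s)) (W n) al by exact: SL2hom_comp he ha.
have hbe : @SL2hom k (W n) (tw (T s)) be by apply: SL2hom_comp he; exact: SL2hom_comp hpsi hb.
have he1 : @SL2hom k (W n) (W n) e1 by exact: SL2hom_comp hal hbe.
have ba : be *m al = 1%:M by rewrite /be /al !mulmxA -[_ *m e *m e]mulmxA ee -!mulmxA -e1l -!mulmxA.
have e1e : e1 *m e = e1 by rewrite /e1 /be -!mulmxA ee.
have ee1 : e *m e1 = e1 by rewrite /e1 /al !mulmxA ee.
have e11 : e1 *m e1 = e1 by rewrite /e1 mulmxA -[al *m be *m al]mulmxA ba mulmx1.
have eal : al *m w = v by rewrite /al -mulmxA eaw.
have e1v : e1 *m v = v by rewrite -eal /e1 mulmxA -[al *m be *m al]mulmxA ba mulmx1.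
have nv : v <> 0 by move=> v0; apply: nuv; rewrite v0 dotp0r.
have wtd q : fixd (@wt n q) e1 = wdim (tw (T s)) q.
  apply: (dimP_iso (X := be) (Y := al)); try exact: weight_subspace.
  - by apply: fix_subspace; exact: weight_subspace.
  - by move=> x [wx _]; exact: weight_hom hbe wx.
  - move=> y wy; split; first exact: weight_hom hal wy.
    by rewrite /e1 mulmxA -[al *m be *m al]mulmxA ba mulmx1.
  - by move=> x [_ ex]; rewrite mulmxA.
  by move=> y _; rewrite mulmxA ba mul1mx.
have top1 : fixd (@wt n (wall s)) e1 = 1%N by rewrite wtd (wdim_tw_top charkp T_tilting c_mult d_inverse).
have sfix (P : 'cV[k]_(dd n) -> Prop) : subspace_pred P -> subspace_pred (fixP P e1) by exact: fix_subspace.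
have sH q : subspace_pred (fixP (@HW k (W n) q) e1) by apply: sfix; exact: HW_subspace.
have sR q : subspace_pred (fixP (@Rad k n q) e1) by apply: sfix; exact: Rad_subspace.
have sW q : subspace_pred (fixP (@wt n q) e1) by apply: sfix; exact: weight_subspace.
have line x : wt (wall s) x -> e1 *m x = x -> exists z, x = z *: v.
  by move=> wx ex; apply: (dimP_line (sW (wall s)) _ nv).2; rewrite ?top1; [split; [exact: hv.1|] | | split].
exists e1; split; split=> // [t|r]; last first.
  by rewrite /chard !wtd (wdim_tw_T charkp T_tilting c_mult) PoszD addrK.
rewrite /headd; case: eqP => [->|ts].
  have -> : fixd (@HW k (W n) (wall s)) e1 = 1%N.
    apply/eqP; rewrite eqn_leq -{1}top1 dimP_le //=; last by move=> x [[wx _] ex].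
    by apply/(dimP_gt0 (sH _)); exists v.
  rewrite [fixd _ _]dimP0 // => x [[[wx _] rx] ex].
  have [z ez] := line x wx ex; have := rx u hu; rewrite ez dotpZr => /eqP.
  by rewrite mulf_eq0 => /orP[/eqP ->|/eqP //]; rewrite scale0r.
suff -> : fixd (@HW k (W n) (wall t)) e1 = fixd (@Rad k n (wall t)) e1 by rewrite subrr.
apply: dimP_eq => // x; split=> [[hx ex]|[[hx _] ex]]; last by split.
split=> //; split=> // y hy; apply: contrapT => nyx; apply: ts.
have [a2 [b2 [psi2 [w2 [ha2 hb2 hpsi2 [p2l p2r] [ww2 eaw2]]]]]] :=
  split_T charkp T_tilting c_mult d_inverse he1 hx ex hy nyx.
pose al' := be *m a2; pose be' := psi2 *m (b2 *m al).
have ba' : be' *m al' = 1%:M.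
  by rewrite /be' /al' -p2l -!mulmxA; congr (_ *m (_ *m _)); rewrite /e1 -!mulmxA.
(* the idempotent endomorphism of tw (T s) that would project onto tw (T t) *)
pose Ps := al' *m be'.
have PP : Ps *m Ps = Ps by rewrite /Ps mulmxA -[al' *m be' *m al']mulmxA ba' mulmx1.
have hal' : @SL2hom k (tw (T t)) (tw (T s)) al' by exact: SL2hom_comp hbe ha2.
have hbe' : @SL2hom k (tw (T s)) (tw (T t)) be'.
  by apply: SL2hom_comp hpsi2 _; exact: SL2hom_comp hb2 hal.
have [[r Pr]|[chi [hchi cP Pc]]] := tw_T_local T_tilting (SL2hom_comp hal' hbe').
  have P0 : Ps = 0.
    have : Ps ^+ r.+1 = Ps.
      elim: (r) => [|r' IH]; first by rewrite expr1.
      by rewrite exprS IH; exact: PP.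
    by rewrite exprS Pr mulr0 => <-.
  case: nyx; have w20 : w2 = 0.
    have : be' *m Ps = be' by rewrite /Ps mulmxA ba' mul1mx.
    by rewrite P0 mulmx0 => b0; rewrite -[w2]mul1mx -ba' -b0 !mul0mx.
  by rewrite -eaw2 w20 mulmx0 dotp0r.
have P1 : al' *m be' = 1%:M.
  by have := congr1 (mulmx chi) PP; rewrite mulmxA cP mul1mx.
have iso : SL2iso (tw (T s)) (tw (T t)) by exists be', al'.
have top := wdim_tw_top charkp T_tilting c_mult d_inverse.
have wle t' q' := @weight_tw_T k p charkp T T_tilting c c_mult t' q'.
have l1 : (wall s <= wall t)%N.
  by have /wdim_gt0/wle : (0 < wdim (tw (T t)) (wall s))%N; rewrite -?(wdim_iso _ iso) ?top.
have l2 : (wall t <= wall s)%N.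
  by have /wdim_gt0/wle : (0 < wdim (tw (T s)) (wall t))%N; rewrite ?(wdim_iso _ iso) ?top.
by apply: (wall_inj charkp); apply/eqP; rewrite eqn_leq l1 l2.
Qed.

(** All highest weights that occur in the image of e are of the form p (s + 1) - 1. *)
Definition walls n (e : 'M[k]_(dd n)) := forall q v, @HW k (W n) q v -> e *m v = v -> v <> 0 ->
  exists s, q = wall s :> int.

Lemma headd_add n e1 e2 s : @SL2hom k (W n) (W n) e1 -> @SL2hom k (W n) (W n) e2 ->
  e1 *m e1 = e1 -> e2 *m e2 = e2 -> e1 *m e2 = 0 -> e2 *m e1 = 0 ->
  headd (e1 + e2) s = headd e1 s + headd e2 s.
Proof.
move=> h1 h2 e11 e22 e12 e21; rewrite /headd !fixd_add ?PoszD //; try exact: HW_subspace; try exact: Rad_subspace.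
- by rewrite opprD addrACA.
- by move=> v; exact: Rad_hom.
- by move=> v; exact: Rad_hom.
- by move=> v; exact: HW_hom.
by move=> v; exact: HW_hom.
Qed.
Lemma chard_add n e1 e2 s : @SL2hom k (W n) (W n) e1 -> @SL2hom k (W n) (W n) e2 ->
  e1 *m e1 = e1 -> e2 *m e2 = e2 -> e1 *m e2 = 0 -> e2 *m e1 = 0 ->
  chard (e1 + e2) s = chard e1 s + chard e2 s.
Proof.
move=> h1 h2 e11 e22 e12 e21; rewrite /chard !fixd_add ?PoszD //; try exact: weight_subspace.
- by rewrite opprD addrACA.
all: by move=> v; exact: weight_hom.
Qed.

(** Induction on the rank of e: a nonzero image contains by [top_pair] two highest
    weight vectors that pair nontrivially, and [summand] splits off a copy of
    tw (T s).  Both sides are additive. *)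
Lemma decomposition n (e : 'M[k]_(dd n)) r : @SL2hom k (W n) (W n) e -> e *m e = e -> walls e ->
  \sum_(s < n.+1) headd e s * c s r = chard e r.
Proof.
have sT : subspace_pred (fun _ : 'cV[k]_(dd n) => True) by [].
move: {2}(fixd (fun _ => True) e) (leqnn (fixd (fun _ => True) e)) => N.
elim: N e => [|N IH] e leN he ee we.
  have h0 (P : 'cV[k]_(dd n) -> Prop) : subspace_pred P -> fixd P e = 0%N.
    move=> sP; apply/eqP; rewrite -leqn0; apply: leq_trans leN; apply: dimP_le; try exact: fix_subspace.
    by move=> v [].
  rewrite /chard !h0; try exact: weight_subspace.
  rewrite subrr; apply: big1 => s _; rewrite /headd !h0; try exact: HW_subspace; try exact: Rad_subspace.
  by rewrite subrr mul0r.
case: (posnP (fixd (fun _ => True) e)) => [e0|pos]; first by apply: IH => //; rewrite e0.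
have [x [_ ex] nx] := (dimP_gt0 (fix_subspace e sT)).1 pos.
have [q [v [u [ev hv hu nuv]]]] := top_pair he ee ex nx.
have nv : v <> 0 by move=> v0; apply: nuv; rewrite v0 dotp0r.
have [s es] := we _ _ hv ev nv; rewrite es in hv hu.
have [e1 [[he1 e1e ee1 e11] [e1v hd ch]]] := summand he ee hv ev hu nuv.
pose e2 := e - e1.
have he2 : @SL2hom k (W n) (W n) e2.
  by rewrite /e2 addrC -scaleN1r; apply: (SL2hom_subspace (W n) (W n)).2.
have e12 : e1 *m e2 = 0 by rewrite mulmxBr e1e e11 subrr.
have e21 : e2 *m e1 = 0 by rewrite mulmxBl ee1 e11 subrr.
have e22 : e2 *m e2 = e2 by rewrite {2}/e2 mulmxBr e21 subr0 mulmxBl ee e1e.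
have e2e : e *m e2 = e2 by rewrite mulmxBr ee ee1.
have eD : e = e1 + e2 by rewrite addrC subrK.
have fT : fixd (fun _ => True) e = (fixd (fun _ => True) e1 + fixd (fun _ => True) e2)%N.
  by rewrite [in LHS]eD fixd_add.
have pos1 : (0 < fixd (fun _ => True) e1)%N by apply/(dimP_gt0 (fix_subspace e1 sT)); exists v.
have ih : \sum_(s < n.+1) headd e2 s * c s r = chard e2 r.
  apply: IH => //; first by move: leN; rewrite fT; lia.
  by move=> q' v' hv' ev' nv'; apply: (we q' v') => //; rewrite -ev' mulmxA e2e.
rewrite eD chard_add // -ih ch; under eq_bigr => t _ do rewrite headd_add // mulrDl.
rewrite big_split /=; congr (_ + _).
have ls : (s < n.+1)%N by have := weight_W_le hv.1 nv; rewrite /wall; have := p_gt1 charkp; nia.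
rewrite (bigD1 (Ordinal ls)) //= hd eqxx mul1r big1 ?addr0 // => t nt.
by rewrite hd (_ : (t == s :> nat) = false) ?mul0r //; apply/negbTE; exact: nt.
Qed.
End Decomposition.

(** * The Casimir operator and the block of the walls *)

Section CasimirAlgebra.
Variables (A : comNzRingType) (m : nat).
Implicit Types e f h u : 'M[A]_m.
(** The Casimir element 4 F E + (H + 1)^2 of the universal enveloping algebra. *)
Definition cas e f h : 'M[A]_m := 4%:R *: (f *m e) + h *m h + 2%:R *: h + 1%:M.
(** Invariance of the Casimir element under the adjoint action of the upper unipotent
    subgroup. *)
Lemma cas_conj (x : A) e f h : h *m e = e *m h + 2%:R *: e ->
  cas e (f + x *: h - x ^+ 2 *: e) (h - (2%:R * x) *: e) = cas e f h.
Proof.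
move=> he; rewrite /cas !(mulmxDl, mulmxDr, mulNmx, mulmxN) -!scalemxAl -!scalemxAr -?scalemxAl he.
move: (f *m e) (e *m h) (e *m e) (h *m h) => fe eh ee hh.
by apply/matrixP=> i j; rewrite !mxE; ring.
Qed.
Lemma cas_mul u e f h e' f' h' : u *m e = e' *m u -> u *m f = f' *m u -> u *m h = h' *m u ->
  u *m cas e f h = cas e' f' h' *m u.
Proof.
move=> ue uf uh; rewrite /cas !mulmxDr !mulmxDl mulmx1 mul1mx -!scalemxAr -!scalemxAl.
by rewrite !mulmxA uf uh -!mulmxA ue uh.
Qed.
End CasimirAlgebra.

Section Casimir.
Variable k : fieldType.
Notation W := (W k).
Notation dd n := (sldim (W n)).
Notation Eo := (Eo k). Notation Fo := (Fo k). Notation Ho := (Ho k).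

Definition Cas n : 'M[k]_(dd n) := cas (Eo n) (Fo n) (Ho n).
Lemma Cas_T n : (Cas n)^T = Cas n.
Proof. by rewrite /Cas /cas !linearD /= !linearZ /= !trmx_mul Eo_T Fo_T Ho_T trmx1. Qed.
Lemma ext_cas (A : comAlgType k) m (e f h : 'M[k]_m) : ext A (cas e f h) = cas (ext A e) (ext A f) (ext A h).
Proof.
rewrite /cas !extD !extM !extZ ext1 !extM; congr (_ *: _ + _ + _ *: _ + _).
  by rewrite -[LHS]/(in_alg A 4%:R) rmorph_nat.
by rewrite -[LHS]/(in_alg A 2%:R) rmorph_nat.
Qed.
(** Equivariance for the upper unipotent subgroup is [cas_conj]; transposition gives the
    lower one, as the Casimir operator is symmetric. *)
Lemma Cas_hom n : @SL2hom k (W n) (W n) (Cas n).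
Proof.
have hu : homat (M := W n) (N := W n) (Cas n) (up ('X : {poly k})).
  rewrite /homat ext_cas; apply/esym; set u := slact _ _.
  rewrite (cas_mul (U_E _ n) (U_F _ n) (U_H _ n)) cas_conj // -!extM HE_comm extD extZ extM.
  by congr (_ + _ *: _); rewrite -[LHS]/(in_alg {poly k} 2%:R) rmorph_nat.
apply: SL2hom_generic => //; rewrite /homat.
have := congr1 trmx hu; rewrite !trmx_mul !W_T tr_up -extT Cas_T => <- //.
Qed.
Lemma Cas_weight n (q : int) v : @weight_vector k (W n) q v ->
  Cas n *m v = 4%:R *: (Fo n *m (Eo n *m v)) + ((q + 1)%:~R ^+ 2) *: v.
Proof.
move=> w; rewrite /Cas /cas !mulmxDl -!scalemxAl -!mulmxA mul1mx (Ho_weight w) -scalemxAr (Ho_weight w).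
rewrite -!addrA; congr (_ + _); rewrite !scalerA.
by apply/matrixP=> i j; rewrite !mxE rmorphD /=; ring.
Qed.
Lemma Cas_weight2 n (q : int) v : @weight_vector k (W n) (q + 2) v ->
  Cas n *m v = 4%:R *: (Eo n *m (Fo n *m v)) + ((q + 1)%:~R ^+ 2) *: v.
Proof.
move=> w; rewrite (Cas_weight w) [Eo n *m (Fo n *m v)]mulmxA EF_comm mulmxDl -mulmxA (Ho_weight w).
rewrite scalerDr -[RHS]addrA; congr (_ + _); rewrite scalerA.
by apply/matrixP=> i j; rewrite !mxE !rmorphD /=; ring.
Qed.
End Casimir.

Section Block.
Variables (k : fieldType) (p : nat).
Hypothesis charkp : p \in [pchar k].
Notation W := (W k).
Notation dd n := (sldim (W n)).
Notation wall := (wall p).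

Lemma natz_eq0 (q : nat) : ((q%:Z)%:~R == 0 :> k) = (p %| q)%N.
Proof. by rewrite (dvdn_pcharf charkp). Qed.
Lemma wall_eq0 s : ((wall s)%:Z + 1)%:~R = 0 :> k.
Proof.
apply/eqP; have -> : (wall s)%:Z + 1 = (p * s.+1)%N%:Z by rewrite /wall; have := p_gt1 charkp; nia.
by rewrite natz_eq0 dvdn_mulr.
Qed.

(** On a highest weight vector of weight q the Casimir operator is (q + 1)^2, which
    vanishes if and only if q is a wall, so e is the projection onto its generalised
    kernel.  On the complementary summand the operator is invertible, and for a wall
    q it is 4 F E on weight q and 4 E F on weight q + 2, so that E is bijective
    between these weight spaces and the complement does not contribute to the jump
    of the character at q. *)
Lemma block_idem n : exists e : 'M[k]_(dd n), [/\ @SL2hom k (W n) (W n) e, e *m e = e, @walls k p n e,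
  (forall s v, @HW k (W n) (wall s) v -> e *m v = v) &
  forall r, chard p e r = (wdim (W n) (wall r))%:Z - (wdim (W n) ((wall r)%:Z + 2))%:Z].
Proof.
have [||||e [Z [N [he hZ eZ ee eN]]]] := @fitting k _ (Cas k n) (@SL2hom k (W n) (W n)).
- exact: SL2hom1.
- by move=> c A B; apply: (SL2hom_subspace _ _).2.
- by move=> A B; apply: SL2hom_comp.
- exact: Cas_hom.
pose f : 'M[k]_(dd n) := 1%:M - e.
have hf : @SL2hom k (W n) (W n) f.
  by rewrite /f addrC -scaleN1r; apply: (SL2hom_subspace _ _).2 => //; exact: SL2hom1.
have ef : e *m f = 0 by rewrite mulmxBr mulmx1 ee subrr.
have fe : f *m e = 0 by rewrite mulmxBl mul1mx ee subrr.
have ff : f *m f = f by rewrite {2}/f mulmxBr mulmx1 fe subr0.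
exists f; split=> //.
- move=> q v hv fv nv.
  have cv : Cas k n *m v = (q + 1)%:~R ^+ 2 *: v.
    by rewrite (Cas_weight hv.1) (upfix_E hv.2) mulmx0 scaler0 add0r.
  have cN : Cas k n ^+ N *m v = ((q + 1)%:~R ^+ 2) ^+ N *: v.
    elim: (N) => [|r IH]; first by rewrite !expr0 scale1r; exact: mul1mx.
    by rewrite exprSr -[_ * Cas k n]/(_ *m Cas k n) -mulmxA cv -scalemxAr IH scalerA -exprS.
  have : Cas k n ^+ N *m v = 0 by rewrite -fv mulmxA eN mul0mx.
  rewrite cN => /eqP; rewrite scaler_eq0 !expf_eq0 /= => /orP[/andP[_ q0]|/eqP //].
  case: q q0 hv {cv cN} => q q0 hv; last by case: nv; exact: HW_neg hv _.
  have : (p %| q.+1)%N by rewrite -natz_eq0 -addn1 PoszD.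
  move=> /dvdnP[[|s] es]; first by rewrite mul0n in es.
  by exists s; rewrite /wall; congr Posz; have := p_gt1 charkp; nia.
- move=> s v hv; rewrite mulmxBl mul1mx eZ -mulmxA (Cas_weight hv.1) (upfix_E hv.2) wall_eq0.
  by rewrite mulmx0 expr0n scaler0 scale0r addr0 mulmx0 subr0.
move=> r; have sW q : subspace_pred (@wt k n q) by exact: weight_subspace.
have add q : wdim (W n) q = (fixd (@wt k n q) e + fixd (@wt k n q) f)%N.
  rewrite -fixd_add //; try by move=> v; exact: weight_hom.
  apply: dimP_eq; first exact: weight_subspace.
    by apply: fix_subspace; exact: weight_subspace.
  by move=> v; split=> [w|[w _] //]; split=> //; rewrite addrC subrK mul1mx.
rewrite /chard !add.
suff -> : fixd (@wt k n (wall r)) e = fixd (@wt k n ((wall r)%:Z + 2)) e by lia.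
have hE (X : 'M[k]_(dd n)) : @SL2hom k (W n) (W n) X -> X *m Eo k n = Eo k n *m X by move/(Ec_hom 1).
(* on the complement E is inverted by 4 Z F, where Z inverts the Casimir operator *)
apply: (dimP_iso (X := Eo k n) (Y := e *m (Z *m (4%:R *: Fo k n)))); try exact: fix_subspace.
- move=> v [w ev]; split; first by have := weight_E 1 w; rewrite muln1.
  by rewrite mulmxA hE // -mulmxA ev.
- move=> v [w ev]; split; last by rewrite !mulmxA ee.
  rewrite -!mulmxA; apply: weight_hom he _; apply: weight_hom hZ _; rewrite -scalemxAl; apply: weightZ.
  by have := weight_F 1 w; rewrite muln1 addrK.
- move=> v [w ev]; have := Cas_weight w; rewrite wall_eq0 expr0n scale0r addr0 => cv.
  by rewrite -!mulmxA -scalemxAl -cv [Z *m _]mulmxA -eZ !ev.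
move=> v [w ev]; have := Cas_weight2 w; rewrite wall_eq0 expr0n scale0r addr0 => cv.
rewrite -!mulmxA mulmxA -(hE e he) -mulmxA [Eo k n *m (Z *m _)]mulmxA -(hE Z hZ) -mulmxA -scalemxAl -scalemxAr -cv.
by rewrite [Z *m _]mulmxA -eZ !ev.
Qed.

End Block.

Section PathCount.
Variable k : fieldType.
Notation W := (W k).
Notation dd n := (sldim (W n)).
Lemma wdim_W0 r : wdim (W 0) r = (r == 0).
Proof.
case: eqP => [->|ne]; last first.
  by apply: dimP0; [exact: weight_subspace | move=> v w; exact: weight_uniq w (weight_triv v) ne].
apply/(dimP_line (v := 1%:M)); first exact: weight_subspace.
- exact: weight_triv.
- by move=> /matrixP/(_ 0 0)/eqP; rewrite !mxE oner_eq0.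
by move=> w _; exists (w 0 0); apply/matrixP=> i j; rewrite !ord1 !mxE mulr1.
Qed.
Lemma wdim_WS n r : wdim (W n.+1) r = (wdim (W n) (r - 1) + wdim (W n) (r + 1))%N.
Proof.
apply: (@dim_slices k (dd n) (dd n)); try exact: weight_subspace.
- move=> v; split=> [/(@weight_VM k (W n))[]//|w]; apply/(@weight_VM k (W n)); split=> //; exact: weight0.
- by move=> v; rewrite -{1}[v](@vsubmxK k (dd n) (dd n)) => /(@weight_VM k (W n))[].
by move=> v w; exists 0; apply/(@weight_VM k (W n)); split=> //; exact: weight0.
Qed.
Lemma wdim_W_sym n r : wdim (W n) (- r) = wdim (W n) r.
Proof.
elim: n r => [|n IH] r; first by rewrite !wdim_W0 oppr_eq0.
rewrite !wdim_WS; have -> : - r - 1 = - (r + 1) by lia.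
have -> : - r + 1 = - (r - 1) by lia.
by rewrite !IH addnC.
Qed.
(** The reflection principle: the dimensions of the weight spaces are binomial
    coefficients, and their jumps satisfy the recursion of the path numbers, the
    boundary condition at -1 being the symmetry of the weights. *)
Lemma wdim_path n (q : int) : 0 <= q -> (wdim (W n) q)%:Z - (wdim (W n) (q + 2))%:Z = path_number n q.
Proof.
elim: n q => [|n IH] q q0.
  by rewrite !wdim_W0 /= (_ : (q + 2 == 0) = false) ?subr0 //; lia.
rewrite !wdim_WS /= (_ : (q < 0)%R = false); last by lia.
rewrite -[path_number n (q + 1)]IH; last by lia.
have e1 : q + 1 + 2 = q + 2 + 1 by lia.
have e2 : q + 2 - 1 = q + 1 by lia.
rewrite e1 e2; case: (eqVneq q 0) => [->|ne]; last first.
  have -> : path_number n (q - 1) = (wdim (W n) (q - 1))%:Z - (wdim (W n) (q + 1))%:Z.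
    rewrite -IH; last by lia.
    by congr (_ - (wdim _ _)%:Z); lia.
  lia.
have -> : path_number n (0 - 1) = 0 by case: (n).
rewrite sub0r wdim_W_sym !add0r; move: (wdim _ _) (wdim _ _) => a b; lia.
Qed.
End PathCount.

(** * The recursion for the dimensions *)

Section Final.
Variables (k : fieldType) (p : nat).
Hypothesis charkp : p \in [pchar k].
Variable T : nat -> SL2mod k.
Hypothesis T_tilting : forall r : nat, indecomposable_tilting (T r) r.
Variable c : nat -> nat -> nat.
Hypothesis c_mult : forall r s : nat, weyl_mult (T r) s (c r s).
Variable d : nat -> nat -> int.
Hypothesis d_inverse : inverse_lower c d.
Notation W := (W k).
Notation dd n := (sldim (W n)).
Notation wall := (wall p).

(** The two computations of the character of the wall block of W n. *)
Lemma wall_path n r : \sum_(s < n.+1) (Ddim k n (wall s))%:Z * c s r = path_number n (wall r).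
Proof.
have [e [he ee we hw ch]] := block_idem charkp n.
rewrite -(wdim_path k) // -ch -(decomposition charkp T_tilting c_mult d_inverse) //.
apply: eq_bigr => s _; congr (_ * _).
rewrite /Ddim /headd -subzn; last exact: raddim_le.
congr (_%:Z - _%:Z); apply: dimP_eq.
- exact: HW_subspace.
- by apply: fix_subspace; exact: HW_subspace.
- by move=> v; split=> [h|[h _]] //; split=> //; exact: hw h.
- exact: Rad_subspace.
- by apply: fix_subspace; exact: Rad_subspace.
by move=> v; split=> [h|[h _]] //; split=> //; apply: hw h.1.
Qed.

Lemma Ddim_gt n (q : int) : n%:Z < q -> Ddim k n q = 0%N.
Proof.
move=> lt; rewrite /Ddim; have -> : hwdim k n q = 0%N; last by [].
apply: dimP0; first exact: HW_subspace.
move=> v [w _]; apply: contrapT => nv; have := weight_W_le w nv; lia.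
Qed.
Lemma Ddim_neg n (q : int) : q < 0 -> Ddim k n q = 0%N.
Proof.
move=> lt; rewrite /Ddim; have -> : hwdim k n q = 0%N; last by [].
by apply: dimP0; [exact: HW_subspace | move=> v h; exact: HW_neg h lt].
Qed.

(** The relation [wall_path] multiplied by the inverse matrix d; the sums are finite
    because c is lower triangular. *)
Lemma Ddim_wall n s : (Ddim k n (wall s))%:Z = \sum_(r < n.+1) path_number n (wall r) * d r s.
Proof.
have [d0 cd _] := d_inverse.
under eq_bigr => r _ do rewrite -wall_path mulr_suml.
rewrite exchange_big /=.
have inner (t : 'I_n.+1) : \sum_(r < n.+1) (Ddim k n (wall t))%:Z * c t r * d r s = (Ddim k n (wall t))%:Z * (t == s :> nat)%:Z.
  under eq_bigr => r _ do rewrite -mulrA.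
  rewrite -mulr_sumr -cd; congr (_ * _).
  rewrite (big_ord_widen n.+1 (fun r => (c t r)%:Z * d r s) (ltn_ord t)) [RHS]big_mkcond /=.
  apply: eq_bigr => r _; case: ltnP => // lt; by rewrite (c_lower charkp T_tilting c_mult) ?mul0r.
under eq_bigr => t _ do rewrite inner.
case: (ltnP s n.+1) => h.
  rewrite (bigD1 (Ordinal h)) //= eqxx mulr1 big1 ?addr0 // => t nt.
  by rewrite (_ : (t == s :> nat) = false) ?mulr0 //; apply/negbTE; exact: nt.
rewrite big1 => [|t _]; last by rewrite (_ : (t == s :> nat) = false) ?mulr0 //; have := ltn_ord t; lia.
by rewrite Ddim_gt // /wall; have := p_gt1 charkp; nia.
Qed.

Lemma Ddim_0 m : Ddim k 0 (m : nat) = (m == 0%N).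
Proof.
case: m => [|m]; last by rewrite Ddim_gt.
have HWall (v : 'cV[k]_(dd 0)) : @HW k (W 0) 0 v.
  split; first exact: weight_triv.
  by rewrite /upfix mul1mx.
have -> : Ddim k 0 0 = (dimP (@HW k (W 0) 0) - dimP (@Rad k 0 0))%N by [].
rewrite [dimP (@Rad _ _ _)]dimP0; [|exact: Rad_subspace|]; last first.
  move=> v [_ rv]; apply/matrixP=> i j; have := rv (delta_mx i 0) (HWall _).
  by rewrite dotp_delta [j]ord1 mxE.
rewrite subn0; apply/(dimP_line (v := 1%:M)); first exact: HW_subspace.
- exact: HWall.
- by move=> /matrixP/(_ 0 0)/eqP; rewrite !mxE oner_eq0.
by move=> w _; exists (w 0 0); apply/matrixP=> i j; rewrite !ord1 !mxE mulr1.
Qed.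

Lemma p_path_neg n (m : int) : m < 0 -> p_path_number p d n m = 0.
Proof. by case: n => [|n] h /=; [case: eqP => // e; lia | rewrite h]. Qed.

Local Arguments path_number : simpl never.

(** The case m = 0 is excluded for p = 2 and n > 0, where the form vanishes on H(n, 0)
    but the path number counts D(n - 1, 1). *)
Lemma p_path_Ddim n (m : nat) : odd m = odd n -> [|| (0 < m)%N, n == 0%N | p != 2%N] ->
  p_path_number p d n m = (Ddim k n m)%:Z.
Proof.
have p1 := p_gt1 charkp.
elim: n m => [|n IH] m par h; first by rewrite Ddim_0 /=; case: m {par h}.
rewrite [LHS]/=.
have IHs : p_path_number p d n (m%:Z + 1) = (Ddim k n (m%:Z + 1))%:Z.
  by rewrite -PoszD; apply: IH; rewrite addn1 //= par /= negbK.
have IHp : ~~ ((p == 2%N) && (m == 1%N) && (n != 0%N)) -> p_path_number p d n (m%:Z - 1) = (Ddim k n (m%:Z - 1))%:Z.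
  case: m par h IHs => [|m] par h IHs nh; first by rewrite p_path_neg // Ddim_neg.
  have -> : m.+1%:Z - 1 = m by lia.
  apply: IH; first by move: par => /= /negb_inj.
  by move: nh; case: (m) => //=; case: eqP => //= _; case: eqP.
have rec (r : k) : r * (m%:Z + 1)%:~R = 1 -> Ddim k n.+1 m = (Ddim k n (m%:Z - 1)%R + ((m%:Z + 2)%:~R != 0%R :> k) * Ddim k n (m%:Z + 1)%R)%N.
  exact: Ddim_rec.
have div1 : ((m%:Z + 1)%:~R == 0 :> k) = (p %| m.+1)%N.
  by have -> : m%:Z + 1 = m.+1%:Z; [lia | exact: natz_eq0].
have div2 : ((m%:Z + 2)%:~R == 0 :> k) = (p %| m.+2)%N.
  by have -> : m%:Z + 2 = m.+2%:Z; [lia | exact: natz_eq0].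
have dvE : (p %| m%:Z + 1)%Z = (p %| m.+1)%N by rewrite dvdzE; congr (_ %| _)%N; lia.
rewrite [(m + 1)%N]addn1 dvE; case: (posnP m) => [m0|m0]; last first.
  have -> : (0 < m%:Z) by lia.
  rewrite /=; case: ifP => [/dvdnP[s' es]|ndv].
    case: s' es => [|s] es; first by rewrite mul0n in es.
    have -> : m = wall s by rewrite /wall; nia.
    rewrite Ddim_wall; have -> : ((wall s).+1 %/ p).-1 = s.
      by have -> : (wall s).+1 = (s.+1 * p)%N; [rewrite /wall; nia | rewrite mulnK //; lia].
    apply: eq_bigr => r _; congr (path_number _ _ * _); rewrite /wall; nia.
  have ne : (m%:Z + 1)%:~R != 0 :> k by rewrite div1 ndv.
  (* for p = 2 and m = 1 the first case applies *)
  have par2 : ~~ ((p == 2%N) && (m == 1%N) && (n != 0%N)).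
    apply/negP => /andP[/andP[/eqP ep /eqP em] _]; by move: ndv; rewrite ep em.
  rewrite (rec _ (mulVf ne)) div2 IHp // IHs.
  have -> : (m%:Z == -2 %[mod p])%Z = (p %| m.+2)%N.
    by rewrite eqz_mod_dvd opprK dvdzE; congr (_ %| _)%N; lia.
  by case: ifP => _ /=; rewrite ?mul0n ?addn0 ?mul1n ?PoszD.
have -> : (0 < m%:Z) = false by lia.
rewrite /= IHs IHp; last by rewrite m0 andbF.
have p2 : p != 2%N by move: h; rewrite m0.
rewrite (rec 1); last by rewrite m0 add0r mul1r.
rewrite div2 m0 (_ : (p %| 2)%N = false) ?mul1n ?PoszD //.
by apply/negP => /dvdn_leq; lia.
Qed.

Lemma p_path_fddim n m : m \in Lambda n -> (fddim (simple_module k n m))%:Z = p_path_number p d n m%:Z.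
Proof.
move=> L; have /andP[le /eqP par] := L.
case: (boolP ((0 < m) || (n == 0)))%N => h.
  rewrite fddim_Rad // p_path_Ddim //; by case/orP: h => ->; rewrite ?orbT.
move: h; rewrite negb_or -eqn0Ngt => /andP[/eqP m0 n0]; subst m.
case: n n0 par L le => [|[|n]] // _ par _ _.
rewrite fddim_zero; last by move: par => /=; case: (odd n).
rewrite -[RHS]/(p_path_number p d n.+1 (0 - 1) + p_path_number p d n.+1 (0 + 1)) p_path_neg // !add0r.
by rewrite -[RHS]/(p_path_number p d n.+1 1%N) p_path_Ddim //; move: par => /=; case: (odd n).
Qed.
End Final.

Theorem proposition6p4 (k : fieldType) (p : nat) (charkp : p \in [pchar k])
    (T : nat -> SL2mod k)
    (T_tilting : forall r : nat, indecomposable_tilting (T r) r)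
    (c : nat -> nat -> nat)
    (c_mult : forall r s : nat, weyl_mult (T r) s (c r s))
    (d : nat -> nat -> int) (d_inverse : inverse_lower c d)
    (n m : nat) (m_Lambda : m \in Lambda n) :
  (fddim (simple_module k n m))%:Z = p_path_number p d n m%:Z.
Proof. exact: (p_path_fddim charkp T_tilting c_mult d_inverse). Qed.
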